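(* Let $H$ be a connected digraph with maximum degree $\Delta\ge2$ and let $\delta>0$. Then as $p\to0$, \[ \frac{\Phi_p(H,\delta)}{p^\Delta\log(1/p)}\ge\begin{cases}G(H,\delta)+o(1)&\text{if $H$ is irregular},\\ \min\big(G(H,\delta),\delta^{2/\mathsf v(H)}\big)+o(1)&\text{if $H$ is regular.}\end{cases} \] Furthermore, the infimum $G(H,\delta)$ is obtained when $y_1\vee y_2=1$, i.e. restricting the infimum defining $G(H,\delta)$ to points with $\max(y_1,y_2)=1$ does not change its value.
   Context: A digraph $H=(\mathsf V,\mathsf E)$ has no self-loops and at most one directed edge per ordered pair of vertices; $\mathsf v(H)=|\mathsf V(H)|$, $\mathsf e(H)=|\mathsf E(H)|$. The degree of a vertex is its in-degree plus out-degree; $\Delta$ is the maximum degree; $H$ is regular if all vertices have the same degree, irregular otherwise. Connectedness refers to the underlying undirected graph. A directed graphon is a measurable $W:[0,1]^2\to[0,1]$ (not necessarily symmetric). $t(H,W)=\int_{[0,1]^{\mathsf v(H)}}\prod_{(i,j)\in\mathsf E(H)}W(x_i,x_j)\,dx$. With $I_p(x)=x\log\frac xp+(1-x)\log\frac{1-x}{1-p}$ and $\mathbb E[I_p(W)]=\int_{[0,1]^2}I_p(W(x,y))\,dx\,dy$, define \[ \Phi_p(H,\delta)=\inf\{\mathbb E[I_p(W)]: W\text{ a directed graphon with }t(H,W)\ge(1+\delta)p^{\mathsf e(H)}\}. \] $H^*$ is the induced subgraph of $H$ on vertices of degree $\Delta$; $\mathcal S_H$ is the collection of all independent sets of $H^*$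 (including $\emptyset$). For $S\in\mathcal S_H$ let $T=\mathsf N(S)$ be the set of vertices outside $S$ adjacent (in either direction) to some vertex of $S$, let $\mathsf E(S,T)$ (resp. $\mathsf E(T,S)$) be the set of edges of $H$ from $S$ to $T$ (resp. from $T$ to $S$), and let $F_S$ be the bipartite digraph with vertex set $S\cup T$ and edge set $\mathsf E(S,T)\cup\mathsf E(T,S)$. A maximum fractional matching of $F_S$ is a function $w:\mathsf E(F_S)\to[0,1]$ with $\sum_{e\ni v}w(e)\le1$ for every vertex $v$ of $F_S$ and $\sum_{e\ni v}w(e)=1$ for every $v\in S$. Define \[ a_S=\max_w\sum_{e\in\mathsf E(S,T)}w(e),\qquad b_S=\max_w\sum_{e\in\mathsf E(T,S)}w(e), \] maxima over maximum fractional matchings $w$ of $F_S$. Let $\mathsf v^+(S)$, $\mathsf v^-(S)$, $\mathsf v^{\pm}(S)$ be the numbers of vertices of $S$ with, respectively, no in-neighbours, no out-neighbours, and both in- and out-neighbours in $H$. Set \[ g_H(x_1,x_2,y_1,y_2)=\sum_{S\in\mathcal S_H}x_1^{\mathsf v^+(S)}x_2^{\mathsf v^-(S)}(x_1\wedge x_2)^{\mathsf v^{\pm}(S)}y_1^{a_S}y_2^{b_S}, \] \[ G(H,\delta)=\inf_{x_1,x_2\ge0,\ 0\le y_1,y_2\le1}\{x_1y_1+x_2y_2: g_H(x_1,x_2,y_1,y_2)=1+\delta\}. \] *)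

(* Defs.v *)
From HB Require Import structures.
From mathcomp Require Import all_boot all_order all_algebra.
From mathcomp Require Import all_classical all_reals all_analysis.
Set Implicit Arguments. Unset Strict Implicit. Unset Printing Implicit Defensive.
Import Order.TTheory GRing.Theory Num.Theory.
Import numFieldNormedType.Exports.
Local Open Scope classical_set_scope.
Local Open Scope ring_scope.

(* A digraph on vertex set 'I_n is a relation E : rel 'I_n (E u v = edge u -> v);
   no self-loops is the hypothesis [irreflexive E]; a relation has at most one
   edge per ordered pair automatically. *)
Section Digraph.
Variables (n : nat) (E : rel 'I_n).

Definition nedges : nat := #|[set uv : 'I_n * 'I_n | E uv.1 uv.2]|.

Definition outdeg (v : 'I_n) : nat := #|[set u | E v u]|.
Definition indeg (v : 'I_n) : nat := #|[set u | E u v]|.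
Definition deg (v : 'I_n) : nat := (indeg v + outdeg v)%N.
Definition maxdeg : nat := (\max_(v : 'I_n) deg v)%N.

Definition regular : Prop := forall u v : 'I_n, deg u = deg v.

Definition connected_digraph : Prop :=
  forall u v : 'I_n, connect [rel x y | E x y || E y x] u v.

Definition indepHstar (S : {set 'I_n}) : bool :=
  [forall v in S, deg v == maxdeg] && [forall u in S, forall v in S, ~~ E u v].

Definition nbhd (S : {set 'I_n}) : {set 'I_n} :=
  [set v | (v \notin S) && [exists u in S, E u v || E v u]].

Definition edgeST (S : {set 'I_n}) (u v : 'I_n) : bool :=
  [&& E u v, u \in S & v \in nbhd S].
Definition edgeTS (S : {set 'I_n}) (u v : 'I_n) : bool :=
  [&& E u v, u \in nbhd S & v \in S].
Definition edgeF (S : {set 'I_n}) (u v : 'I_n) : bool :=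
  edgeST S u v || edgeTS S u v.

Definition load {R : realType} (S : {set 'I_n}) (w : 'I_n -> 'I_n -> R)
    (v : 'I_n) : R :=
  \sum_(u | edgeF S u v) w u v + \sum_(u | edgeF S v u) w v u.

(* w : E(F_S) -> [0,1] is a maximum fractional matching of F_S
   (only the values of w on edges of F_S are relevant) *)
Definition max_frac_matching {R : realType} (S : {set 'I_n})
    (w : 'I_n -> 'I_n -> R) : Prop :=
  [/\ forall u v, edgeF S u v -> 0 <= w u v <= 1,
      forall v, load S w v <= 1 &
      forall v, v \in S -> load S w v = 1].

Definition aS {R : realType} (S : {set 'I_n}) : R :=
  sup [set s | exists w : 'I_n -> 'I_n -> R,
         max_frac_matching S w /\ s = \sum_u \sum_(v | edgeST S u v) w u v].

Definition bS {R : realType} (S : {set 'I_n}) : R :=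
  sup [set s | exists w : 'I_n -> 'I_n -> R,
         max_frac_matching S w /\ s = \sum_u \sum_(v | edgeTS S u v) w u v].

Definition vplus (S : {set 'I_n}) : nat := #|[set v in S | indeg v == 0%N]|.
Definition vminus (S : {set 'I_n}) : nat := #|[set v in S | outdeg v == 0%N]|.
Definition vpm (S : {set 'I_n}) : nat :=
  #|[set v in S | (0 < indeg v)%N && (0 < outdeg v)%N]|.

Definition gH {R : realType} (x1 x2 y1 y2 : R) : R :=
  \sum_(S : {set 'I_n} | indepHstar S)
     x1 ^+ vplus S * x2 ^+ vminus S * (Num.min x1 x2) ^+ vpm S
     * y1 `^ aS S * y2 `^ bS S.

Definition GHdelta {R : realType} (delta : R) : R :=
  inf [set z | exists x1 x2 y1 y2 : R,
        [/\ 0 <= x1, 0 <= x2, 0 <= y1 <= 1 & 0 <= y2 <= 1] /\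
        gH x1 x2 y1 y2 = 1 + delta /\ z = x1 * y1 + x2 * y2].

Definition GHdelta_y1 {R : realType} (delta : R) : R :=
  inf [set z | exists x1 x2 y1 y2 : R,
        [/\ 0 <= x1, 0 <= x2, 0 <= y1 <= 1 & 0 <= y2 <= 1] /\
        Num.max y1 y2 = 1 /\
        gH x1 x2 y1 y2 = 1 + delta /\ z = x1 * y1 + x2 * y2].

End Digraph.

Section Graphon.
Variable R : realType.
Local Open Scope ereal_scope.

Definition unit_itv : set R := `[0%R, 1%R].

(* a directed graphon, represented as a function R -> R -> R; only its values
   on [0,1]^2 matter.  Measurability is w.r.t. the product sigma-algebra of
   the Borel sets of R. *)
Definition graphon (W : R -> R -> R) : Prop :=
  measurable_fun [set: R * R] (fun z : R * R => W z.1 z.2) /\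
  (forall x y, (0 <= W x y <= 1)%R).

(* iterated Lebesgue integral over [0,1]^k of F, on coordinates 0..k-1
   (by Tonelli, equal to the integral over [0,1]^k for nonnegative
   measurable F) *)
Fixpoint iter_int (k : nat) (F : (nat -> R) -> \bar R) (x : nat -> R) : \bar R :=
  match k with
  | 0%N => F x
  | k'.+1 => \int[lebesgue_measure]_(u in unit_itv)
               iter_int k' F (fun i => if i == k' then u else x i)
  end.

Definition tHW (n : nat) (E : rel 'I_n) (W : R -> R -> R) : \bar R :=
  iter_int n (fun x => (\prod_(i : 'I_n) \prod_(j : 'I_n | E i j)
                          W (x (nat_of_ord i)) (x (nat_of_ord j)))%R%:E)
           (fun _ => 0%R).

Definition xlogx (x p : R) : R := if x == 0%R then 0%R else (x * ln (x / p))%R.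

Definition Ip (p x : R) : R := (xlogx x p + xlogx (1 - x) (1 - p))%R.

Definition EIp (p : R) (W : R -> R -> R) : \bar R :=
  \int[lebesgue_measure]_(x in unit_itv)
    \int[lebesgue_measure]_(y in unit_itv) (Ip p (W x y))%:E.

Definition Phi (n : nat) (E : rel 'I_n) (p delta : R) : \bar R :=
  ereal_inf [set EIp p W | W in [set W | graphon W /\
             ((1 + delta) * p ^+ nedges E)%:E <= tHW E W]].

End Graphon.

(* Phi_p(H,delta) / (p^Delta log(1/p)) >= c + o(1) as p -> 0+ :
   for every eps > 0, for all sufficiently small p > 0,
   Phi_p(H,delta) >= (c - eps) p^Delta log(1/p). *)
Definition asymp_lower_bound (R : realType) (n : nat) (E : rel 'I_n)
    (delta c : R) : Prop :=
  forall eps : R, (0 < eps)%R ->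
    exists p0 : R, (0 < p0)%R /\
      forall p : R, (0 < p < p0)%R ->
        ((c - eps)%:E * (p ^+ maxdeg E * ln (1 / p))%:E <= Phi E p delta)%E.

(* Main.v *)
Require Import Defs.
From HB Require Import structures.
From mathcomp Require Import all_boot all_order all_algebra.
From mathcomp Require Import all_classical all_reals all_analysis.
From mathcomp Require Import measurable_realfun ring lra.

(* Proof idea.  Write [q = p ^ Delta], [L = ln (1/p)], and let [W] have entropy
   at most [K q L].  The values of [W] above [L ^- 2] form a kernel [A] with
   entropy at least about [L * int A], while the smaller values exceed [p] so
   little that their contribution to any subgraph count is negligible by Hoelder.
   Split the points of [0, 1] into hubs (degree in [A] at least [bh]) and low
   vertices (degree below [bl]), where the two scales, with [bl] much smaller
   than [bh], are chosen by pigeonhole so that the points in between carry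
   almost no mass.  Expanding [t(H, W)] over the edges gives one term for each
   labelling of the edges by [p], by the negligible part, or by the part of [A]
   between two classes of points.

   Every term is estimated by Finner's inequality with edge weights close to the
   constant [1 / Delta], under which every term is [O(p ^ e(H))].  A term with an
   edge between two low vertices gains a power of [bl] (or of [bl / bh]) as soon
   as its component has a vertex of degree less than [Delta] or a hub: shifting
   the weights alternately along a walk creates slack at an end of that edge,
   where degrees in [A] are small.  Hubs have measure [O(q)], which kills the
   terms with a hub of degree less than [Delta].  What remains is the term where
   all vertices are low, which needs [H] regular and is at most [eta ^ (v/2)], and
   the terms where the hubs form a set [S] in [S_H] and the labelled edges are
   those of [F_S]; Finner's inequality with an arbitrary maximum fractional
   matching bounds the latter by [th1 ^ a * th2 ^ b], with [th1], [th2] the masses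
   leaving and entering hubs.  Optimizing over matchings yields exactly the
   summand of [g_H] at [x1 = x2 = max th1 th2] and [y_i = th_i / x_i]. *)

Set Implicit Arguments. Unset Strict Implicit. Unset Printing Implicit Defensive.
Import Order.TTheory GRing.Theory Num.Theory.
Import numFieldNormedType.Exports.
Local Open Scope classical_set_scope.
Local Open Scope ring_scope.

(** * Integrating bounded functions of finitely many variables *)

(** The threshold [L ^- 2] serves both sides. Above it [ln (x / p)] is still [(1 - o(1)) L]; below
    it [(x - p) ^ 2 <= 4 x I_p(x)] bounds the integral of the squared excess by [O(q / L)], and
    since [Delta >= 2] this also controls the [Delta]-th power that Hoelder's inequality with
    weights [1 / Delta] asks for.

    The obstacle is that these weights give every labelling the full order [p ^ e(H)], so each
    unwanted labelling needs a gain of its own. Where an edge between low vertices is joined to a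
    hub, that gain is a power of (hub measure) * [bl / q], and the hub measure is only known to be
    [O(q / bh)]: what counts is the ratio [bl / bh]. A single cut would gain nothing, hence two cuts
    in a fixed ratio, with a pigeonhole over boundedly many scales to make the mass between them
    small.

    All scales are fixed before [p]. Every factor is shifted by a small [eps], so that Finner's
    inequality is applied only to functions bounded away from 0 and the masses [th1], [th2], [eta]
    are positive. *)

Section Integration.
Variable R : realType.
Local Notation mu := (@lebesgue_measure R).
Local Notation D := (@unit_itv R).
Implicit Types (x : nat -> R) (F G : (nat -> R) -> R) (f g : R -> R).

Definition bounded_measurable f :=
  measurable_fun setT f /\ exists C, forall u, 0 <= f u <= C.

Lemma measurable_unit_itv : measurable D.
Proof. exact: measurable_itv. Qed.
Hint Resolve measurable_unit_itv : core.

Lemma measure_unit_itv : mu D = 1%E.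
Proof. by rewrite /unit_itv lebesgue_measure_itv /= lte_fin ltr01 oppr0 adde0. Qed.

Definition int01 f : R := \int[mu]_(u in D) f u.

Lemma bounded_measurable_integrable f :
  bounded_measurable f -> mu.-integrable D (EFin \o f).
Proof.
move=> [mf [C fC]]; apply: measurable_bounded_integrable => //.
- by change ((mu D < +oo)%E); rewrite measure_unit_itv ltry.
- exact: measurable_funTS.
- exists C; split; first exact: num_real.
  move=> M CM u _; have /andP[f0 fc] := fC u.
  by rewrite /= ger0_norm// (le_trans fc)// ltW.
Qed.

Lemma int01E f : bounded_measurable f ->
  (\int[mu]_(u in D) (f u)%:E)%E = (int01 f)%:E.
Proof.
move=> bf; rewrite /int01 /Rintegral fineK//.
exact: integrable_fin_num (bounded_measurable_integrable bf).
Qed.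

Lemma int01_ge0 f : (forall u, 0 <= f u) -> 0 <= int01 f.
Proof. by move=> f0; apply: Rintegral_ge0. Qed.

Lemma int01_cst (c : R) : int01 (fun=> c) = c.
Proof.
by rewrite /int01 Rintegral_cst// -[LHS]/(c * fine (mu D)) measure_unit_itv mulr1.
Qed.

Lemma int01_le f g : bounded_measurable f -> bounded_measurable g ->
  (forall u, f u <= g u) -> int01 f <= int01 g.
Proof.
move=> bf bg fg; apply: le_Rintegral => //;
  exact: bounded_measurable_integrable.
Qed.

Lemma int01D f g : bounded_measurable f -> bounded_measurable g ->
  int01 (fun u => f u + g u) = int01 f + int01 g.
Proof.
move=> bf bg; apply: RintegralD => //; exact: bounded_measurable_integrable.
Qed.

Lemma int01Zl c f : bounded_measurable f ->
  int01 (fun u => c * f u) = c * int01 f.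
Proof.
move=> bf; apply: RintegralZl => //; exact: bounded_measurable_integrable.
Qed.

Definition upd x k u : nat -> R := fun i => if i == k then u else x i.

Lemma upd_same x k u v : upd (upd x k u) k v = upd x k v.
Proof. by apply/funext => i; rewrite /upd; case: eqP. Qed.

Lemma updC x k l u v : k != l ->
  upd (upd x k u) l v = upd (upd x l v) k u.
Proof.
move=> kl; apply/funext => i; rewrite /upd.
by case: eqP => // ->; rewrite eq_sym (negbTE kl).
Qed.

(* Measurability of a function of infinitely many coordinates is tested along
   all measurable families of coordinate maps, so that no sigma-algebra on
   [nat -> R] is needed and the class is visibly stable under [intv]. *)
Definition good F :=
  (forall (d : measure_display) (T : measurableType d) (phi : nat -> T -> R),
     (forall i, measurable_fun setT (phi i)) ->
     measurable_fun setT (fun t => F (fun i => phi i t))) /\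
  exists C, forall x, 0 <= F x <= C.

Lemma good_ge0 F x : good F -> 0 <= F x.
Proof. by move=> [_ [C]] /(_ x)/andP[]. Qed.

Lemma good_upd F x k : good F -> bounded_measurable (fun u => F (upd x k u)).
Proof.
move=> [mF [C FC]]; split; last by exists C.
apply: (mF _ _ (fun i u => upd x k u i)) => i; rewrite /upd.
by case: (i == k); [exact: measurable_id | exact: measurable_cst].
Qed.

Lemma good_cst (c : R) : 0 <= c -> good (fun=> c).
Proof.
move=> c0; split; last by exists c => x; rewrite c0 lexx.
by move=> d T phi mphi; exact: measurable_cst.
Qed.

Lemma goodD F G : good F -> good G -> good (fun x => F x + G x).
Proof.
move=> [mF [C FC]] [mG [C' GC]]; split.
  move=> d T phi mphi; exact: measurable_funD (mF _ _ _ mphi) (mG _ _ _ mphi).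
exists (C + C') => x; have /andP[? ?] := FC x; have /andP[? ?] := GC x.
by rewrite addr_ge0//= lerD.
Qed.

Lemma goodM F G : good F -> good G -> good (fun x => F x * G x).
Proof.
move=> [mF [C FC]] [mG [C' GC]]; split.
  move=> d T phi mphi; exact: measurable_funM (mF _ _ _ mphi) (mG _ _ _ mphi).
exists (C * C') => x; have /andP[? ?] := FC x; have /andP[? ?] := GC x.
by rewrite mulr_ge0//= ler_pM.
Qed.

Lemma good_prod (I : Type) (s : seq I) (P : pred I) (F : I -> (nat -> R) -> R) :
  (forall i, P i -> good (F i)) -> good (fun x => \prod_(i <- s | P i) F i x).
Proof.
move=> gF; elim: s => [|i s IH].
  rewrite (_ : (fun _ => _) = fun=> 1); first by apply: good_cst.
  by apply/funext => x; rewrite big_nil.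
case Pi: (P i); last first.
  rewrite (_ : (fun _ => _) = fun x => \prod_(i <- s | P i) F i x) //.
  by apply/funext => x; rewrite big_cons Pi.
rewrite (_ : (fun _ => _) = fun x => F i x * \prod_(i <- s | P i) F i x).
  by apply: goodM => //; exact: gF.
by apply/funext => x; rewrite big_cons Pi.
Qed.

Lemma good_sum (I : Type) (s : seq I) (P : pred I) (F : I -> (nat -> R) -> R) :
  (forall i, P i -> good (F i)) -> good (fun x => \sum_(i <- s | P i) F i x).
Proof.
move=> gF; elim: s => [|i s IH].
  rewrite (_ : (fun _ => _) = fun=> 0); first by apply: good_cst.
  by apply/funext => x; rewrite big_nil.
case Pi: (P i); last first.
  rewrite (_ : (fun _ => _) = fun x => \sum_(i <- s | P i) F i x) //.
  by apply/funext => x; rewrite big_cons Pi.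
rewrite (_ : (fun _ => _) = fun x => F i x + \sum_(i <- s | P i) F i x).
  by apply: goodD => //; exact: gF.
by apply/funext => x; rewrite big_cons Pi.
Qed.

Lemma good_powR F w : 0 <= w -> good F -> good (fun x => F x `^ w).
Proof.
move=> w0 [mF [C FC]]; split.
  move=> d T phi mphi.
  exact: (measurableT_comp (measurable_powR w) (mF _ _ _ mphi)).
exists (C `^ w) => x; rewrite powR_ge0/=.
have /andP[F0 Fc] := FC x.
by rewrite ge0_ler_powR// nnegrE// (le_trans F0).
Qed.

Definition bounded_kernel (f : R -> R -> R) :=
  measurable_fun [set: R * R] (fun z : R * R => f z.1 z.2) /\
  exists C, forall a b, 0 <= f a b <= C.

Lemma good_kernel (h : R -> R -> R) i j :
  bounded_kernel h -> good (fun x => h (x i) (x j)).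
Proof.
move=> [mf [C fC]]; split; last by exists C.
move=> d T phi mphi.
apply: (measurableT_comp mf (measurable_fun_pair (mphi i) (mphi j))).
Qed.

Definition intv k F x : R := int01 (fun u => F (upd x k u)).

(** The integrand is extended by 0 off the unit interval, since Tonelli's theorem is applied on the
    whole line; [int01_swap] does the same in both variables. *)
Lemma measurable_int_snd (d : measure_display) (T : measurableType d)
    (h : T * R -> R) (C : R) :
  measurable_fun setT h -> (forall z, 0 <= h z <= C) ->
  measurable_fun setT (fun t => int01 (fun u => h (t, u))).
Proof.
move=> mh h0.
have bh t : bounded_measurable (fun u => h (t, u)).
  split; last by exists C.
  exact: (measurableT_comp mh (pair1_measurable t)).
pose h' : T * R -> \bar R := fun z => (h z * \1_D z.2)%:E.
have mh' : measurable_fun setT h'.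
  apply/measurable_EFinP; apply: measurable_funM => //.
  apply: measurableT_comp; last exact: measurable_snd.
  exact: measurable_indic.
have h'0 z : (0 <= h' z)%E.
  by rewrite lee_fin mulr_ge0//; case/andP: (h0 z).
have := @measurable_fun_fubini_tonelli_F _ _ _ _ R mu h' mh' h'0.
rewrite (_ : fubini_F _ _ = EFin \o (fun t => int01 (fun u => h (t, u)))).
  by move/measurable_EFinP.
apply/funext => t /=; rewrite -int01E// /fubini_F [RHS]integral_mkcond.
apply: eq_integral => u _; rewrite /h' /= patchE indicE.
by case: ifP => _; rewrite ?mulr1 ?mulr0.
Qed.

Lemma good_intv k F : good F -> good (intv k F).
Proof.
move=> gF; have [mF [C FC]] := gF; split; last first.
  exists C => x; rewrite /intv int01_ge0/=; last by move=> u; exact: good_ge0.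
  rewrite -[leRHS](int01_cst C); apply: int01_le => //.
  - exact: good_upd.
  - split; first exact: measurable_cst.
    exists C => u; have /andP[h1 h2] := FC x.
    by rewrite lexx andbT (le_trans h1).
  - by move=> u; case/andP: (FC (upd x k u)).
move=> d T phi mphi.
pose psi i (z : T * R) := if i == k then z.2 else phi i z.1.
have mpsi i : measurable_fun setT (psi i).
  rewrite /psi; case: (i == k); first exact: measurable_snd.
  exact: measurableT_comp (mphi i) measurable_fst.
have := @measurable_int_snd d T (fun z => F (psi ^~ z)) C (mF _ _ _ mpsi).
by apply=> z.
Qed.

Lemma int01_swap (h : R -> R -> R) : bounded_kernel h ->
  int01 (fun u => int01 (fun v => h u v)) =
  int01 (fun v => int01 (fun u => h u v)).
Proof.
move=> kh; have [mh [C hC]] := kh.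
pose h' : R * R -> \bar R := fun z => (h z.1 z.2 * (\1_D z.1 * \1_D z.2))%:E.
have mh' : measurable_fun setT h'.
  apply/measurable_EFinP; apply: measurable_funM => //.
  apply: measurable_funM; apply: measurableT_comp.
  - exact: measurable_indic.
  - exact: measurable_fst.
  - exact: measurable_indic.
  - exact: measurable_snd.
have h'0 z : (0 <= h' z)%E.
  by rewrite lee_fin mulr_ge0//; case/andP: (hC z.1 z.2).
have gh : good (fun x => h (x 0) (x 1)) by exact: good_kernel.
have b1 u : bounded_measurable (h u).
  exact: (good_upd (fun i => if i == 0 then u else 0) 1 gh).
have b2 v : bounded_measurable (h ^~ v).
  exact: (good_upd (fun i => if i == 0 then 0 else v) 0 gh).
have b3 : bounded_measurable (fun u => int01 (h u)).
  exact: (good_upd (fun=> 0) 0 (good_intv 1 gh)).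
have b4 : bounded_measurable (fun v => int01 (h ^~ v)).
  exact: (good_upd (fun=> 0) 1 (good_intv 0 gh)).
have /= := @fubini_tonelli _ _ _ _ R mu mu h' mh' h'0.
move=> fub; apply/eqP; rewrite -eqe -(int01E b3) -(int01E b4); apply/eqP.
rewrite [LHS]integral_mkcond [RHS]integral_mkcond; move: fub.
rewrite (_ : (fun u => _) = ((fun u => (int01 (h u))%:E) \_ D)); last first.
  apply/funext => u; rewrite patchE -int01E// [X in if _ then X else _]integral_mkcond.
  case: ifP => uD; last first.
    by apply: integral0_eq => v _; rewrite /h' /= indicE uD mul0r mulr0.
  apply: eq_integral => v _; rewrite /h' /= patchE !indicE uD mul1r.
  by case: ifP => _; rewrite ?mulr1 ?mulr0.
move=> ->; apply: eq_integral => v _; rewrite patchE -int01E//.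
rewrite [X in if _ then X else _]integral_mkcond.
case: ifP => vD; last first.
  by apply: integral0_eq => u _; rewrite /h' /= !indicE vD !mulr0.
apply: eq_integral => u _; rewrite /h' /= patchE !indicE vD mulr1.
by case: ifP => _; rewrite ?mulr1 ?mulr0.
Qed.

Lemma good_pair F x k l : good F ->
  bounded_kernel (fun u v => F (upd (upd x k u) l v)).
Proof.
move=> [mF [C FC]]; split; last by exists C.
apply: (mF _ _ (fun i (z : R * R) => upd (upd x k z.1) l z.2 i)) => i.
rewrite /upd; case: (i == l); first exact: measurable_snd.
by case: (i == k); [exact: measurable_fst | exact: measurable_cst].
Qed.

Lemma intvC k l F x : k != l -> good F ->
  intv k (intv l F) x = intv l (intv k F) x.
Proof.
move=> kl gF; rewrite /intv int01_swap; last exact: good_pair.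
by congr int01; apply/funext => v; congr int01; apply/funext => u; rewrite updC.
Qed.

Lemma intv_indep k F x : (forall u, F (upd x k u) = F x) -> intv k F x = F x.
Proof.
move=> FE; rewrite /intv -[RHS]int01_cst; congr int01; exact/funext.
Qed.

Lemma intv_le k F G x : good F -> good G -> (forall y, F y <= G y) ->
  intv k F x <= intv k G x.
Proof. by move=> gF gG FG; apply: int01_le => //; exact: good_upd. Qed.

Definition itg (s : seq nat) F : (nat -> R) -> R := foldr intv F s.

Lemma itg_cons k s F : itg (k :: s) F = intv k (itg s F).
Proof. by []. Qed.

Lemma itg_rcons k s F : itg (rcons s k) F = itg s (intv k F).
Proof. by rewrite /itg -cats1 foldr_cat. Qed.

Lemma good_itg s F : good F -> good (itg s F).
Proof. by move=> gF; elim: s => //= k s IH; exact: good_intv. Qed.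

Lemma itg_le s F G x : good F -> good G -> (forall y, F y <= G y) ->
  itg s F x <= itg s G x.
Proof.
move=> gF gG FG; elim: s x => [|k s IH] x; first exact: FG.
by rewrite !itg_cons; apply: intv_le => //; exact: good_itg.
Qed.

Lemma itg_cst s (c : R) x : itg s (fun=> c) x = c.
Proof.
elim: s x => //= k s IH x; rewrite intv_indep// => u.
by rewrite -/(itg _ _) !IH.
Qed.

Lemma itgD s F G x : good F -> good G ->
  itg s (fun y => F y + G y) x = itg s F x + itg s G x.
Proof.
move=> gF gG; elim: s x => // k s IH x; rewrite !itg_cons.
rewrite /intv -int01D; try exact/good_upd/good_itg.
by congr int01; apply/funext => u; rewrite IH.
Qed.

Lemma itgZ s c F x : good F -> itg s (fun y => c * F y) x = c * itg s F x.
Proof.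
move=> gF; elim: s x => // k s IH x; rewrite !itg_cons.
rewrite /intv -int01Zl; try exact/good_upd/good_itg.
by congr int01; apply/funext => u; rewrite IH.
Qed.

Lemma itg_sum (I : Type) (t : seq I) (F : I -> (nat -> R) -> R) s x :
  (forall i, good (F i)) ->
  itg s (fun y => \sum_(i <- t) F i y) x = \sum_(i <- t) itg s (F i) x.
Proof.
move=> gF; elim: t => [|i t IH].
  rewrite big_nil -[RHS](itg_cst s 0 x); congr itg.
  by apply/funext => y; rewrite big_nil.
rewrite big_cons -IH -itgD//; last exact: good_sum.
by congr itg; apply/funext => y; rewrite big_cons.
Qed.

Lemma itg_move k s F x : k \notin s -> good F ->
  itg (k :: s) F x = itg (rcons s k) F x.
Proof.
move=> ks gF; elim: s x ks => [//|l s IH] x; rewrite inE negb_or => /andP[kl ks].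
rewrite rcons_cons !itg_cons intvC//; last exact: good_itg.
rewrite /intv; congr int01; apply/funext => u; rewrite -/(intv _ _ _).
by rewrite -IH.
Qed.

(** A partial integral in one variable can be evaluated or bounded only when that variable is
    innermost; this brings any chosen variable there. *)
Lemma itg_rem k s F x : uniq s -> k \in s -> good F ->
  itg s F x = itg (rcons (rem k s) k) F x.
Proof.
move=> us ks gF; elim: s us ks x => //= l s IH /andP[ls us] ks x.
case: eqP ks => [<-|/eqP lk] ks; first exact: itg_move.
rewrite inE eq_sym (negbTE lk) /= in ks.
rewrite rcons_cons /= /intv; congr int01; apply/funext => u.
by rewrite -/(itg _ _) IH.
Qed.

Lemma itg_upd_indep s F k : (forall x u, F (upd x k u) = F x) ->
  forall x u, itg s F (upd x k u) = itg s F x.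
Proof.
move=> FE; elim: s => //= l s IH x u; rewrite -/(itg _ _) /intv.
congr int01; apply/funext => v; have [<-|kl] := eqVneq k l.
  by rewrite upd_same.
by rewrite updC// IH.
Qed.

Definition int2 (f : R -> R -> R) : R := int01 (fun a => int01 (fun b => f a b)).

Lemma itg_kernel s (f : R -> R -> R) i j x : uniq s -> i \in s -> j \in s -> i != j ->
  bounded_kernel f ->
  itg s (fun y => f (y i) (y j)) x = int2 f.
Proof.
move=> us is_ js ij kf.
have gf : good (fun y => f (y i) (y j)) by exact: good_kernel.
rewrite (itg_rem _ us js)// itg_rcons.
have ir : i \in rem j s by rewrite mem_rem_uniq// inE ij.
rewrite (itg_rem _ (rem_uniq _ us) ir); last exact: good_intv.
rewrite itg_rcons.
rewrite (_ : intv i _ = fun=> int2 f); first exact: itg_cst.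
apply/funext => y; rewrite /intv /int2; congr int01; apply/funext => a.
congr int01; apply/funext => b; congr (f _ _); rewrite /upd eqxx//.
by rewrite (negbTE ij).
Qed.

(** [iter_int] integrates coordinate [n - 1] outermost, hence the reversed list. *)
Lemma iter_intE n F x : good F ->
  iter_int n (fun y => (F y)%:E) x = (itg (rev (iota 0 n)) F x)%:E.
Proof.
move=> gF; elim: n x => // k IH x.
have -> : rev (iota 0 k.+1) = k :: rev (iota 0 k).
  by rewrite -addn1 iotaD rev_cat.
rewrite itg_cons /= /intv -int01E.
  by apply: eq_integral => u _; rewrite -IH.
exact/good_upd/good_itg.
Qed.

End Integration.

(** * Finner's inequality *)

Section Finner.
Variable R : realType.
Implicit Types (x : nat -> R).

(** Weighted AM-GM, with the missing weight [1 - sum w] on the constant 1. It is a weighted sum of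
    the tangent inequalities [Q (1 + ln b - ln Q) <= b] of the exponential at [ln Q], for [b = a e]
    and for [b = 1]. *)
Lemma prod_powR_le_sum (I : finType) (P : pred I) (a w : I -> R) :
  (forall e, P e -> 0 < a e) -> (forall e, P e -> 0 <= w e) ->
  \sum_(e | P e) w e <= 1 ->
  \prod_(e | P e) a e `^ w e <=
  \sum_(e | P e) w e * a e + (1 - \sum_(e | P e) w e).
Proof.
move=> a0 w0 w1; set Q := \prod_(e | P e) _.
have [Q0 lnQ] : 0 < Q /\ ln Q = \sum_(e | P e) w e * ln (a e).
  rewrite /Q; apply: (big_ind2 (fun u v => 0 < u /\ ln u = v)).
  - by rewrite ln1.
  - by move=> u1 v1 u2 v2 [h1 <-] [h2 <-]; rewrite mulr_gt0// lnM.
  - by move=> e Pe; rewrite ln_powR powR_gt0 ?a0.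
have key (b : R) : 0 < b -> Q * (1 + ln b - ln Q) <= b.
  move=> b0; rewrite -ler_pdivlMl// mulrC.
  have h : 0 < b / Q by rewrite divr_gt0.
  have := expR_ge1Dx (ln (b / Q)); rewrite lnK ?posrE// ln_div ?posrE//.
  by rewrite addrA.
have h1 : \sum_(e | P e) w e * (Q * (1 + ln (a e) - ln Q)) <=
    \sum_(e | P e) w e * a e.
  by apply: ler_sum => e Pe; rewrite ler_wpM2l ?w0// key// a0.
have h2 := key 1 ltr01; rewrite ln1 addr0 in h2.
set s := \sum_(e | P e) w e in w1 *.
have h3 : (1 - s) * (Q * (1 - ln Q)) <= 1 - s.
  by rewrite -[leRHS]mulr1 ler_wpM2l// subr_ge0.
apply: le_trans (lerD h1 h3).
have -> : \sum_(e | P e) w e * (Q * (1 + ln (a e) - ln Q)) =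
   Q * (s + ln Q - s * ln Q).
  rewrite {2}lnQ /s mulr_suml -big_split -sumrB mulr_sumr.
  by apply: eq_bigr => e _ /=; ring.
by rewrite le_eqVlt; apply/orP; left; apply/eqP; ring.
Qed.

Lemma good_pos_intv (F : (nat -> R) -> R) c k x : good F -> 0 < c ->
  (forall y, c <= F y) -> c <= intv k F x.
Proof.
move=> gF c0 cF; have gc : good (fun _ : nat -> R => c) by apply: good_cst; exact: ltW.
by have := intv_le k x gc gF cF; rewrite intv_indep.
Qed.

Lemma good_pos_itg (F : (nat -> R) -> R) c s x : good F -> 0 < c ->
  (forall y, c <= F y) -> c <= itg s F x.
Proof.
move=> gF c0 cF; elim: s x => // k s IH x; rewrite itg_cons.
by apply: good_pos_intv => //; exact: good_itg.
Qed.

Section Weighted.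
Variables (I : finType) (F : I -> (nat -> R) -> R) (c : R).
Hypotheses (c0 : 0 < c) (gF : forall e, good (F e)) (cF : forall e x, c <= F e x).

(** Hoelder's inequality from AM-GM: each factor is divided by its mean [m e], and the product of
    powers of the quotients is at most an affine function of integral 1. Factors constant in
    coordinate [k] equal their means, so only the weights of the others are constrained. The bound
    [c] keeps the means positive. *)
Lemma intv_hoelder (w : I -> R) k (dep : pred I) x :
  (forall e, 0 <= w e) -> \sum_(e | dep e) w e <= 1 ->
  (forall e, ~~ dep e -> forall x u, F e (upd x k u) = F e x) ->
  intv k (fun y => \prod_e F e y `^ w e) x <= \prod_e intv k (F e) x `^ w e.
Proof.
move=> w0 w1 nodep; set m := fun e => intv k (F e) x.
have m0 e : 0 < m e by rewrite (lt_le_trans c0)// good_pos_intv.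
have F0 e y : 0 < F e y by exact: lt_le_trans c0 (cF e y).
pose G y := (\prod_e m e `^ w e) *
   (\sum_(e | dep e) (w e / m e) * F e y + (1 - \sum_(e | dep e) w e)).
have M0 : 0 <= \prod_e m e `^ w e by apply: prodr_ge0 => e _; exact: powR_ge0.
have gS : good (fun y => \sum_(e | dep e) (w e / m e) * F e y).
  apply: good_sum => e _; apply: goodM => //; apply: good_cst.
  by rewrite divr_ge0// ltW.
have gC : good (fun _ : nat -> R => 1 - \sum_(e | dep e) w e).
  by apply: good_cst; rewrite subr_ge0.
have gG : good G by exact: (goodM (good_cst M0) (goodD gS gC)).
have gL : good (fun y => \prod_e F e y `^ w e).
  by apply: good_prod => e _; exact: good_powR.
have le1 : intv k (fun y => \prod_e F e y `^ w e) x <= intv k G x.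
  rewrite /intv; apply: (int01_le (good_upd x k gL) (good_upd x k gG)) => u.
  rewrite (eq_bigr (fun e => m e `^ w e * (F e (upd x k u) / m e) `^ w e)).
    rewrite big_split /= /G ler_wpM2l// (bigID dep) /=.
    rewrite [X in _ * X]big1 ?mulr1; last first.
      move=> e nd; rewrite nodep// /m intv_indep ?divff ?powR1//.
        by rewrite gt_eqF.
      by move=> v; rewrite nodep.
    apply: le_trans (prod_powR_le_sum _ _ w1) _ => //.
      by move=> e _; rewrite divr_gt0.
    by rewrite lerD2r; apply: ler_sum => e _; rewrite mulrA mulrAC.
  move=> e _; rewrite -powRM//; first by rewrite mulrC divfK// gt_eqF.
    exact: ltW.
  by rewrite divr_ge0// ltW.
apply: le_trans le1 _.
have -> : intv k G x = \prod_e m e `^ w e.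
  transitivity (\prod_e m e `^ w e *
      (\sum_(e | dep e) w e + (1 - \sum_(e | dep e) w e))); last first.
    by rewrite addrCA subrr addr0 mulr1.
  apply: etrans (itgZ [:: k] _ x (goodD gS gC)) _; congr (_ * _).
  apply: etrans (itgD [:: k] x gS gC) _.
  rewrite (itg_cst [:: k]); congr (_ + _).
  under [X in itg _ X]eq_fun do rewrite big_mkcond.
  rewrite (itg_sum _ (F := fun e y => if dep e then w e / m e * F e y else 0)).
    rewrite [RHS]big_mkcond; apply: eq_bigr => e _; case: (dep e).
      by rewrite itgZ// -[itg _ _ _]/(m e) divfK// gt_eqF.
    exact: itg_cst.
  move=> e; case: (dep e); last exact: good_cst.
  by apply: goodM => //; apply: good_cst; rewrite divr_ge0// ltW.
exact: lexx.
Qed.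

End Weighted.

(** One coordinate at a time: the partial integrals [itg s (F e)] still do not depend on coordinates
    outside [dep e], so [intv_hoelder] applies to them again. *)
Lemma finner (I : finType) (F : I -> (nat -> R) -> R) (c : R)
    (w : I -> R) (dep : I -> pred nat) s x :
  0 < c -> (forall e, good (F e)) -> (forall e x, c <= F e x) ->
  (forall e, 0 <= w e) ->
  (forall k, k \in s -> \sum_(e | dep e k) w e <= 1) ->
  (forall e k, ~~ dep e k -> forall x u, F e (upd x k u) = F e x) ->
  itg s (fun y => \prod_e F e y `^ w e) x <= \prod_e itg s (F e) x `^ w e.
Proof.
move=> c0 gF cF w0 w1 nodep; elim: s x w1 => // k s IH x w1.
have w1' l : l \in s -> \sum_(e | dep e l) w e <= 1.
  by move=> ls; apply: w1; rewrite inE ls orbT.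
have gP (G : I -> (nat -> R) -> R) : (forall e, good (G e)) ->
    good (fun y => \prod_e G e y `^ w e).
  by move=> gG; apply: good_prod => e _; exact: good_powR.
have gI e : good (itg s (F e)) by exact: good_itg.
rewrite !itg_cons; apply: le_trans (intv_le k x _ (gP _ gI) _) _.
- exact/good_itg/gP.
- by move=> y; exact: IH.
apply: (@intv_hoelder I (fun e => itg s (F e)) c c0 gI _ w k (dep^~ k)) => //.
- by move=> e y; exact: good_pos_itg.
- exact/w1/mem_head.
- by move=> e nd; apply: itg_upd_indep; exact: nodep.
Qed.

(* The extra exponent [tau] of the factor [e0] at the variable [u] is used up by
   the sup over the other variables of the partial integral of [F e0]; for this
   [u] has to be the innermost variable. *)
Lemma finner_sup (I : finType) (F : I -> (nat -> R) -> R) (c : R)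
    (w : I -> R) (dep : I -> pred nat) s x (e0 : I) (u : nat) (tau b : R) :
  0 < c -> (forall e, good (F e)) -> (forall e x, c <= F e x) ->
  (forall e, 0 <= w e) -> 0 <= tau ->
  uniq s -> u \in s -> dep e0 u -> (forall x, intv u (F e0) x <= b) ->
  (forall k, k \in s -> \sum_(e | dep e k) w e <= 1 - (if k == u then tau else 0)) ->
  (forall e k, ~~ dep e k -> forall x u, F e (upd x k u) = F e x) ->
  itg s (fun y => \prod_e F e y `^ (w e + (if e == e0 then tau else 0))) x
    <= b `^ tau * \prod_e itg s (F e) x `^ w e.
Proof.
move=> c0 gF cF w0 tau0 us us_ du Fb w1 nodep.
pose w' e := w e + (if e == e0 then tau else 0).
have w'0 e : 0 <= w' e by rewrite /w' addr_ge0//; case: ifP.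
have gP (G : I -> (nat -> R) -> R) v : (forall e, 0 <= v e) ->
    (forall e, good (G e)) -> good (fun y => \prod_e G e y `^ v e).
  by move=> v0 gG; apply: good_prod => e _; exact: good_powR.
have gI e : good (intv u (F e)) by exact: good_intv.
have b0 : 0 <= b.
  by apply: le_trans (Fb x); rewrite (le_trans (ltW c0))// good_pos_intv.
rewrite (itg_rem _ us us_); last exact: gP.
rewrite (eq_bigr (fun e => itg (rem u s) (intv u (F e)) x `^ w e)); last first.
  by move=> e _; rewrite (itg_rem _ us us_)// itg_rcons.
rewrite itg_rcons.
have le1 y : intv u (fun y => \prod_e F e y `^ w' e) y <=
     b `^ tau * \prod_e intv u (F e) y `^ w e.
  apply: le_trans (@intv_hoelder I F c c0 gF cF w' u (dep^~ u) y w'0 _ _) _.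
  - rewrite /w' big_split /= -lerBrDr; apply: le_trans (w1 _ us_) _.
    rewrite eqxx lerD2l lerN2 (bigD1 e0)//= eqxx big1 ?addr0//.
    by move=> e /andP[_ /negbTE->].
  - by move=> e nd; exact: nodep.
  rewrite (bigD1 e0)//= [in leRHS](bigD1 e0)//= /w' eqxx.
  rewrite powRD; last first.
    by apply/implyP => _; rewrite gt_eqF// (lt_le_trans c0)// good_pos_intv.
  rewrite -mulrA [leLHS]mulrCA ler_pM//.
  - exact: powR_ge0.
  - by rewrite mulr_ge0 ?powR_ge0// prodr_ge0// => e _; exact: powR_ge0.
  - by rewrite ge0_ler_powR ?nnegrE//; exact: good_ge0.
  - rewrite ler_wpM2l ?powR_ge0// le_eqVlt; apply/orP; left; apply/eqP.
    by apply: eq_bigr => e /negbTE->; rewrite addr0.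
apply: le_trans (itg_le _ x _ _ le1) _.
- exact/good_intv/gP.
- by apply: goodM; [apply: good_cst; exact: powR_ge0 | exact: gP].
rewrite itgZ; last exact: gP.
rewrite ler_wpM2l ?powR_ge0//.
apply: (@finner I _ c w dep) => //.
- by move=> e y; exact: good_pos_intv.
- move=> k /mem_rem ks; apply: le_trans (w1 k ks) _.
  by rewrite lerBlDr lerDl; case: ifP.
- by move=> e k nd; apply: (itg_upd_indep [:: u]); exact: nodep.
Qed.

End Finner.

(** * Edges, degrees and walks *)

Lemma big_option (R : Type) (idx : R) (op : Monoid.com_law idx) (T : finType)
    (F : option T -> R) :
  \big[op/idx]_(o : option T) F o =
  op (F None) (\big[op/idx]_(e : T) F (Some e)).
Proof.
rewrite (bigD1 None)//=; congr (op _ _).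
rewrite (reindex_omap Some id)//=; last by case.
by apply: eq_bigl => e; rewrite eqxx.
Qed.

Lemma card_mkset (T : finType) (P : pred T) : #|[set x | P x]| = #|P|.
Proof. by apply: eq_card => x; apply/idP/idP; rewrite in_setE. Qed.

Section Edges.
Variables (n : nat) (E : rel 'I_n).
Hypothesis Hloop : irreflexive E.

Local Notation edge := {e : 'I_n * 'I_n | E e.1 e.2}.

Definition src (e : edge) : 'I_n := (val e).1.
Definition tgt (e : edge) : 'I_n := (val e).2.
Definition inc (e : edge) (v : 'I_n) : bool := (src e == v) || (tgt e == v).

Lemma src_neq_tgt (e : edge) : src e != tgt e.
Proof.
by apply: contraL (valP e) => /eqP st; rewrite -/(tgt e) -/(src e) st Hloop.
Qed.

Lemma big_edge (R : Type) (idx : R) (op : Monoid.com_law idx)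
    (F : 'I_n -> 'I_n -> R) :
  \big[op/idx]_(e : edge) F (src e) (tgt e) =
  \big[op/idx]_i \big[op/idx]_(j | E i j) F i j.
Proof.
rewrite pair_big_dep /=.
by rewrite -(big_sub [pred e : 'I_n * 'I_n | E e.1 e.2] (fun e => F e.1 e.2)).
Qed.

Lemma nedgesE : nedges E = #|{: edge}|.
Proof. by rewrite /nedges card_sub card_mkset. Qed.

Lemma sum_inc_src_tgt (R : nmodType) (F : edge -> R) v :
  \sum_(e | inc e v) F e = \sum_(e | src e == v) F e + \sum_(e | tgt e == v) F e.
Proof.
rewrite (bigID (fun e => src e == v)) /=; congr (_ + _); apply: eq_bigl => e.
  by rewrite /inc; case: eqP; rewrite ?andbT ?andbF.
rewrite /inc; case: eqP => [<-|_] //=; last by rewrite andbT.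
by rewrite eq_sym (negbTE (src_neq_tgt e)).
Qed.

Lemma sum_src (R : nmodType) (F : 'I_n -> 'I_n -> R) v :
  \sum_(e : edge | src e == v) F (src e) (tgt e) = \sum_(u | E v u) F v u.
Proof.
rewrite big_mkcond (big_edge _ (fun i j => if i == v then F i j else 0)).
rewrite (bigD1 v)//= [X in _ + X]big1 ?addr0; first by rewrite eqxx.
by move=> i /negbTE iv; rewrite big1// => j _; rewrite iv.
Qed.

Lemma sum_tgt (R : nmodType) (F : 'I_n -> 'I_n -> R) v :
  \sum_(e : edge | tgt e == v) F (src e) (tgt e) = \sum_(u | E u v) F u v.
Proof.
rewrite big_mkcond (big_edge _ (fun i j => if j == v then F i j else 0)).
rewrite (eq_bigr (fun i => if E i v then F i v else 0)).
  by rewrite -big_mkcond.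
move=> i _; case: ifP => Eiv.
  rewrite (bigD1 v)//= eqxx big1 ?addr0//.
  by move=> j /andP[_ /negbTE->].
rewrite big1// => j Eij; case: eqP => // jv.
by rewrite jv Eiv in Eij.
Qed.

Lemma degE v : deg E v = #|[pred e : edge | inc e v]|.
Proof.
rewrite /deg /indeg /outdeg !card_mkset -!sum1_card /= (sum_inc_src_tgt (fun=> 1%N)).
rewrite (sum_src (fun _ _ => 1%N)) (sum_tgt (fun _ _ => 1%N)) addnC.
by congr (_ + _)%N.
Qed.

Lemma deg_le_maxdeg v : (deg E v <= maxdeg E)%N.
Proof. by rewrite /maxdeg (leq_bigmax v). Qed.

Lemma handshake (R : nmodType) (F : edge -> R) :
  \sum_v \sum_(e | inc e v) F e = \sum_e F e *+ 2.
Proof.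
rewrite (eq_bigr _ (fun v _ => sum_inc_src_tgt F v)) big_split /=.
have aux (h : edge -> 'I_n) : \sum_v \sum_(e | h e == v) F e = \sum_e F e.
  rewrite (exchange_big_dep predT)//=; apply: eq_bigr => e _.
  by rewrite (big_pred1 (h e))// => v /=; rewrite eq_sym.
by rewrite !aux -big_split /=; apply: eq_bigr => e _; rewrite mulr2n.
Qed.

Section Walks.
Variables (R : realType) (F : pred edge).

Definition adj : rel 'I_n := fun u v =>
  [exists e, F e && inc e u && inc e v && (u != v)].

Lemma inc_sum_indic (e : edge) v (a : R) :
  \sum_(e' | inc e' v) (if e' == e then a else 0) = a * (inc e v)%:R.
Proof.
case: (boolP (inc e v)) => h.
  rewrite (bigD1 e)//= eqxx big1 ?addr0 ?mulr1//.
  by move=> e' /andP[_ /negbTE->].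
rewrite big1 ?mulr0// => e' h'; case: eqP => // ee.
by rewrite -ee h' in h.
Qed.

Lemma inc_natr (e : edge) u v w : inc e u -> inc e v -> u != v ->
  (inc e w)%:R = (w == u)%:R + (w == v)%:R :> R.
Proof.
have := src_neq_tgt e; rewrite /inc => st.
move=> /orP[] /eqP <- /orP[] /eqP <-; rewrite ?eqxx// => _;
  rewrite ![w == _]eq_sym.
  case: eqP => [<-|_] /=; last by rewrite add0r.
  by rewrite eq_sym (negbTE st) addr0.
rewrite orbC; case: eqP => [<-|_] /=; last by rewrite add0r.
by rewrite (negbTE st) addr0.
Qed.

(** Signs alternating along a walk from [v0] to [u] cancel at every inner vertex, leaving load 1 at
    [v0] and [sg] at [u], added up if [u = v0]. Repeated edges accumulate, whence the bound by the
    length [m]. *)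
Definition walk_weight v0 u (m : nat) (sg : R) (z : edge -> R) :=
  [/\ forall e, ~~ F e -> z e = 0, forall e, `|z e| <= m%:R &
      forall v, \sum_(e | inc e v) z e = (v == v0)%:R + sg * (v == u)%:R].

(** Weight [- sg] on an edge joining [u] to [u'] cancels the load at [u] and leaves [- sg] at
    [u']. *)
Lemma walk_weight_step v0 u u' m sg z : (sg == 1) || (sg == -1) ->
  walk_weight v0 u m sg z -> adj u u' ->
  exists z', walk_weight v0 u' m.+1 (- sg) z'.
Proof.
move=> sg1 [zF zm zl] /existsP[e /andP[/andP[/andP[Fe eu] eu'] uu']].
exists (fun e' => z e' + (if e' == e then - sg else 0)); split.
- move=> e' nF; rewrite zF// add0r; case: eqP => // ee.
  by rewrite ee Fe in nF.
- move=> e'; rewrite -natr1; apply: le_trans (ler_normD _ _) _; apply: lerD => //.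
  case: ifP => _; last by rewrite normr0.
  by case/orP: sg1 => /eqP ->; rewrite ?opprK ?normrN normr1.
- move=> v; rewrite big_split /= inc_sum_indic zl (inc_natr _ eu eu' uu').
  ring.
Qed.

Lemma walk_weight_path v0 p : path adj v0 p ->
  exists sg z, ((sg == 1) || (sg == -1)) /\ walk_weight v0 (last v0 p) (size p) sg z.
Proof.
elim/last_ind: p => [_|p u IH].
  (* The empty walk carries sign [-1], for which the two loads at [v0] cancel. *)
  exists (-1), (fun=> 0); split; first by rewrite eqxx orbT.
  split => // [e|v]; first by rewrite normr0.
  by rewrite big1//= mulN1r subrr.
rewrite rcons_path last_rcons size_rcons => /andP[/IH[sg [z [sg1 wz]]] au].
have [z' wz'] := walk_weight_step sg1 wz au.
exists (- sg), z'; split => //.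
by case/orP: sg1 => /eqP ->; rewrite ?opprK eqxx ?orbT.
Qed.

(* The sign at the end of a walk is its parity; a walk of the wrong parity to one
   end of [e0] is corrected by continuing through [e0]. *)
Lemma walk_weight_edge v0 (e0 : edge) (sg : R) : F e0 ->
  (sg == 1) || (sg == -1) -> connect adj v0 (src e0) ->
  exists u z, inc e0 u /\ walk_weight v0 u n sg z.
Proof.
move=> Fe0 sg1 /connectP[p0 pth0 lst0].
case: (shortenP pth0) lst0 => p pth us _ lst.
(* A simple path has fewer than [n] edges, so one more step through [e0] keeps the bound [n]. *)
have szp : (size p < n)%N.
  by have := max_card (mem (v0 :: p)); rewrite (card_uniqP us) card_ord.
have [sg' [z [sg1' wz]]] := walk_weight_path pth.
have ww u m m' s y : (m <= m')%N -> walk_weight v0 u m s y -> walk_weight v0 u m' s y.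
  move=> mm [h1 h2 h3]; split => // e; apply: le_trans (h2 e) _.
  by rewrite ler_nat.
rewrite -lst in wz.
have [sgE|sgN] := eqVneq sg sg'.
  exists (src e0), z; split; first by rewrite /inc eqxx.
  by rewrite sgE; apply: ww wz; exact: ltnW.
have sgE : sg = - sg'.
  case/orP: sg1 sgN => /eqP ->; case/orP: sg1' => /eqP ->;
    by rewrite ?eqxx ?opprK.
have au : adj (src e0) (tgt e0).
  by apply/existsP; exists e0; rewrite Fe0 /inc !eqxx orbT src_neq_tgt.
have [z' wz'] := walk_weight_step sg1' wz au.
exists (tgt e0), z'; split; first by rewrite /inc eqxx orbT.
by rewrite sgE; apply: ww wz'.
Qed.

(** By the handshake identity the sum is 0 for [sg = -1] and 1 for [sg = 1]; up to a factor it is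
    the change in total weight when edge weights are shifted along the walk. *)
Lemma walk_weight_sum v0 u m sg z : walk_weight v0 u m sg z ->
  \sum_e z e = (1 + sg) / 2.
Proof.
move=> [_ _ zl]; have := handshake z.
rewrite (eq_bigr _ (fun v _ => zl v)) big_split /= -mulr_sumr.
have d1 (v : 'I_n) : \sum_w (w == v)%:R = 1 :> R.
  by rewrite (bigD1 v)//= eqxx big1 ?addr0// => w /negbTE->.
rewrite !d1 mulr1 sumrMnl => ->.
by field.
Qed.

End Walks.
End Edges.

(** * Bounding one term of the expansion *)

Section Terms.
Variables (R : realType) (n : nat) (E : rel 'I_n).
Hypothesis Hloop : irreflexive E.
Local Notation edge := {e : 'I_n * 'I_n | E e.1 e.2}.

(* An edge carries [None] for the constant [p], [Some None] for the negligible
   part [Z], and [Some (Some (s, t))] for the part of [A] between the classes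
   [s] and [t], where [true] stands for hubs and [false] for low vertices. *)
Local Notation label := (option (option (bool * bool))).

Variables (p : R) (A Z : R -> R -> R) (hb lo : R -> R).

Definition cls (b : bool) : R -> R := if b then hb else lo.

Definition piece (l : label) (x y : R) : R :=
  match l with
  | None => p
  | Some None => Z x y
  | Some (Some (s, t)) => A x y * cls s x * cls t y
  end.

Definition all_vertices : seq nat := rev (iota 0 n).

Definition term (l : edge -> label) : R :=
  itg all_vertices (fun x => \prod_e piece (l e) (x (src e)) (x (tgt e))) (fun=> 0).

Definition class_at (l : edge -> label) (e : edge) (v : 'I_n) : option bool :=
  if l e is Some (Some (s, t)) then
    if src e == v then Some s else if tgt e == v then Some t else None
  else None.

Hypotheses (Hp : 0 < p < 1).
Hypotheses (kA : bounded_kernel A) (kZ : bounded_kernel Z).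
Hypotheses (A01 : forall x y, 0 <= A x y <= 1) (Z01 : forall x y, 0 <= Z x y <= 1).
Hypotheses (mhb : bounded_measurable hb) (mlo : bounded_measurable lo).
Hypotheses (hb01 : forall x, hb x = 0 \/ hb x = 1).
Hypotheses (lo01 : forall x, lo x = 0 \/ lo x = 1).
Hypotheses (hblo : forall x, hb x * lo x = 0).

Lemma mcls b : bounded_measurable (cls b).
Proof. by case: b. Qed.

Lemma cls01 b x : cls b x = 0 \/ cls b x = 1.
Proof. by case: b; [exact: hb01 | exact: lo01]. Qed.

Lemma cls_bound b x : 0 <= cls b x <= 1.
Proof. by case: (cls01 b x) => ->; rewrite ?lexx ?ler01. Qed.

Lemma bounded_kernel_fst (f : R -> R) :
  bounded_measurable f -> bounded_kernel (fun x _ => f x).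
Proof.
move=> [mf [C fC]]; split; last by exists C.
by apply: measurableT_comp mf _; exact: measurable_fst.
Qed.

Lemma bounded_kernel_snd (f : R -> R) :
  bounded_measurable f -> bounded_kernel (fun _ y => f y).
Proof.
move=> [mf [C fC]]; split; last by exists C.
by apply: measurableT_comp mf _; exact: measurable_snd.
Qed.

Lemma bounded_kernelM (f g : R -> R -> R) : bounded_kernel f ->
  bounded_kernel g -> bounded_kernel (fun x y => f x y * g x y).
Proof.
move=> [mf [C fC]] [mg [C' gC]]; split; first exact: measurable_funM.
exists (C * C') => a b; have /andP[f0 f1] := fC a b.
by have /andP[g0 g1] := gC a b; rewrite mulr_ge0//= ler_pM.
Qed.

Lemma kpiece l : bounded_kernel (piece l).
Proof.
case: l => [[[s t]|]|] //=.
  apply: bounded_kernelM; last exact/bounded_kernel_snd/mcls.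
  by apply: bounded_kernelM => //; exact/bounded_kernel_fst/mcls.
split; first exact: measurable_cst.
by exists p => a b; case/andP: Hp => /ltW -> _; rewrite lexx.
Qed.

Lemma piece01 l x y : 0 <= piece l x y <= 1.
Proof.
case: l => [[[s t]|]|] //=; last by case/andP: Hp => /ltW -> /ltW ->.
have /andP[a0 a1] := A01 x y; have /andP[s0 s1] := cls_bound s x.
have /andP[t0 t1] := cls_bound t y.
by rewrite !mulr_ge0//= !mulr_ile1// mulr_ge0.
Qed.

Lemma uniq_all_vertices : uniq all_vertices.
Proof. by rewrite rev_uniq iota_uniq. Qed.

Lemma mem_all_vertices (v : 'I_n) : (v : nat) \in all_vertices.
Proof. by rewrite mem_rev mem_iota ltn_ord. Qed.

Lemma good_piece (l : edge -> label) e :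
  good (fun x => piece (l e) (x (src e)) (x (tgt e))).
Proof. exact/good_kernel/kpiece. Qed.

Lemma class_at_zero (l : edge -> label) e v b (x : nat -> R) :
  class_at l e v = Some b -> cls b (x v) = 0 ->
  piece (l e) (x (src e)) (x (tgt e)) = 0 :> R.
Proof.
rewrite /class_at; case: (l e) => [[[s t]|]|] //=.
case: eqP => [-> [->] ->|_]; first by rewrite mulr0 mul0r.
by case: eqP => // -> [->] ->; rewrite mulr0.
Qed.

Lemma term_inconsistent l e e' v :
  class_at l e v = Some true -> class_at l e' v = Some false -> term l = 0.
Proof.
move=> h1 h2; rewrite /term (_ : (fun x => _) = fun=> 0); first exact: itg_cst.
apply/funext => x; have /eqP := hblo (x v); rewrite mulf_eq0 => /orP[] /eqP h0.
  by rewrite (bigD1 e)//= (class_at_zero h1)// mul0r.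
by rewrite (bigD1 e')//= (class_at_zero h2)// mul0r.
Qed.

Section OneTerm.
Variables (l : edge -> label) (g : edge -> R -> R -> R) (w : edge -> R).
Variables (h : 'I_n) (th eps : R) (m : edge -> R).
Hypotheses (eps0 : 0 < eps) (kg : forall e, bounded_kernel (g e)).
Hypotheses (w0 : forall e, 0 <= w e) (th0 : 0 <= th).
Hypothesis wN : forall e, l e = None -> w e = 0.
Hypothesis hub : th = 0 \/ exists e, class_at l e h = Some true.
Hypothesis gm : forall e, l e != None -> int2 (g e) + eps <= m e.

Let F (o : option edge) (x : nat -> R) : R :=
  if o is Some e then g e (x (src e)) (x (tgt e)) + eps else hb (x h) + eps.
Let W (o : option edge) : R := if o is Some e then w e else th.
Let dep (o : option edge) (k : nat) : bool :=
  if o is Some e then (src e == k :> nat) || (tgt e == k :> nat) else k == h.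

Let g0 e x y : 0 <= g e x y.
Proof. by have [_ [C /(_ x y)/andP[]]] := kg e. Qed.

Let ghb : good (fun x : nat -> R => hb (x h)).
Proof. exact: (good_kernel h h (bounded_kernel_fst mhb)). Qed.

Let gF o : good (F o).
Proof.
case: o => [e|]; apply: goodD => //; try by apply: good_cst; exact: ltW.
exact: good_kernel.
Qed.

Let F_ge o x : eps <= F o x.
Proof.
case: o => [e|] /=; rewrite lerDr//.
by case: (hb01 (x h)) => ->.
Qed.

Let W0 o : 0 <= W o. Proof. by case: o. Qed.

Let F_indep o k : ~~ dep o k -> forall x u, F o (upd x k u) = F o x.
Proof.
case: o => [e|] /=.
  by rewrite negb_or => /andP[/negbTE h1 /negbTE h2] x u; rewrite /upd h1 h2.
by rewrite eq_sym => /negbTE h1 x u; rewrite /upd h1.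
Qed.

Let sum_dep (k : nat) (v : 'I_n) : k = v ->
  \sum_(o | dep o k) W o = \sum_(e | inc e v) w e + (if v == h then th else 0).
Proof.
move=> ->; rewrite big_mkcond (big_option _ (fun o => if dep o v then W o else 0)).
by rewrite addrC /= -big_mkcond.
Qed.

(** The hub factor is inserted for free: unless [th = 0], some label requires a hub at [h], so the
    product already vanishes where [x h] is not a hub. *)
Let hub_le (x : nat -> R) : \prod_e piece (l e) (x (src e)) (x (tgt e)) <=
  (hb (x h) + eps) `^ th * \prod_e piece (l e) (x (src e)) (x (tgt e)).
Proof.
have P0 : 0 <= \prod_e piece (l e) (x (src e)) (x (tgt e)).
  by apply: prodr_ge0 => e _; case/andP: (piece01 (l e) (x (src e)) (x (tgt e))).
case: (hb01 (x h)) => hE; last first.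
  rewrite -[leLHS]mul1r ler_wpM2r// hE.
  rewrite -[X in X <= _](_ : 1 `^ th = 1); last by rewrite powR1.
  by rewrite ge0_ler_powR ?nnegrE ?lerDl ?addr_ge0// ltW.
case: hub => [->|[e he]]; first by rewrite powRr0 mul1r.
by rewrite (bigD1 e)//= (class_at_zero he)// !mul0r mulr0.
Qed.

Let prod_itg_le : \prod_o itg all_vertices (F o) (fun=> 0) `^ W o <=
  (int01 hb + eps) `^ th * \prod_(e | l e != None) m e `^ w e.
Proof.
rewrite (big_option _ (fun o => itg all_vertices (F o) (fun=> 0) `^ W o)) /=.
have hbE : itg all_vertices (F None) (fun=> 0) = int01 hb + eps.
  rewrite itgD//; last by apply: good_cst; exact: ltW.
  rewrite itg_cst; congr (_ + _).
  rewrite (itg_rem _ uniq_all_vertices (mem_all_vertices h) ghb) itg_rcons.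
  rewrite (_ : intv _ _ = fun=> int01 hb) ?itg_cst//.
  by apply/funext => x; congr int01; apply/funext => u; rewrite /upd eqxx.
rewrite hbE ler_wpM2l ?powR_ge0//.
rewrite [leRHS]big_mkcond; apply: ler_prod => e _; rewrite powR_ge0 /=.
case: ifPn => [he|]; last by rewrite negbK => /eqP/wN ->; rewrite powRr0.
have -> : itg all_vertices (F (Some e)) (fun=> 0) = int2 (g e) + eps.
  rewrite itgD//; last by apply: good_cst; exact: ltW.
    rewrite itg_cst; congr (_ + _).
    by rewrite (itg_kernel _ uniq_all_vertices)// ?mem_all_vertices// src_neq_tgt.
  exact: good_kernel.
have i0 : 0 <= int2 (g e) + eps.
  by apply: addr_ge0; [apply: int01_ge0 => a; apply: int01_ge0 => b | exact: ltW].
by apply: ge0_ler_powR; rewrite ?nnegrE//; first apply: le_trans i0 _; exact: gm.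
Qed.

Let term_le_itg (w' : edge -> R) : (forall e, 0 <= w' e) ->
  (forall e, l e = None -> w' e = 0) ->
  (forall e x y, l e != None -> piece (l e) x y <= g e x y `^ w' e) ->
  term l <= p ^+ #|[pred e | l e == None]| *
    itg all_vertices (fun y => \prod_(o : option edge) F o y `^
       (if o is Some e then w' e else th)) (fun=> 0).
Proof.
move=> w'0 w'N lg.
have gR : good (fun y => \prod_(o : option edge) F o y `^
       (if o is Some e then w' e else th)).
  by apply: good_prod => o _; apply: good_powR => //; case: o.
have p0 : 0 <= p by case/andP: Hp => /ltW.
rewrite -itgZ//; apply: itg_le.
- by apply: good_prod => e _; exact: good_piece.
- by apply: goodM => //; apply: good_cst; exact: exprn_ge0.
move=> x; apply: le_trans (hub_le x) _.
rewrite (big_option _ (fun o => F o x `^ (if o is Some e then w' e else th))) /=.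
rewrite mulrCA ler_wpM2l ?powR_ge0//.
rewrite (bigID (fun e => l e == None)) /=; apply: ler_pM.
- by apply: prodr_ge0 => e _; case/andP: (piece01 (l e) (x (src e)) (x (tgt e))).
- by apply: prodr_ge0 => e _; case/andP: (piece01 (l e) (x (src e)) (x (tgt e))).
- rewrite (eq_bigr (fun=> p)); last by move=> e /eqP ->.
  by rewrite prodr_const lexx.
- rewrite big_mkcond; apply: ler_prod => e _; case: ifPn => he.
    have /andP[-> _] := piece01 (l e) (x (src e)) (x (tgt e)); rewrite /=.
    apply: le_trans (lg e _ _ he) _.
    by rewrite ge0_ler_powR ?nnegrE ?lerDl ?addr_ge0// ltW.
  by move: he; rewrite negbK ler01 => /eqP/w'N ->; rewrite powRr0 lexx.
Qed.

(** The piece of an edge is dominated only by the [w e]-th power of [g e]; this lets [Z] enter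
    through [Z ^ D]. *)
Lemma term_le :
  (forall e x y, l e != None -> piece (l e) x y <= g e x y `^ w e) ->
  (forall v, \sum_(e | inc e v) w e + (if v == h then th else 0) <= 1) ->
  term l <= p ^+ #|[pred e | l e == None]| *
    ((int01 hb + eps) `^ th * \prod_(e | l e != None) m e `^ w e).
Proof.
move=> lg w1; have p0 : 0 <= p by case/andP: Hp => /ltW.
apply: le_trans (term_le_itg w0 wN lg) _; rewrite ler_wpM2l ?exprn_ge0//.
apply: le_trans prod_itg_le.
apply: (@finner _ _ F eps W dep) => // k; rewrite mem_rev mem_iota add0n => /= kn.
by rewrite (sum_dep (v := Ordinal kn)).
Qed.

Lemma term_le_sup (e0 : edge) (u : 'I_n) (tau b : R) : 0 <= tau ->
  inc e0 u -> l e0 != None ->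
  (forall e x y, l e != None ->
     piece (l e) x y <= g e x y `^ (w e + (if e == e0 then tau else 0))) ->
  (forall y, int01 (fun v => g e0 v y) + eps <= b) ->
  (forall y, int01 (fun v => g e0 y v) + eps <= b) ->
  (forall v, \sum_(e | inc e v) w e + (if v == h then th else 0) +
     (if v == u then tau else 0) <= 1) ->
  term l <= p ^+ #|[pred e | l e == None]| *
    (b `^ tau * ((int01 hb + eps) `^ th * \prod_(e | l e != None) m e `^ w e)).
Proof.
move=> tau0 e0u le0 lg b1 b2 w1; have p0 : 0 <= p by case/andP: Hp => /ltW.
apply: le_trans (term_le_itg (w' := fun e => w e + (if e == e0 then tau else 0)) _ _ lg) _.
- by move=> e; rewrite addr_ge0//; case: ifP.
- by move=> e le; rewrite wN// add0r; case: eqP => // ee; rewrite -ee le in le0.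
rewrite ler_wpM2l ?exprn_ge0//.
have := @finner_sup _ _ F eps W dep all_vertices (fun=> 0) (Some e0) u tau b eps0 gF
  F_ge W0 tau0 uniq_all_vertices (mem_all_vertices u) _ _ _ F_indep.
rewrite (_ : (fun y => \prod_e F e y `^ (W e + _)) =
  (fun y => \prod_(o : option edge) F o y `^
       (if o is Some e then w e + (if e == e0 then tau else 0) else th))); last first.
  apply/funext => y; apply: eq_bigr => -[e|] _ //=; last by rewrite addr0.
move=> main; apply: le_trans (main _ _ _) _.
- by move: e0u; rewrite /inc /= => /orP[] /eqP ->; rewrite eqxx ?orbT.
- move=> x; rewrite /intv /=.
  have bE (f : R -> R) : bounded_measurable f ->
      int01 (fun v => f v + eps) = int01 f + eps.
    move=> bf; rewrite int01D ?int01_cst//; split; first exact: measurable_cst.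
    by exists eps => _; rewrite lexx ltW.
  have gg (i j : nat) : good (fun x => g e0 (x i) (x j)) by exact: good_kernel.
  move: e0u; rewrite /inc => /orP[] /eqP <-.
    rewrite (_ : (fun v => _) = fun v => g e0 v (x (tgt e0)) + eps).
      rewrite bE//.
      by have := good_upd (fun=> x (tgt e0)) 0 (gg 0 1).
    apply/funext => v; rewrite /upd eqxx ifF//.
    by rewrite eq_sym; apply/negbTE; exact: src_neq_tgt.
  rewrite (_ : (fun v => _) = fun v => g e0 (x (src e0)) v + eps).
    rewrite bE//.
    by have := good_upd (fun=> x (src e0)) 0 (gg 1 0).
  apply/funext => v; rewrite /upd eqxx ifF//.
  by apply/negbTE; exact: src_neq_tgt.
- move=> k; rewrite mem_rev mem_iota add0n => /= kn.
  rewrite (sum_dep (v := Ordinal kn))// lerBrDr; apply: le_trans (w1 (Ordinal kn)).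
  by rewrite lerD2l.
by rewrite ler_wpM2l ?powR_ge0.
Qed.

End OneTerm.
End Terms.

Section PowR.
Variable R : realType.
Implicit Types a x : R.

Lemma maxdeg_attained (n : nat) (E : rel 'I_n) : (0 < maxdeg E)%N ->
  exists v, deg E v = maxdeg E.
Proof.
case: (posnP #|'I_n|) => [n0|n0 _].
  by rewrite /maxdeg big1// => v; have := fintype0 v; rewrite n0 => /(_ erefl).
by have [v vE] := bigop.eq_bigmax (deg E) n0; exists v; rewrite /maxdeg vE.
Qed.

Lemma le_powR_unit x (w : R) : 0 <= x <= 1 -> w <= 1 -> x <= x `^ w.
Proof.
move=> /andP[x0 x1] w1; have [->|xN0] := eqVneq x 0; first exact: powR_ge0.
by apply: ger1_powR => //; rewrite lt_neqAle eq_sym xN0 x0.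
Qed.

Lemma prod_powR (I : finType) (P : pred I) (w : I -> R) a : 0 < a ->
  \prod_(e | P e) a `^ w e = a `^ (\sum_(e | P e) w e).
Proof.
move=> a0; elim/big_rec2: _ => [|e y1 y2 _ ->]; first by rewrite powRr0.
by rewrite powRD//; apply/implyP => _; rewrite gt_eqF.
Qed.

Lemma powR_root (D : nat) a : (0 < D)%N -> 0 <= a -> (a ^+ D) `^ D%:R^-1 = a.
Proof.
move=> D0 a0; rewrite -powR_mulrn// -powRrM divff ?powRr1//.
by rewrite pnatr_eq0 -lt0n.
Qed.

Lemma powR_natr_mul a (w : R) (m : nat) : 0 <= a -> a `^ (m%:R * w) = (a `^ w) ^+ m.
Proof. by move=> a0; rewrite mulrC powRrM powR_mulrn// powR_ge0. Qed.

End PowR.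

(** * Labellings of lower order *)

Section BadTerms.
Variables (R : realType) (n : nat) (E : rel 'I_n).
Hypothesis Hloop : irreflexive E.
Local Notation edge := {e : 'I_n * 'I_n | E e.1 e.2}.
Local Notation label := (option (option (bool * bool))).
Variables (p : R) (A Z : R -> R -> R) (hb lo : R -> R).
Local Notation D := (maxdeg E).
Local Notation q := (p ^+ D).
Local Notation cls := (cls hb lo).
Local Notation piece := (piece p A Z hb lo).
Local Notation term := (@term R n E p A Z hb lo).

Hypotheses (Hp : 0 < p < 1) (D2 : (2 <= D)%N).
Hypotheses (kA : bounded_kernel A) (kZ : bounded_kernel Z).
Hypotheses (A01 : forall x y, 0 <= A x y <= 1) (Z01 : forall x y, 0 <= Z x y <= 1).
Hypotheses (mhb : bounded_measurable hb) (mlo : bounded_measurable lo).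
Hypotheses (hb01 : forall x, hb x = 0 \/ hb x = 1).
Hypotheses (lo01 : forall x, lo x = 0 \/ lo x = 1).
Hypotheses (hblo : forall x, hb x * lo x = 0).

Variables (K zeta eps beta kappa : R).
Hypotheses (K1 : 1 <= K) (zeta0 : 0 < zeta) (zetaK : zeta <= K) (eps0 : 0 < eps).
Hypothesis massA : forall s t, int2 (fun x y => A x y * cls s x * cls t y) + eps <= K * q.
Hypothesis massZ : int2 (fun x y => Z x y ^+ D) + eps <= zeta * q.
Hypothesis masshh : int2 (fun x y => A x y * hb x * hb y) + eps <= zeta * q.
Hypothesis beta1 : forall y, int01 (fun v => A v y * lo v * lo y) + eps <= beta.
Hypothesis beta2 : forall y, int01 (fun v => A y v * lo y * lo v) + eps <= beta.

(** Since [D^-1 = (n + 1) tau], shifting the weights [D^-1] by [tau z] with [|z| <= n] keeps them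
    nonnegative, and a further [tau] keeps them at most [2 / D <= 1]. *)
Let tau : R := (D%:R * n.+1%:R)^-1.

Hypothesis kzeta : zeta `^ D%:R^-1 <= kappa.
Hypothesis khub : (int01 hb + eps) `^ D%:R^-1 <= kappa.
Hypothesis kbeta : beta `^ tau <= kappa.
Hypothesis kmix : ((int01 hb + eps) * beta / (K * q)) `^ tau <= kappa.

Let p0 : 0 < p. Proof. by case/andP: Hp. Qed.
Let K0 : 0 < K. Proof. exact: lt_le_trans ltr01 K1. Qed.
Let D0 : (0 < D)%N. Proof. exact: leq_trans D2. Qed.
Let DR0 : 0 < D%:R :> R. Proof. by rewrite ltr0n. Qed.
Let q0 : 0 < q. Proof. exact: exprn_gt0. Qed.
Let p_ge0 : 0 <= p. Proof. exact: ltW. Qed.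
Let K_ge0 : 0 <= K. Proof. exact: ltW. Qed.
Let q_ge0 : 0 <= q. Proof. exact: ltW. Qed.
Let zeta_ge0 : 0 <= zeta. Proof. exact: ltW. Qed.
Let kappa0 : 0 <= kappa. Proof. exact: le_trans (powR_ge0 _ _) kzeta. Qed.
Let hb0 : 0 <= int01 hb + eps.
Proof.
apply: addr_ge0; last exact: ltW.
by apply: int01_ge0 => u; case: (hb01 u) => ->.
Qed.
Let beta0 : 0 <= beta.
Proof.
apply: le_trans (beta1 0); apply: addr_ge0; last exact: ltW.
apply: int01_ge0 => u; case/andP: (A01 u 0) => a0 _.
by case: (lo01 u) => ->; case: (lo01 0) => ->; rewrite ?mulr0 ?mul0r ?mulr1.
Qed.
Let Dinv1 : D%:R^-1 <= 1 :> R.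
Proof. by rewrite invf_le1// ler1n. Qed.
Let tau0 : 0 < tau. Proof. by rewrite invr_gt0 mulr_gt0// ltr0n. Qed.
Let tau_ge0 : 0 <= tau. Proof. exact: ltW. Qed.
Let tauE : D%:R^-1 = n.+1%:R * tau.
Proof.
by rewrite /tau invfM mulrCA divff ?mulr1.
Qed.

Let root_le (a : R) : 0 <= a -> (a * q) `^ D%:R^-1 = a `^ D%:R^-1 * p.
Proof.
by move=> a0; rewrite powRM// powR_root.
Qed.

Let rootK : (K * q) `^ D%:R^-1 <= K * p.
Proof.
rewrite root_le// ler_wpM2r//.
by apply: ler1_powR.
Qed.

Section Label.
Variable l : edge -> label.
Let F : pred edge := fun e => l e != None.
Let degF v := #|[pred e | inc e v && F e]|.

Lemma degF_le v : (degF v <= deg E v)%N.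
Proof.
by rewrite degE//; apply: subset_leq_card; apply/fintype.subsetP => e /andP[].
Qed.

Let degF_leD v : (degF v <= D)%N.
Proof. exact: leq_trans (degF_le v) (deg_le_maxdeg E v). Qed.

Let sum_const (P : pred edge) (a : R) :
  \sum_(e | P e) (if F e then a else 0) = #|[pred e | P e && F e]|%:R * a.
Proof. by rewrite -big_mkcondr /= sumr_const mulr_natl. Qed.

Let load1 v : (degF v)%:R * D%:R^-1 <= 1 :> R.
Proof. by rewrite ler_pdivrMr// mul1r ler_nat. Qed.

Let card_split : (#|[pred e | l e == None]| + #|F| = nedges E)%N.
Proof.
by rewrite nedgesE -(cardC [pred e | l e == None]).
Qed.

Let finish (k : R) : 0 <= k -> k <= kappa ->
  p ^+ #|[pred e | l e == None]| * (k * (K * p) ^+ #|F|) <=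
  p ^+ nedges E * K ^+ nedges E * kappa.
Proof.
move=> k0 kk; rewrite -card_split exprD exprMn.
rewrite -2!mulrA ler_wpM2l ?exprn_ge0//.
rewrite [k * _]mulrC -mulrA mulrCA ler_wpM2l ?exprn_ge0//.
by apply: ler_pM => //; rewrite ?exprn_ge0// ler_weXn2l// leq_addl.
Qed.

(** With weight [1 / D] on its edge, [Z] is measured by the integral of [Z ^ D], which [massZ] makes
    small. *)
Let gz (e : edge) : R -> R -> R :=
  if l e == Some None then fun x y => Z x y ^+ D else piece (l e).

Let kgz e : bounded_kernel (gz e).
Proof.
rewrite /gz; case: eqP => _; last exact: kpiece.
have [mZ [C ZC]] := kZ; split; first exact: measurable_funX.
exists 1 => x y; case/andP: (Z01 x y) => z0 z1.
by rewrite exprn_ge0//= exprn_ile1.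
Qed.

Let le_gz e x y : F e -> piece (l e) x y <= gz e x y `^ D%:R^-1.
Proof.
move=> _; rewrite /gz; case: eqP => [->|_] /=.
  by rewrite powR_root//; case/andP: (Z01 x y).
by apply: le_powR_unit => //; exact: piece01.
Qed.

Let gz_mass e : F e -> int2 (gz e) + eps <= K * q.
Proof.
rewrite /F /gz; case: (l e) => [[[s t]|]|] // _; first exact: massA.
by rewrite eqxx; apply: le_trans massZ _; rewrite ler_wpM2r// ltW.
Qed.

Let bad_le k (m : edge -> R) : \prod_(e | F e) m e `^ D%:R^-1 <= k * (K * p) ^+ #|F| ->
  0 <= k -> k <= kappa -> (forall e, F e -> int2 (gz e) + eps <= m e) ->
  term l <= p ^+ nedges E * K ^+ nedges E * kappa.
Proof.
move=> mk k0 kk gm; have [v _] := maxdeg_attained D0.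
apply: le_trans (finish k0 kk).
pose w e : R := if F e then D%:R^-1 else 0.
have := @term_le R n E Hloop p A Z hb lo Hp kA kZ A01 Z01 mhb mlo hb01 lo01
  l gz w v 0 eps m eps0 kgz.
rewrite powRr0 mul1r => main; apply: le_trans (main _ _ _ _ _ _ _) _ => //.
- by move=> e; rewrite /w; case: ifP => // _; rewrite invr_ge0.
- by move=> e le; rewrite /w /F le.
- by left.
- by move=> e x y Fe; rewrite /w ifT//; exact: le_gz.
- move=> u; rewrite sum_const if_same addr0; exact: load1.
rewrite ler_wpM2l ?exprn_ge0//.
by rewrite (eq_bigr (fun e => m e `^ D%:R^-1))// => e Fe; rewrite /w /F Fe.
Qed.

Let prodK (P : pred edge) : \prod_(e | P e) ((K * q) `^ D%:R^-1) <= (K * p) ^+ #|P|.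
Proof. by rewrite prodr_const lerXn2r ?nnegrE ?powR_ge0 ?mulr_ge0. Qed.

(** Uniform weights [1 / D] are always admissible; one factor [(zeta q) ^ (1 / D)] in place of
    [(K q) ^ (1 / D)] is the gain. *)
Lemma term_small_label e1 : l e1 = Some None \/ l e1 = Some (Some (true, true)) ->
  term l <= p ^+ nedges E * K ^+ nedges E * kappa.
Proof.
move=> le1; have Fe1 : F e1 by rewrite /F; case: le1 => ->.
apply: (@bad_le (zeta `^ D%:R^-1) (fun e => if e == e1 then zeta * q else K * q)).
- rewrite (bigD1 e1)//= eqxx root_le// -mulrA ler_wpM2l ?powR_ge0//.
  rewrite (eq_bigr (fun=> (K * q) `^ D%:R^-1)); last by move=> e /andP[_ /negbTE->].
  apply: le_trans (ler_wpM2l p_ge0 (prodK _)) _.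
  have -> : #|F| = #|(fun e => F e && (e != e1))|.+1 := cardD1x Fe1.
  rewrite exprS ler_wpM2r ?exprn_ge0 ?mulr_ge0//.
  by rewrite ler_peMl.
- exact: powR_ge0.
- exact: kzeta.
move=> e Fe; case: eqP => [->|_]; last exact: gz_mass.
by rewrite /gz; case: le1 => ->; rewrite ?eqxx.
Qed.

Lemma term_hub_slack h e : class_at l e h = Some true -> (degF h < D)%N ->
  term l <= p ^+ nedges E * K ^+ nedges E * kappa.
Proof.
move=> hh dh; apply: le_trans (finish (powR_ge0 _ _) khub).
pose w e : R := if F e then D%:R^-1 else 0.
apply: le_trans (@term_le R n E Hloop p A Z hb lo Hp kA kZ A01 Z01 mhb mlo hb01 lo01
  l gz w h D%:R^-1 eps (fun=> K * q) eps0 kgz _ _ _ _ gz_mass _ _) _.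
- by move=> e'; rewrite /w; case: ifP => // _; rewrite invr_ge0.
- by rewrite invr_ge0.
- by move=> e' le; rewrite /w /F le.
- by right; exists e.
- by move=> e' x y Fe; rewrite /w ifT//; exact: le_gz.
- move=> u; rewrite sum_const; case: eqP => [->|_]; last by rewrite addr0 load1.
  by rewrite -[X in _ + X]mul1r -mulrDl ler_pdivrMr// mul1r natr1 ler_nat.
rewrite ler_wpM2l ?exprn_ge0// ler_wpM2l ?powR_ge0//.
rewrite (eq_bigr (fun=> (K * q) `^ D%:R^-1)); last by move=> e' Fe; rewrite /w /F Fe.
exact: prodK.
Qed.

Section Mixed.
Hypothesis noZ : forall e, l e != Some None.
Variables (e0 : edge) (v0 : 'I_n).
Hypothesis le0 : l e0 = Some (Some (false, false)).
Hypothesis conn : connect (adj F) v0 (src e0).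

Let Fe0 : F e0. Proof. by rewrite /F le0. Qed.

(** Uniform weights shifted by [sg tau z]. The price is the change [sg tau sum z] in the exponent of
    [K q]; the profit is [beta ^ tau] from [e0] and the hub measure to the power [th]. *)
Let mixed_le (sg th : R) (ht : 'I_n) u z : `|sg| = 1 -> (forall e, ~~ F e -> z e = 0) ->
  (forall e, `|z e| <= n%:R) -> inc e0 u -> 0 <= th ->
  (th = 0 \/ exists e, class_at l e ht = Some true) ->
  (forall v, (degF v)%:R * D%:R^-1 + sg * tau * \sum_(e | inc e v) z e +
     (if v == ht then th else 0) + (if v == u then tau else 0) <= 1) ->
  term l <= p ^+ #|[pred e | l e == None]| *
    (beta `^ tau * ((int01 hb + eps) `^ th *
      ((K * p) ^+ #|F| * (K * q) `^ (sg * tau * \sum_e z e)))).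
Proof.
move=> sg1 zF zn e0u th0 hub ld.
pose w e : R := if F e then D%:R^-1 + sg * tau * z e else 0.
have wz e : `|sg * tau * z e| <= n%:R * tau.
  by rewrite 2!normrM sg1 mul1r gtr0_norm// mulrC ler_wpM2r// ltW.
have w_ge0 e : 0 <= w e.
  rewrite /w; case: ifP => // _; rewrite tauE -natr1 mulrDl mul1r.
  by have := wz e; rewrite ler_norml => /andP[h1 _]; have := ltW tau0; lra.
have w_le1 e : w e + tau <= 1.
  rewrite /w; have := wz e; rewrite ler_norml => /andP[_ h1].
  have h2 : 2 * D%:R^-1 <= 1 :> R by rewrite ler_pdivrMr// mul1r ler_nat.
  move: h2; rewrite tauE -natr1; have h3 : 0 <= n%:R * tau by rewrite mulr_ge0// ltW.
  have := ltW tau0; case: ifP => _; lra.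
have sumw (P : pred edge) : \sum_(e | P e) w e =
    #|[pred e | P e && F e]|%:R * D%:R^-1 + sg * tau * \sum_(e | P e) z e.
  rewrite -sum_const mulr_sumr -big_split /=; apply: eq_bigr => e _.
  by rewrite /w; case: ifPn => // /zF ->; rewrite mulr0 addr0.
have kp e : bounded_kernel (piece (l e)) by exact: kpiece.
apply: le_trans (@term_le_sup R n E Hloop p A Z hb lo Hp kA kZ A01 Z01 mhb mlo hb01
  lo01 l (fun e => piece (l e)) w ht th eps (fun=> K * q) eps0 kp w_ge0 th0 _ hub _
  e0 u tau beta (ltW tau0) e0u Fe0 _ _ _ _) _.
- by move=> e le; rewrite /w /F le.
- move=> e; have := noZ e; case: (l e) => [[[s t]|]|] //= _ _; exact: massA.
- move=> e x y Fe; apply: le_powR_unit; first exact: piece01.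
  apply: le_trans (w_le1 e); rewrite lerD2l; case: ifP => // _; exact: ltW.
- by move=> y; rewrite le0; exact: beta1.
- by move=> y; rewrite le0; exact: beta2.
- move=> v; rewrite sumw; exact: ld.
rewrite ler_wpM2l ?exprn_ge0// 2?ler_wpM2l ?powR_ge0//.
rewrite prod_powR ?mulr_gt0//.
have -> : \sum_(e | l e != None) w e = #|F|%:R * D%:R^-1 + sg * tau * \sum_e z e.
  transitivity (\sum_(e | predT e) w e).
    rewrite [RHS](bigID F) /= [X in _ + X]big1 ?addr0// => e.
    by rewrite /w => /negbTE ->.
  by rewrite sumw; congr (_%:R * _ + _); exact: eq_card.
rewrite powRD; last by apply/implyP => _; rewrite gt_eqF// mulr_gt0.
rewrite ler_wpM2r ?powR_ge0// powR_natr_mul ?mulr_ge0//.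
by rewrite lerXn2r ?nnegrE ?powR_ge0 ?mulr_ge0.
Qed.

Lemma term_low_slack : (degF v0 < D)%N ->
  term l <= p ^+ nedges E * K ^+ nedges E * kappa.
Proof.
move=> dv; have sg : ((-1 : R) == 1) || ((-1 : R) == -1) by rewrite eqxx orbT.
have [u [z [e0u wz]]] := walk_weight_edge Hloop Fe0 sg conn.
have zS := walk_weight_sum Hloop wz; have [zF zn zl] := wz.
apply: le_trans (finish (powR_ge0 _ _) kbeta).
apply: le_trans (@mixed_le 1 0 v0 u z _ zF zn e0u _ _ _) _ => //.
- exact: normr1.
- by left.
- move=> v; rewrite if_same addr0 zl mul1r mulN1r.
  have dE : (degF v)%:R * D%:R^-1 + tau * (v == v0)%:R <= 1.
    case: eqP => [->|_]; last by rewrite mulr0 addr0 load1.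
    rewrite mulr1; apply: (@le_trans _ _ ((degF v0)%:R * D%:R^-1 + D%:R^-1)).
      rewrite lerD2l tauE ler_peMl// ler1n//.
    by rewrite -[X in _ + X]mul1r -mulrDl ler_pdivrMr// mul1r natr1 ler_nat.
  apply: le_trans dE; rewrite mulrBr.
  by case: (v =P u) => _; rewrite ?mulr1 ?mulr0; lra.
rewrite zS subrr mul0r mulr0 !powRr0 mulr1 mul1r.
exact: lexx.
Qed.

(** Subtracting [tau z] for a walk of sign [1] frees weight [tau] at [v0], for the hub indicator,
    and at an end of [e0]. The total weight drops by [tau]; the resulting factor [(K q) ^ - tau] is
    compensated by hub measure times [beta], which is [kmix]. *)
Lemma term_hub_connected e1 : class_at l e1 v0 = Some true ->
  term l <= p ^+ nedges E * K ^+ nedges E * kappa.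
Proof.
move=> hv; have sg : ((1 : R) == 1) || ((1 : R) == -1) by rewrite eqxx.
have [u [z [e0u wz]]] := walk_weight_edge Hloop Fe0 sg conn.
have zS := walk_weight_sum Hloop wz; have [zF zn zl] := wz.
apply: le_trans (finish (powR_ge0 _ _) kmix).
apply: le_trans (@mixed_le (-1) tau v0 u z _ zF zn e0u _ _ _) _ => //.
- by rewrite normrN1.
- by right; exists e1.
- move=> v; rewrite zl mul1r !mulN1r mulrDr.
  apply: le_trans (load1 v).
  by case: eqP => _; case: eqP => _; rewrite ?mulr1 ?mulr0; lra.
rewrite zS mulN1r (_ : (1 + 1) / 2 = 1 :> R); last by field.
have -> : ((int01 hb + eps) * beta / (K * q)) `^ tau =
    (int01 hb + eps) `^ tau * beta `^ tau * ((K * q) `^ tau)^-1.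
  rewrite powRM ?invr_ge0 ?mulr_ge0//; congr (_ * _); first by rewrite powRM.
  by rewrite -powR_inv1 ?mulr_ge0// -powRrM mulN1r powRN.
rewrite mulr1 powRN le_eqVlt; apply/orP; left; apply/eqP.
by congr (_ * _); ring.
Qed.

End Mixed.
End Label.
End BadTerms.

(** * Expanding the homomorphism density *)

Section Expansion.
Variables (R : realType) (n : nat) (E : rel 'I_n).
Hypothesis Hloop : irreflexive E.
Hypothesis Hconn : connected_digraph E.
Local Notation edge := {e : 'I_n * 'I_n | E e.1 e.2}.
Local Notation label := (option (option (bool * bool))).
Variables (p : R) (A Z : R -> R -> R) (hb lo : R -> R).
Local Notation D := (maxdeg E).
Local Notation q := (p ^+ D).
Local Notation cls := (cls hb lo).
Local Notation piece := (piece p A Z hb lo).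
Local Notation term := (@term R n E p A Z hb lo).

Hypotheses (Hp : 0 < p < 1) (D2 : (2 <= D)%N).
Hypotheses (kA : bounded_kernel A) (kZ : bounded_kernel Z).
Hypotheses (A01 : forall x y, 0 <= A x y <= 1) (Z01 : forall x y, 0 <= Z x y <= 1).
Hypotheses (mhb : bounded_measurable hb) (mlo : bounded_measurable lo).
Hypotheses (hb01 : forall x, hb x = 0 \/ hb x = 1).
Hypotheses (lo01 : forall x, lo x = 0 \/ lo x = 1).
Hypotheses (hblo : forall x, hb x * lo x = 0).

Let p0 : 0 < p. Proof. by case/andP: Hp. Qed.
Let p_ge0 : 0 <= p. Proof. exact: ltW. Qed.
Let q0 : 0 < q. Proof. exact: exprn_gt0. Qed.
Let q_ge0 : 0 <= q. Proof. exact: ltW. Qed.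
Let D0 : (0 < D)%N. Proof. exact: leq_trans D2. Qed.

(** For [S] in [S_H] no edge has both ends in [S], so the order of the tests is immaterial. *)
Definition hub_label (S : {set 'I_n}) (e : edge) : label :=
  if src e \in S then Some (Some (true, false))
  else if tgt e \in S then Some (Some (false, true)) else None.

Definition low_label (e : edge) : label := Some (Some (false, false)).

Section HubTerm.
Variable S : {set 'I_n}.
Hypothesis indS : indepHstar E S.

Lemma indep_edge (e : edge) : ~~ ((src e \in S) && (tgt e \in S)).
Proof.
apply/negP => /andP[sS tS]; case/andP: indS => _ /forall_inP/(_ _ sS).
by move=> /forall_inP/(_ _ tS); rewrite [E _ _](valP e).
Qed.

Lemma indep_deg v : v \in S -> deg E v = D.
Proof. by move=> vS; case/andP: indS => /forall_inP/(_ _ vS)/eqP. Qed.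

Lemma edgeST_edge (e : edge) : edgeST E S (src e) (tgt e) = (src e \in S).
Proof.
rewrite /edgeST [E _ _](valP e) /=; have := indep_edge e.
case sS: (src e \in S) => //= tS; rewrite inE tS /=.
by apply/exists_inP; exists (src e) => //; rewrite [E _ _](valP e).
Qed.

Lemma edgeTS_edge (e : edge) : edgeTS E S (src e) (tgt e) = (tgt e \in S).
Proof.
rewrite /edgeTS [E _ _](valP e) /=; have := indep_edge e.
case tS: (tgt e \in S); rewrite ?andbF// andbT => sS; rewrite inE sS /= andbT.
by apply/exists_inP; exists (tgt e) => //; rewrite [E (src e) _](valP e) orbT.
Qed.

Lemma sum_indep_inc (f : edge -> R) : (forall e, hub_label S e = None -> f e = 0) ->
  \sum_(v in S) \sum_(e | inc e v) f e = \sum_e f e.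
Proof.
move=> f0; rewrite (exchange_big_dep predT)//=; apply: eq_bigr => e _.
have := f0 e; rewrite /hub_label; have := indep_edge e.
case sS: (src e \in S) => /=; [|case tS: (tgt e \in S) => /=].
- move=> tS _; rewrite (big_pred1 (src e))// => v /=; rewrite /inc [v == _]eq_sym.
  have [<-|sv] := eqVneq (src e) v; first by rewrite sS.
  by have [<-|tv] := eqVneq (tgt e) v; rewrite ?andbF// andbT (negbTE tS).
- move=> _ _; rewrite (big_pred1 (tgt e))// => v /=; rewrite /inc [v == _]eq_sym orbC.
  have [<-|tv] := eqVneq (tgt e) v; first by rewrite tS.
  by have [<-|sv] := eqVneq (src e) v; rewrite ?andbF// andbT sS.
- by move=> _ ->//; rewrite big1.
Qed.

(** All [D] edges at a vertex of [S] are labelled, and each labelled edge has one end in [S]. Hence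
    [q ^ #|S|] is exactly the power of [p] that these edges would have contributed with label
    [p]. *)
Lemma card_hub_label : #|[pred e | hub_label S e != None]| = (D * #|S|)%N.
Proof.
apply/eqP; rewrite -(eqr_nat R); apply/eqP.
have := sum_indep_inc (f := fun e => if hub_label S e != None then 1 else 0).
rewrite -big_mkcond /= sumr_const => <-; last by move=> e ->.
rewrite natrM mulr_natr -sumr_const; apply: eq_bigr => v vS.
rewrite -(indep_deg vS) (degE Hloop) -sumr_const; apply: eq_bigr => e.
rewrite /inc /hub_label => /orP[] /eqP ->; rewrite vS//.
by case: (src e \in S).
Qed.

Section Matching.
Variables (w : 'I_n -> 'I_n -> R).

(** A matching is constrained only on edges of [F_S], so its other values are replaced by 0. *)
Let w' i j := if edgeF E S i j then w i j else 0.
Let we (e : edge) := w' (src e) (tgt e).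

Let weE e : we e = if hub_label S e != None then w (src e) (tgt e) else 0.
Proof.
rewrite /we /w' /edgeF edgeST_edge edgeTS_edge /hub_label.
by case: (src e \in S) => //=; case: (tgt e \in S).
Qed.

Let edgeF_E i j : edgeF E S i j -> E i j.
Proof. by case/orP => /and3P[]. Qed.

Lemma load_edges v : load E S w v =
  \sum_(e | inc e v) (if hub_label S e != None then w (src e) (tgt e) else 0).
Proof.
rewrite -(eq_bigr _ (fun e _ => weE e)).
rewrite (sum_inc_src_tgt Hloop) /we (sum_src E w') (sum_tgt E w') addrC /load.
congr (_ + _).
  rewrite [RHS]big_mkcond [LHS]big_mkcond; apply: eq_bigr => u _; rewrite /w'.
  by case: ifPn => [/edgeF_E ->|]//; case: ifP.
rewrite [RHS]big_mkcond [LHS]big_mkcond; apply: eq_bigr => u _; rewrite /w'.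
by case: ifPn => [/edgeF_E ->|]//; case: ifP.
Qed.

Let loadE v : load E S w v = \sum_(e | inc e v) we e.
Proof. by rewrite load_edges; apply: eq_bigr => e _; rewrite weE. Qed.

Hypothesis mw : max_frac_matching E S w.

Let we0 e : 0 <= we e <= 1.
Proof.
rewrite /we /w'; case: ifP => [h|_]; last by rewrite lexx ler01.
by case: mw => + _ _; apply.
Qed.

Lemma matching_sumST :
  \sum_u \sum_(v | edgeST E S u v) w u v = \sum_(e : edge | src e \in S) we e.
Proof.
rewrite [RHS]big_mkcond /=.
rewrite (big_edge E _ (fun i j => if i \in S then w' i j else 0)).
apply: eq_bigr => i _; rewrite [LHS]big_mkcond [RHS]big_mkcond; apply: eq_bigr => j _.
case: (boolP (edgeST E S i j)) => h; case: (boolP (E i j)) => Eij //.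
- by have /and3P[_ -> _] := h; rewrite /w' /edgeF h.
- by case/and3P: h Eij => ->.
case: ifP => // iS; rewrite /w' /edgeF (negbTE h) /=; case: ifP => // /and3P[_ _ jS].
by have := indep_edge (exist _ (i, j) Eij); rewrite /src /tgt /= iS jS.
Qed.

Lemma matching_sumTS :
  \sum_u \sum_(v | edgeTS E S u v) w u v = \sum_(e : edge | tgt e \in S) we e.
Proof.
rewrite [RHS]big_mkcond /=.
rewrite (big_edge E _ (fun i j => if j \in S then w' i j else 0)).
apply: eq_bigr => i _; rewrite [LHS]big_mkcond [RHS]big_mkcond; apply: eq_bigr => j _.
case: (boolP (edgeTS E S i j)) => h; case: (boolP (E i j)) => Eij //.
- by have /and3P[_ _ ->] := h; rewrite /w' /edgeF h orbT.
- by case/and3P: h Eij => ->.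
case: ifP => // jS; rewrite /w' /edgeF (negbTE h) orbF; case: ifP => // /and3P[_ iS _].
by have := indep_edge (exist _ (i, j) Eij); rewrite /src /tgt /= iS jS.
Qed.

Lemma matching_size : \sum_u \sum_(v | edgeST E S u v) w u v +
  \sum_u \sum_(v | edgeTS E S u v) w u v = #|S|%:R.
Proof.
rewrite matching_sumST matching_sumTS.
have -> : #|S|%:R = \sum_e we e.
  rewrite -sum_indep_inc; last by move=> e h; rewrite weE h.
  rewrite (eq_bigr (fun=> 1)) ?sumr_const// => v vS.
  by rewrite -loadE; case: mw => _ _; apply.
rewrite [RHS](bigID (fun e => src e \in S)) /=; congr (_ + _).
rewrite big_mkcond [RHS]big_mkcond; apply: eq_bigr => e _.
rewrite weE /hub_label; have := indep_edge e.
by case: (src e \in S) => /= [/negbTE-> //|_]; case: (tgt e \in S).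
Qed.

(** The conditions on a fractional matching are those of Finner's inequality. By [matching_size] the
    exponents of [th1 q] and [th2 q] add up to [#|S|], so by [card_hub_label] the power of [q]
    completes that of [p] to [p ^ e(H)]. *)
Lemma hub_term_le (eps th1 th2 : R) : 0 < eps -> 0 < th1 -> 0 < th2 ->
  int2 (fun x y => A x y * hb x * lo y) + eps <= th1 * q ->
  int2 (fun x y => A x y * lo x * hb y) + eps <= th2 * q ->
  term (hub_label S) <= p ^+ nedges E *
    (th1 `^ (\sum_u \sum_(v | edgeST E S u v) w u v) *
     th2 `^ (\sum_u \sum_(v | edgeTS E S u v) w u v)).
Proof.
move=> eps0 th10 th20 m1 m2; have [v _] := maxdeg_attained D0.
have we_ge0 e : 0 <= we e by case/andP: (we0 e).
have main := @term_le R n E Hloop p A Z hb lo Hp kA kZ A01 Z01 mhb mlo hb01 lo01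
  (hub_label S) (fun e => piece (hub_label S e)) we v 0 eps
  (fun e => if src e \in S then th1 * q else th2 * q) eps0
  (fun e => kpiece Hp kA kZ mhb mlo _) we_ge0 (lexx 0).
apply: le_trans (main _ _ _ _ _) _.
- by move=> e h; rewrite weE h.
- by left.
- move=> e; rewrite /hub_label; case: ifP => _ //=; case: ifP => //=.
- move=> e x y _; apply: le_powR_unit; last by case/andP: (we0 e).
  exact: piece01.
- by move=> u; rewrite if_same addr0 -loadE; case: mw => _ + _; apply.
rewrite powRr0 mul1r.
have -> : \prod_(e | hub_label S e != None)
    (if src e \in S then th1 * q else th2 * q) `^ we e =
  (\prod_(e | src e \in S) (th1 * q) `^ we e) *
  (\prod_(e | tgt e \in S) (th2 * q) `^ we e).
  rewrite [LHS]big_mkcond [X in _ = X * _]big_mkcond [X in _ = _ * X]big_mkcond.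
  rewrite -big_split; apply: eq_bigr => e _ /=; rewrite /hub_label.
  have := indep_edge e; case: (src e \in S) => /= [/negbTE->|_]; rewrite ?mulr1//.
  by case: (tgt e \in S); rewrite ?mul1r.
rewrite !prod_powR ?mulr_gt0// -matching_sumST -matching_sumTS.
set a := \sum_u _; set b := \sum_u _; have ab : a + b = #|S|%:R by exact: matching_size.
rewrite !powRM ?(ltW th10) ?(ltW th20)// mulrACA -powRD; last first.
  by apply/implyP => _; rewrite gt_eqF.
rewrite ab powR_mulrn// -exprM -card_hub_label mulrCA -exprD mulrC.
rewrite (_ : (_ + _)%N = nedges E); first exact: lexx.
by rewrite nedgesE -(cardC [pred e | hub_label S e == None]).
Qed.

End Matching.

(** Vertices of [S] have degree exactly [D], with all their edges in [F_S]; this is why matchings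
    saturating [S] exist. *)
Lemma uniform_matching : max_frac_matching E S (fun _ _ => D%:R^-1 : R).
Proof.
have DR : 0 < D%:R :> R by rewrite ltr0n.
have ld v : load E S (fun _ _ => D%:R^-1 : R) v =
    #|[pred e : edge | inc e v && (hub_label S e != None)]|%:R * D%:R^-1.
  by rewrite load_edges -big_mkcondr /= sumr_const mulr_natl.
split.
- by move=> u v _; rewrite invr_ge0 ltW//= invf_le1// ler1n.
- move=> v; rewrite ld ler_pdivrMr// mul1r ler_nat.
  apply: leq_trans (deg_le_maxdeg E v); rewrite (degE Hloop).
  by apply: subset_leq_card; apply/fintype.subsetP => e /andP[].
move=> v vS; rewrite ld -[RHS](@divff _ D%:R) ?gt_eqF//; congr (_%:R * _).
rewrite -(indep_deg vS) (degE Hloop); apply: eq_card => e; rewrite !inE.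
case iv: (inc e v) => //=; move: iv; rewrite /inc /hub_label => /orP[] /eqP ->.
  by rewrite vS.
by rewrite vS; case: ifP.
Qed.

End HubTerm.

(** In a regular graph the weights [1 / D] saturate every vertex, and their total [e(H) / D = n / 2]
    is the exponent of [eta]. *)
Lemma low_term_le (eps eta : R) : 0 < eps -> 0 < eta -> regular E ->
  int2 (fun x y => A x y * lo x * lo y) + eps <= eta * q ->
  term low_label <= p ^+ nedges E * eta `^ (n%:R / 2).
Proof.
move=> eps0 eta0 regE m1; have [v vD] := maxdeg_attained D0.
have degD u : deg E u = D by rewrite (regE u v).
have DR : D%:R != 0 :> R by rewrite pnatr_eq0 -lt0n.
have main := @term_le R n E Hloop p A Z hb lo Hp kA kZ A01 Z01 mhb mlo hb01 lo01
  low_label (fun e => piece (low_label e)) (fun=> D%:R^-1) v 0 eps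
  (fun e => eta * q) eps0 (fun e => kpiece Hp kA kZ mhb mlo _).
apply: le_trans (main _ _ _ _ _ _ _) _ => //.
- by left.
- move=> e x y _; apply: le_powR_unit; first exact: piece01.
  by rewrite invf_le1 ?ler1n// ltr0n.
- move=> u; rewrite if_same addr0 sumr_const -(degE Hloop) degD.
  by rewrite -[X in X <= _]mulr_natl divff.
rewrite powRr0 mul1r prod_powR ?mulr_gt0// sumr_const.
have -> : #|[pred e | low_label e == None]| = 0%N by apply: eq_card0.
have -> : #|(fun e : edge => low_label e != None)| = nedges E.
  by rewrite nedgesE; apply: eq_card.
rewrite expr0 mul1r -[X in _ `^ X]mulr_natl powR_natr_mul ?mulr_ge0 ?(ltW eta0)//.
rewrite powRM ?(ltW eta0)// powR_root// exprMn mulrC ler_wpM2l ?exprn_ge0//.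
rewrite -powR_natr_mul ?(ltW eta0)// le_eqVlt; apply/orP; left; apply/eqP.
congr (_ `^ _); apply: (mulIf DR); rewrite divfK//.
have := handshake Hloop (fun _ : edge => 1%N).
rewrite (eq_bigr (fun=> D)); last by move=> u _; rewrite sum1_card -(degE Hloop).
rewrite sum_nat_const card_ord sum_nat_const -nedgesE => nDE.
have : (n * D)%:R = (nedges E * 2)%:R :> R by rewrite nDE.
by rewrite !natrM => h; rewrite mulrAC h; field.
Qed.

Variables (K zeta eps beta kappa : R).
Hypotheses (K1 : 1 <= K) (zeta0 : 0 < zeta) (zetaK : zeta <= K) (eps0 : 0 < eps).
Hypothesis massA : forall s t, int2 (fun x y => A x y * cls s x * cls t y) + eps <= K * q.
Hypothesis massZ : int2 (fun x y => Z x y ^+ D) + eps <= zeta * q.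
Hypothesis masshh : int2 (fun x y => A x y * hb x * hb y) + eps <= zeta * q.
Hypothesis beta1 : forall y, int01 (fun v => A v y * lo v * lo y) + eps <= beta.
Hypothesis beta2 : forall y, int01 (fun v => A y v * lo y * lo v) + eps <= beta.
Local Notation tau := ((D%:R * n.+1%:R)^-1).
Hypothesis kzeta : zeta `^ D%:R^-1 <= kappa.
Hypothesis khub : (int01 hb + eps) `^ D%:R^-1 <= kappa.
Hypothesis kbeta : beta `^ tau <= kappa.
Hypothesis kmix : ((int01 hb + eps) * beta / (K * q)) `^ tau <= kappa.

(** Where none of the gains applies, a vertex joined by labelled edges to an edge between low
    vertices, or used as a hub, has labelled degree [D], so all its edges are labelled. In the first
    situation connectedness spreads this over [H], which is then regular with low labels only.
    Otherwise the vertices required to be hubs form [S], and every labelled edge joins a hub to a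
    low vertex. *)
Lemma term_cases (l : edge -> label) :
  [\/ term l <= p ^+ nedges E * K ^+ nedges E * kappa,
      exists2 S, indepHstar E S & l =1 hub_label S |
      regular E /\ l =1 low_label].
Proof.
have kappa0 : 0 <= kappa by exact: le_trans (powR_ge0 _ _) kzeta.
pose F e := l e != None.
have [/existsP[e1 h]|] :=
    boolP [exists e, (l e == Some None) || (l e == Some (Some (true, true)))].
  constructor 1; apply: (term_small_label Hloop Hp D2 kA kZ A01 Z01
      mhb mlo hb01 lo01 K1 zeta0 zetaK eps0 massA massZ
    masshh kzeta (e1 := e1)); by case/orP: h => /eqP ->; [left|right].
rewrite negb_exists => /forallP noZ.
have [/existsP[v /andP[/existsP[e /eqP h] /existsP[e' /eqP h']]]|] :=
  boolP [exists v, [exists e, class_at l e v == Some true] &&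
                   [exists e, class_at l e v == Some false]].
  constructor 1; rewrite (term_inconsistent p A Z hblo h h').
  by rewrite !mulr_ge0 ?exprn_ge0// (le_trans ler01).
rewrite negb_exists => /forallP consistent.
have cons v e e' : class_at l e v = Some true -> class_at l e' v = Some false -> False.
  move=> h h'; have := consistent v; rewrite negb_and => /orP[] /existsP[].
    by exists e; rewrite h.
  by exists e'; rewrite h'.
have noZ' e : l e != Some None by have := noZ e; rewrite negb_or => /andP[].
have nohh e : l e != Some (Some (true, true)) by have := noZ e; rewrite negb_or => /andP[].
have Fdeg v e : (#|[pred e | inc e v && (l e != None)]| = D)%N -> inc e v -> F e.
  move=> dv iv.
  have sub : [pred e | inc e v && (l e != None)] \subset [pred e : edge | inc e v].
    by apply/fintype.subsetP => e' /andP[].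
  have [_ cE] := subset_leqif_card sub.
  have : [pred e : edge | inc e v] \subset [pred e | inc e v && (l e != None)].
    rewrite -cE eqn_leq (subset_leq_card sub) dv -(degE Hloop); exact: deg_le_maxdeg.
  by move=> /fintype.subsetP/(_ e iv)/andP[].
have degFD v : (#|[pred e | inc e v && (l e != None)]| <= D)%N.
  exact: leq_trans (degF_le Hloop l v) (deg_le_maxdeg E v).
have degD v : (#|[pred e | inc e v && (l e != None)]| = D)%N -> deg E v = D.
  move=> dv; apply/eqP; rewrite eqn_leq deg_le_maxdeg -{1}dv; exact: degF_le.
have class_src e s t : l e = Some (Some (s, t)) -> class_at l e (src e) = Some s.
  by move=> h; rewrite /class_at h eqxx.
have class_tgt e s t : l e = Some (Some (s, t)) -> class_at l e (tgt e) = Some t.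
  by move=> h; rewrite /class_at h (negbTE (src_neq_tgt Hloop e)) eqxx.
have [/existsP[e0 /eqP le0]|] := boolP [exists e, l e == Some (Some (false, false))].
  have [/existsP[v0 /andP[cv dv]]|] := boolP [exists v0,
      connect (adj F) v0 (src e0) && (#|[pred e | inc e v0 && (l e != None)]| < D)%N].
    by constructor 1; exact: (term_low_slack Hloop Hp D2 kA kZ A01 Z01
      mhb mlo hb01 lo01 K1 eps0 massA beta1 beta2
      kbeta noZ' le0 cv dv).
  rewrite negb_exists => /forallP noslack.
  have [/existsP[v0 /andP[cv /existsP[e1 /eqP h1]]]|] := boolP [exists v0,
      connect (adj F) v0 (src e0) && [exists e1, class_at l e1 v0 == Some true]].
    by constructor 1; exact: (term_hub_connected Hloop Hp D2 kA kZ A01 Z01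
      mhb mlo hb01 lo01 K1 eps0 massA beta1 beta2
      kmix noZ' le0 cv h1).
  rewrite negb_exists => /forallP nohub.
  have dF v : connect (adj F) v (src e0) ->
      #|[pred e | inc e v && (l e != None)]| = D.
    move=> cv; have := noslack v; rewrite cv /= -leqNgt => Dle.
    by apply/eqP; rewrite eqn_leq degFD Dle.
  (* Every edge of [H] at a vertex of full labelled degree is labelled, so a path in [H] from
     [src e0] never leaves the labelled component. *)
  have all_conn v : connect (adj F) v (src e0).
    have /connectP[pth pthP ->] := Hconn (src e0) v.
    have main : forall x, connect (adj F) x (src e0) ->
        path [rel x y | E x y || E y x] x pth -> connect (adj F) (last x pth) (src e0).
      elim: pth {pthP} => [|y pth IH] x cx //=.
      move=> /andP[Exy pthy]; apply: IH pthy; apply: (connect_trans _ cx).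
      apply: connect1.
      have [e [ex ey xy]] : exists e : edge, [/\ inc e x, inc e y & x != y].
        case/orP: Exy => Exy; have xy : x != y by
          apply: contraL Exy => /eqP ->; rewrite Hloop.
          by exists (exist _ (x, y) Exy); rewrite /inc /src /tgt /= !eqxx orbT.
        by exists (exist _ (y, x) Exy); rewrite /inc /src /tgt /= !eqxx orbT.
      apply/existsP; exists e; rewrite ex ey eq_sym xy !andbT.
      exact: Fdeg (dF _ cx) ex.
    exact: main (connect0 _ _) pthP.
  constructor 3; split; first by move=> u v; rewrite !degD ?dF.
  move=> e; have : F e by apply: Fdeg (dF _ (all_conn (src e))) _; rewrite /inc eqxx.
  rewrite /F /low_label; have := noZ' e.
  have cs := class_src e; have ct := class_tgt e.
  have nh v : class_at l e v <> Some true.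
    move=> h; have := nohub v; rewrite all_conn /= => /existsP[]; by exists e; rewrite h.
  case: (l e) cs ct => [[[s t]|]|] // cs ct _ _.
  have := nh (src e); rewrite (cs _ _ erefl); have := nh (tgt e); rewrite (ct _ _ erefl).
  by case: s {cs ct}; case: t.
rewrite negb_exists => /forallP nolow.
have [/existsP[v /andP[/existsP[e /eqP h] dv]]|] := boolP [exists v,
    [exists e, class_at l e v == Some true] &&
    (#|[pred e | inc e v && (l e != None)]| < D)%N].
  by constructor 1; exact: (term_hub_slack Hloop Hp D2 kA kZ A01 Z01
      mhb mlo hb01 lo01 K1 zetaK eps0 massA massZ khub
    h dv).
rewrite negb_exists => /forallP noslack; constructor 2.
pose S := finset (fun v => [exists e, class_at l e v == Some true]).
have inS v : v \in S -> exists e, class_at l e v = Some true.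
  by rewrite inE => /existsP[e /eqP h]; exists e.
have Sin e v : class_at l e v = Some true -> v \in S.
  by move=> h; rewrite inE; apply/existsP; exists e; rewrite h.
have dS v : v \in S -> #|[pred e | inc e v && (l e != None)]| = D.
  rewrite inE => h; have := noslack v; rewrite h /= -leqNgt => Dle.
  by apply/eqP; rewrite eqn_leq degFD Dle.
have lE : l =1 hub_label S.
  move=> e; rewrite /hub_label; have cs := class_src e; have ct := class_tgt e.
  have Zc := noZ' e; have hc := nohh e; have lc := nolow e.
  have Fs sS := Fdeg _ e (dS _ sS); have Ft := Fdeg _ e (dS (tgt e) _).
  have iS : inc e (src e) by rewrite /inc eqxx.
  have iT : inc e (tgt e) by rewrite /inc eqxx orbT.
  have kS s t : l e = Some (Some (s, t)) -> (src e \in S) = s.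
    move=> h; case: s h => h; first exact: Sin (cs _ _ h).
    by apply/negP => /inS[e' h']; exact: cons h' (cs _ _ h).
  have kT s t : l e = Some (Some (s, t)) -> (tgt e \in S) = t.
    move=> h; case: t h => h; first exact: Sin (ct _ _ h).
    by apply/negP => /inS[e' h']; exact: cons h' (ct _ _ h).
  case le: (l e) Zc hc lc => [[[s t]|]|] // _; last first.
    move=> _ _; case: ifPn => [sS|_]; first by have := Fs _ sS iS; rewrite /F le.
    by case: ifPn => // tS; have := Fdeg _ e (dS _ tS) iT; rewrite /F le.
  by rewrite (kS _ _ le) (kT _ _ le); case: s {le}; case: t.
exists S => //; apply/andP; split.
  by apply/forall_inP => v /dS/degD ->.
apply/forall_inP => u uS; apply/forall_inP => v vS; apply/negP => Euv.
pose e : edge := exist _ (u, v) Euv.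
have le : l e = Some (Some (true, false)) by rewrite lE /hub_label /src /= uS.
by have [e' h'] := inS v vS; exact: cons h' (class_tgt _ _ _ le).
Qed.

(** Each [S] and the low labelling account for a single labelling, while the error is charged to all
    of them; hence the number of labellings in front of it. *)
Lemma density_le (W : R -> R -> R) (c : {set 'I_n} -> R) (c' : R) :
  bounded_kernel W ->
  (forall x y, W x y <= \sum_(l : label) piece l x y) ->
  (forall S, indepHstar E S -> 0 <= c S) -> 0 <= c' ->
  (forall S, indepHstar E S -> term (hub_label S) <= p ^+ nedges E * c S) ->
  (regular E -> term low_label <= p ^+ nedges E * c') ->
  (tHW E W <= (p ^+ nedges E * (\sum_(S | indepHstar E S) c S +
     (if `[< regular E >] then c' else 0) +
     #|{ffun edge -> label}|%:R * (K ^+ nedges E * kappa)))%:E)%E.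
Proof.
move=> kW WL c0 c'0 hc hc'.
have kappa0 : 0 <= kappa by exact: le_trans (powR_ge0 _ _) kzeta.
have pN0 : 0 <= p ^+ nedges E by exact: exprn_ge0.
have KN0 : 0 <= K ^+ nedges E by rewrite exprn_ge0// (le_trans ler01).
have W0 x y : 0 <= W x y by have [_ [C /(_ x y)/andP[]]] := kW.
pose FW (x : nat -> R) := \prod_(e : edge) W (x (src e)) (x (tgt e)).
have gFW : good FW by apply: good_prod => e _; exact: good_kernel.
rewrite /tHW (_ : (fun x => _) = (fun x => (FW x)%:E)); last first.
  by apply/funext => x; rewrite /FW (big_edge E _ (fun i j => W (x i) (x j))).
rewrite iter_intE// lee_fin -/all_vertices.
pose FL (l : {ffun edge -> label}) (x : nat -> R) :=
  \prod_e piece (l e) (x (src e)) (x (tgt e)).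
have gFL l : good (FL l) by apply: good_prod => e _; exact/good_piece.
have exp_le : itg (all_vertices n) FW (fun=> 0) <= \sum_(l : {ffun edge -> label}) term l.
  rewrite -(itg_sum _ _ _ gFL); apply: itg_le => //; first exact: good_sum.
  move=> x; rewrite /FL -(bigA_distr_bigA (fun e l => piece l (x (src e)) (x (tgt e)))).
  by apply: ler_prod => e _; rewrite W0 WL.
apply: le_trans exp_le _.
pose bd (l : {ffun edge -> label}) := p ^+ nedges E *
  (\sum_(S | indepHstar E S) (if l == [ffun e => hub_label S e] then c S else 0) +
   (if `[< regular E >] then if l == [ffun e => low_label e] then c' else 0 else 0) +
   K ^+ nedges E * kappa).
have s1 (l : {ffun edge -> label}) : 0 <= \sum_(S | indepHstar E S)
    (if l == [ffun e => hub_label S e] then c S else 0).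
  by apply: sumr_ge0 => S /c0 cS; case: ifP.
have s2 (l : {ffun edge -> label}) : 0 <= if `[< regular E >] then
    if l == [ffun e => low_label e] then c' else 0 else 0.
  by case: ifP => // _; case: ifP.
have s3 : 0 <= K ^+ nedges E * kappa by rewrite mulr_ge0.
have term_bd (l : {ffun edge -> label}) : term l <= bd l.
  rewrite /bd; have [h|[S iS h]|[rE h]] := term_cases l.
  - by apply: le_trans h _; rewrite -mulrA ler_wpM2l// lerDr addr_ge0.
  - have -> : (l : edge -> label) = hub_label S by exact/funext.
    apply: le_trans (hc S iS) _; rewrite ler_wpM2l// -addrA.
    apply: ler_wpDr; first by rewrite addr_ge0.
    rewrite (bigD1 S)//= ifT; last by apply/eqP/ffunP => e; rewrite ffunE h.
    by rewrite lerDl; apply: sumr_ge0 => T /andP[/c0 cT _]; case: ifP.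
  - have -> : (l : edge -> label) = low_label by exact/funext.
    apply: le_trans (hc' rE) _; rewrite ler_wpM2l//.
    rewrite ifT; last exact/asboolP.
    rewrite ifT; last by apply/eqP/ffunP => e; rewrite ffunE h.
    by apply: ler_wpDr => //; apply: ler_wpDl.
apply: le_trans (ler_sum _ (fun l _ => term_bd l)) _.
rewrite -mulr_sumr ler_wpM2l// 2!big_split /= exchange_big /=.
have pick (l0 : {ffun edge -> label}) (a : R) : \sum_l (if l == l0 then a else 0) = a.
  by rewrite -big_mkcond /= big_pred1_eq.
rewrite (eq_bigr c) => [|S _]; last exact: pick.
rewrite sumr_const mulr_natl; rewrite !lerD2r lerD2l.
by case: ifP => _; rewrite ?pick// big1.
Qed.

End Expansion.

(** * The relative entropy and the splitting of a graphon *)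

Section Entropy.
Variable R : realType.
Implicit Types p x : R.

Lemma ln_ge_1subV x : 0 < x -> 1 - x^-1 <= ln x.
Proof.
move=> x0; have xV0 : 0 < x^-1 by rewrite invr_gt0.
have := @le_ln1Dx R (x^-1 - 1); rewrite ltrBrDr addNr xV0 => /(_ isT).
by rewrite addrC subrK lnV ?posrE//; lra.
Qed.

Lemma xlogxE x p : xlogx x p = x * ln (x / p).
Proof. by rewrite /xlogx; case: eqP => // ->; rewrite mul0r. Qed.

(** By [ln y >= 1 - 1 / y], the second half of [Ip] is at least [(1 - x) - (1 - p) = p - x]. *)
Lemma Ip_ge p x : 0 < p < 1 -> 0 <= x <= 1 -> x * ln (x / p) - (x - p) <= Ip p x.
Proof.
move=> /andP[p0 p1] /andP[x0 x1]; rewrite /Ip !xlogxE lerD2l.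
have [->|xN1] := eqVneq x 1; first by rewrite subrr mul0r; lra.
have x1' : 0 < 1 - x by rewrite subr_gt0 lt_neqAle xN1.
have p1' : 0 < 1 - p by rewrite subr_gt0.
have := ln_ge_1subV (divr_gt0 x1' p1'); rewrite invf_div => h.
have := ler_wpM2l (ltW x1') h; rewrite mulrBr mulr1 mulrCA divff ?gt_eqF// mulr1.
by lra.
Qed.

(* With [r = sqrt (p / x)] the bound [ln y >= 1 - 1 / y] at [y = 1 / r] turns
   [x ln (x / p) - (x - p)] into at least [x (1 - r) ^ 2]. *)
Lemma Ip_ge_sqrt p x : 0 < p < 1 -> 0 <= x <= 1 ->
  exists r, [/\ 0 <= r, p = r ^+ 2 * x \/ x = 0 & x * (1 - r) ^+ 2 <= Ip p x].
Proof.
move=> hp hx; have h := Ip_ge hp hx.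
have /andP[p0 p1] := hp; have /andP[x0 x1] := hx.
have [x00|xN0] := eqVneq x 0.
  exists 1; split => //; first by right.
  by apply: le_trans h; rewrite x00 !mul0r; lra.
have x0' : 0 < x by rewrite lt_neqAle eq_sym xN0.
exists (Num.sqrt (p / x)); set r := Num.sqrt _.
have r0 : 0 < r by rewrite sqrtr_gt0 divr_gt0.
have r2 : r ^+ 2 = p / x by rewrite sqr_sqrtr// divr_ge0// ltW.
have px : p = r ^+ 2 * x by rewrite r2 divfK.
split; [exact: ltW|by left|]; apply: le_trans h.
have -> : ln (x / p) = 2 * ln r^-1.
  rewrite -invf_div -r2 -exprVn lnXn ?invr_gt0// mulr_natl//.
have := ln_ge_1subV (x := r^-1); rewrite invr_gt0 invrK => /(_ r0) lr.
have := ler_wpM2l x0 lr; rewrite px; lra.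
Qed.

Lemma Ip_ge0 p x : 0 < p < 1 -> 0 <= x <= 1 -> 0 <= Ip p x.
Proof.
move=> hp hx; have [r [_ _ h]] := Ip_ge_sqrt hp hx; apply: le_trans h.
by rewrite mulr_ge0 ?sqr_ge0//; case/andP: hx.
Qed.

(** With [r] from [Ip_ge_sqrt], [x - p = x (1 - r) (1 + r)] and [1 + r <= 2]. The factor [x] on the
    right is what makes small values of a graphon negligible in the square norm. *)
Lemma Ip_ge_sqr p x : 0 < p < 1 -> p <= x <= 1 -> (x - p) ^+ 2 <= 4 * x * Ip p x.
Proof.
move=> hp /andP[px x1]; have /andP[p0 p1] := hp.
have x0 : 0 < x by exact: lt_le_trans px.
have [|r [r0 h1 h]] := @Ip_ge_sqrt p x hp; first by rewrite ltW.
have {h1}h1 : p = r ^+ 2 * x by case: h1 => // x00; rewrite x00 ltxx in x0.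
have r1 : r <= 1.
  rewrite -(@ler_pXn2r _ 2)// ?nnegrE// expr1n.
  by rewrite -(ler_pM2r x0) mul1r -h1.
have h2 : 4 * x * (x * (1 - r) ^+ 2) <= 4 * x * Ip p x.
  by rewrite ler_wpM2l// mulr_ge0// ltW.
apply: le_trans h2; rewrite h1.
have -> : (x - r ^+ 2 * x) ^+ 2 = x ^+ 2 * (1 - r) ^+ 2 * (1 + r) ^+ 2 by ring.
have -> : 4 * x * (x * (1 - r) ^+ 2) = x ^+ 2 * (1 - r) ^+ 2 * 4 by ring.
by rewrite ler_wpM2l ?mulr_ge0 ?sqr_ge0//; nra.
Qed.

(** Here [ln x >= - 2 ln L]; the fraction [e] of [L] absorbs this loss together with the term
    [x - p]. *)
Lemma Ip_ge_lin p x e : 0 < p < 1 -> (ln p^-1) ^- 2 <= x <= 1 ->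
  1 <= ln p^-1 -> 2 * ln (ln p^-1) + 1 <= e * ln p^-1 ->
  x * ((1 - e) * ln p^-1) <= Ip p x.
Proof.
move=> hp; have /andP[p0 p1] := hp; set L := ln p^-1 => /andP[xL x1] L1 eL.
have L0 : 0 < L by exact: lt_le_trans L1.
have x0 : 0 < x by apply: lt_le_trans xL; rewrite invr_gt0 exprn_gt0.
apply: le_trans (Ip_ge hp _); last by rewrite ltW.
have lnx : - (2 * ln L) <= ln x.
  rewrite mulr_natl -lnXn// -lnV ?posrE ?exprn_gt0// ler_ln ?posrE//.
  by rewrite invr_gt0 exprn_gt0.
rewrite lnM ?posrE ?invr_gt0// -/L.
apply: (@le_trans _ _ (x * (ln x + L - 1))); last by lra.
by rewrite ler_wpM2l ?(ltW x0)//; lra.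
Qed.

Lemma measurable_Ip p : measurable_fun setT (Ip p).
Proof.
rewrite (_ : Ip p = fun x => x * ln (x / p) + (1 - x) * ln ((1 - x) / (1 - p))).
  apply: measurable_funD; apply: measurable_funM.
  - exact: measurable_id.
  - apply: measurableT_comp; first exact: measurable_ln.
    by apply: measurable_funM; [exact: measurable_id | exact: measurable_cst].
  - by apply: measurable_funB; [exact: measurable_cst | exact: measurable_id].
  - apply: measurableT_comp; first exact: measurable_ln.
    apply: measurable_funM; last exact: measurable_cst.
    by apply: measurable_funB; [exact: measurable_cst | exact: measurable_id].
by apply/funext => x; rewrite /Ip !xlogxE.
Qed.

(** A crude bound, for integrability only. *)
Lemma Ip_le p x : 0 < p < 1 -> 0 <= x <= 1 -> Ip p x <= p^-1 + (1 - p)^-1.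
Proof.
move=> /andP[p0 p1] /andP[x0 x1]; rewrite /Ip !xlogxE.
have aux (y s : R) : 0 <= y <= 1 -> 0 < s -> y * ln (y / s) <= s^-1.
  move=> /andP[y0 y1] s0; have [->|yN0] := eqVneq y 0.
    by rewrite mul0r invr_ge0 ltW.
  have y0' : 0 < y by rewrite lt_neqAle eq_sym yN0.
  have h : ln (y / s) <= s^-1.
    apply: le_trans (ltW (ln_sublinear (divr_gt0 y0' s0))) _.
    by rewrite ler_piMl// invr_ge0 ltW.
  apply: le_trans (ler_wpM2l y0 h) _.
  by rewrite ler_piMl// invr_ge0 ltW.
by apply: lerD; apply: aux; rewrite ?subr_gt0 ?x0//; apply/andP; split; lra.
Qed.

End Entropy.

Section Int2.
Variable R : realType.
Implicit Types f g : R -> R -> R.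

Lemma bounded_kernelD f g : bounded_kernel f -> bounded_kernel g ->
  bounded_kernel (fun x y => f x y + g x y).
Proof.
move=> [mf [C fC]] [mg [C' gC]]; split; first exact: measurable_funD.
exists (C + C') => a b; have /andP[f0 f1] := fC a b.
by have /andP[g0 g1] := gC a b; rewrite addr_ge0//= lerD.
Qed.

Lemma bounded_kernel_cst (c : R) : 0 <= c -> bounded_kernel (fun _ _ => c).
Proof.
move=> c0; split; first exact: measurable_cst.
by exists c => a b; rewrite c0 lexx.
Qed.

Lemma bounded_kernelT f : bounded_kernel f -> bounded_kernel (fun x y => f y x).
Proof.
move=> [mf [C fC]]; split; last by exists C.
apply: (measurableT_comp mf (measurable_fun_pair _ _)).
  exact: measurable_snd.
exact: measurable_fst.
Qed.

Lemma int2E f : bounded_kernel f ->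
  int2 f = itg [:: 0%N; 1%N] (fun x => f (x 0%N) (x 1%N)) (fun=> 0).
Proof. by move=> kf; rewrite (itg_kernel (i := 0%N) (j := 1%N)). Qed.

Lemma int2_le f g : bounded_kernel f -> bounded_kernel g ->
  (forall x y, f x y <= g x y) -> int2 f <= int2 g.
Proof.
move=> kf kg fg; rewrite !int2E//.
exact: (itg_le _ _ (good_kernel 0%N 1%N kf) (good_kernel 0%N 1%N kg) (fun x => fg _ _)).
Qed.

Lemma int2D f g : bounded_kernel f -> bounded_kernel g ->
  int2 (fun x y => f x y + g x y) = int2 f + int2 g.
Proof.
move=> kf kg; rewrite !int2E//; last exact: bounded_kernelD.
by rewrite (itgD _ _ (good_kernel 0%N 1%N kf) (good_kernel 0%N 1%N kg)).
Qed.

Lemma int2Z c f : 0 <= c -> bounded_kernel f ->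
  int2 (fun x y => c * f x y) = c * int2 f.
Proof.
move=> c0 kf; rewrite !int2E//.
  by rewrite (itgZ _ c _ (good_kernel 0%N 1%N kf)).
by apply: bounded_kernelM => //; exact: bounded_kernel_cst.
Qed.

Lemma int2_ge0 f : bounded_kernel f -> 0 <= int2 f.
Proof.
move=> [_ [C fC]]; apply: int01_ge0 => a; apply: int01_ge0 => b.
by case/andP: (fC a b).
Qed.

Lemma int2_swap f : bounded_kernel f -> int2 (fun x y => f y x) = int2 f.
Proof. by move=> kf; rewrite /int2 -int01_swap. Qed.

Lemma bounded_measurable_row f x : bounded_kernel f -> bounded_measurable (f x).
Proof. by move=> kf; exact: (good_upd (fun=> x) 1%N (good_kernel 0%N 1%N kf)). Qed.

Lemma bounded_measurable_int f : bounded_kernel f ->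
  bounded_measurable (fun x => int01 (f x)).
Proof.
move=> kf; exact: (good_upd (fun=> 0) 0%N (good_intv 1%N (good_kernel 0%N 1%N kf))).
Qed.

Lemma EIpE p (W : R -> R -> R) : 0 < p < 1 -> graphon W ->
  bounded_kernel (fun x y => Ip p (W x y)) /\
  EIp p W = (int2 (fun x y => Ip p (W x y)))%:E.
Proof.
move=> hp [mW W01].
have kI : bounded_kernel (fun x y => Ip p (W x y)).
  split; first exact: (measurableT_comp (measurable_Ip p) mW).
  by exists (p^-1 + (1 - p)^-1) => a b; rewrite Ip_ge0//= Ip_le.
split => //; rewrite /EIp -int01E; last exact: (bounded_measurable_int kI).
by apply: eq_integral => x _; rewrite -int01E//; exact: (bounded_measurable_row x kI).
Qed.

End Int2.

(** * Hubs, low vertices and the remainder of a graphon *)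

Section Split.
Variables (R : realType) (W : R -> R -> R) (kap p bh bl : R).
Hypotheses (gW : graphon W) (hp : 0 < p < 1) (kap0 : 0 < kap).
Hypotheses (bl0 : 0 < bl) (blh : bl <= bh).

Definition heavy (x y : R) : R := if kap <= W x y then W x y else 0.
Definition heavy_deg (x : R) : R := int01 (heavy x) + int01 (fun y => heavy y x).
Definition hub (x : R) : R := if bh <= heavy_deg x then 1 else 0.
Definition low (x : R) : R := if bl <= heavy_deg x then 0 else 1.
Definition mid (x : R) : R := 1 - (hub x + low x).
(** What [p] and the four class pieces leave uncovered: heavy values with an end that is neither hub
    nor low, where the product of the two sums is 0, and the excess over [p] of small values. *)
Definition rest (x y : R) : R :=
  if kap <= W x y then W x y * (1 - (hub x + low x) * (hub y + low y))
  else Num.max (W x y - p) 0.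

Let W01 x y : 0 <= W x y <= 1. Proof. by case: gW. Qed.
Let bh0 : 0 < bh. Proof. exact: lt_le_trans blh. Qed.

Lemma kernelW : bounded_kernel W.
Proof. by case: gW => mW _; split => //; exists 1. Qed.

Lemma heavy01 x y : 0 <= heavy x y <= 1.
Proof. by rewrite /heavy; case: ifP => _ //; rewrite lexx ler01. Qed.

Let mW : measurable_fun [set: R * R] (fun z : R * R => W z.1 z.2).
Proof. by case: gW. Qed.

Let mheavy_test : measurable_fun [set: R * R] (fun z : R * R => kap <= W z.1 z.2).
Proof. by apply: measurable_fun_ler => //; exact: measurable_cst. Qed.

Lemma kernel_heavy : bounded_kernel heavy.
Proof.
split; last by exists 1 => x y; exact: heavy01.
by apply: measurable_fun_ifT => //; exact: measurable_cst.
Qed.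

Lemma measurable_heavy_deg : bounded_measurable heavy_deg.
Proof.
have [m1 [C h1]] := bounded_measurable_int kernel_heavy.
have [m2 [C' h2]] := bounded_measurable_int (bounded_kernelT kernel_heavy).
split; first exact: measurable_funD.
exists (C + C') => u; rewrite /heavy_deg.
have /andP[a0 a1] := h1 u; have /andP[b0 b1] := h2 u.
by rewrite addr_ge0//= lerD.
Qed.

Let mtest (b c c' : R) : 0 <= c -> 0 <= c' ->
  bounded_measurable (fun x => if b <= heavy_deg x then c else c').
Proof.
move=> c0 c'0; split; last first.
  exists (c + c') => u; case: ifP => _; first by rewrite c0 lerDl.
  by rewrite c'0 lerDr.
apply: measurable_fun_ifT; [|exact: measurable_cst..].
apply: measurable_fun_ler; first exact: measurable_cst.
by case: measurable_heavy_deg.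
Qed.

Lemma measurable_hub : bounded_measurable hub. Proof. exact: mtest. Qed.
Lemma measurable_low : bounded_measurable low. Proof. exact: mtest. Qed.

Lemma hub01 x : hub x = 0 \/ hub x = 1.
Proof. by rewrite /hub; case: ifP; [right|left]. Qed.

Lemma low01 x : low x = 0 \/ low x = 1.
Proof. by rewrite /low; case: ifP; [left|right]. Qed.

Lemma hub_low x : hub x * low x = 0.
Proof.
rewrite /hub /low; case: ifP => [h|_]; last by rewrite mul0r.
by rewrite (le_trans blh h) mulr0.
Qed.

Lemma hub_low01 x : hub x + low x = 0 \/ hub x + low x = 1.
Proof.
have := hub_low x; case: (hub01 x) => ->; case: (low01 x) => ->;
  rewrite ?mul1r ?addr0 ?add0r; try by [left|right].
by move=> h; right; rewrite h addr0.
Qed.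

Lemma mid_bound x : 0 <= mid x <= 1.
Proof.
by rewrite /mid; case: (hub_low01 x) => ->; rewrite ?subr0 ?subrr lexx ler01.
Qed.

Lemma measurable_mid : bounded_measurable mid.
Proof.
split; last by exists 1 => x; exact: mid_bound.
apply: measurable_funB; first exact: measurable_cst.
by apply: measurable_funD; [case: measurable_hub | case: measurable_low].
Qed.

Let hl_prod01 x y : 0 <= 1 - (hub x + low x) * (hub y + low y) <= 1.
Proof.
by case: (hub_low01 x) => ->; case: (hub_low01 y) => ->;
  rewrite ?mulr1 ?mulr0 ?subr0 ?subrr lexx ler01.
Qed.

Lemma rest01 x y : 0 <= rest x y <= 1.
Proof.
have /andP[w0 w1] := W01 x y; have /andP[h0 h1] := hl_prod01 x y.
have /andP[p0 _] := hp.
rewrite /rest; case: ifP => _; first by rewrite mulr_ge0//= mulr_ile1.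
rewrite le_max lexx orbT /= ge_max ler01 andbT lerBlDr.
by rewrite (le_trans w1)// lerDl ltW.
Qed.

Lemma kernel_rest : bounded_kernel rest.
Proof.
split; last by exists 1 => x y; exact: rest01.
have m1 := measurable_hub.1; have m2 := measurable_low.1.
have mc (f : R -> R) : measurable_fun setT f ->
    measurable_fun [set: R * R] (fun z : R * R => f z.1).
  by move=> mf; apply: measurableT_comp mf _; exact: measurable_fst.
have mc' (f : R -> R) : measurable_fun setT f ->
    measurable_fun [set: R * R] (fun z : R * R => f z.2).
  by move=> mf; apply: measurableT_comp mf _; exact: measurable_snd.
apply: measurable_fun_ifT => //.
  apply: measurable_funM => //; apply: measurable_funB; first exact: measurable_cst.
  by apply: measurable_funM; apply: measurable_funD; auto.
apply: measurable_maxr; last exact: measurable_cst.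
by apply: measurable_funB => //; exact: measurable_cst.
Qed.

Lemma split_le x y : W x y <= \sum_l piece p heavy rest hub low l x y.
Proof.
rewrite (big_option _ (fun l => piece p heavy rest hub low l x y)) /=.
rewrite (big_option _ (fun l => piece p heavy rest hub low (Some l) x y)) /=.
rewrite [X in _ + (_ + X)](eq_bigr (fun st : bool * bool =>
  heavy x y * cls hub low st.1 x * cls hub low st.2 y)); last by case.
rewrite -(pair_bigA _ (fun s t => heavy x y * cls hub low s x * cls hub low t y)) /=.
rewrite !big_bool /= /heavy /rest.
have /andP[p0 _] := hp; case: ifP => _; last first.
  by rewrite !mul0r !addr0 -lerBlDl le_max lexx.
by apply: (@le_trans _ _ (p + W x y)); [rewrite lerDr ltW | lra].
Qed.

(** As [rest <= 1] and [D >= 2], the square suffices: small values fall under [Ip_ge_sqr] with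
    [W x y <= kap], heavy ones under the mass of the middle range. *)
Lemma rest_pow (D : nat) x y : (2 <= D)%N ->
  rest x y ^+ D <= 4 * kap * Ip p (W x y) + (heavy x y * mid x + heavy x y * mid y).
Proof.
move=> D2; have /andP[r0 r1] := rest01 x y; have /andP[w0 w1] := W01 x y.
have I0 := Ip_ge0 hp (W01 x y); have /andP[a0 a1] := heavy01 x y.
have /andP[m0 m1] := mid_bound x; have /andP[m0' m1'] := mid_bound y.
have kI : 0 <= 4 * kap * Ip p (W x y) by rewrite !mulr_ge0// ltW.
have hm : 0 <= heavy x y * mid x + heavy x y * mid y by rewrite addr_ge0 ?mulr_ge0.
have r2 : rest x y ^+ D <= rest x y ^+ 2 by rewrite ler_wiXn2l.
apply: le_trans r2 _; case: (leP kap (W x y)) => kW.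
  apply: ler_wpDl => //; apply: (@le_trans _ _ (rest x y)).
    by rewrite expr2 ler_piMl.
  rewrite /rest /heavy kW -mulrDr ler_wpM2l// /mid.
  by case: (hub_low01 x) => ->; case: (hub_low01 y) => ->; lra.
apply: ler_wpDr => //; rewrite /rest [kap <= _]leNgt kW /=.
case: (leP p (W x y)) => pW; last first.
  rewrite max_r ?expr0n//=; by rewrite subr_le0 ltW.
rewrite max_l ?subr_ge0//; apply: le_trans (Ip_ge_sqr hp _) _; first by rewrite pW.
by rewrite ler_wpM2r// ler_wpM2l// ltW.
Qed.

Let theta := int2 heavy.

Lemma int_heavy_deg : int01 heavy_deg = 2 * theta.
Proof.
rewrite /heavy_deg int01D; first by rewrite [X in _ + X](int2_swap kernel_heavy) mulr_natl mulr2n.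
  exact: bounded_measurable_int kernel_heavy.
exact: bounded_measurable_int (bounded_kernelT kernel_heavy).
Qed.

(** Markov's inequality for [heavy_deg], whose integral is [2 theta]. *)
Lemma hub_mass : int01 hub <= 2 * theta / bh.
Proof.
rewrite -int_heavy_deg mulrC -int01Zl; last exact: measurable_heavy_deg.
have [m1 [C h1]] := measurable_heavy_deg.
apply: int01_le; first exact: measurable_hub.
  split; first by apply: measurable_funM => //; exact: measurable_cst.
  exists (bh^-1 * C) => u; have /andP[a0 aC] := h1 u.
  by rewrite mulr_ge0 ?invr_ge0 ?(ltW bh0)//= ler_wpM2l// invr_ge0 ltW.
move=> u; rewrite /hub; case: ifPn => [h|_].
  by rewrite ler_pdivlMl// mulr1.
by rewrite mulr_ge0 ?invr_ge0 ?(ltW bh0)//; case/andP: (h1 u).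
Qed.

Let kx (f : R -> R) : bounded_measurable f -> bounded_kernel (fun x y => heavy x y * f x).
Proof.
by move=> mf; apply: bounded_kernelM; [exact: kernel_heavy|exact: bounded_kernel_fst].
Qed.

Let ky (f : R -> R) : bounded_measurable f -> bounded_kernel (fun x y => heavy x y * f y).
Proof.
by move=> mf; apply: bounded_kernelM; [exact: kernel_heavy|exact: bounded_kernel_snd].
Qed.

Let kxy (f g : R -> R) : bounded_measurable f -> bounded_measurable g ->
  bounded_kernel (fun x y => heavy x y * f x * g y).
Proof.
by move=> mf mg; apply: bounded_kernelM; [exact: kx|exact: bounded_kernel_snd].
Qed.

(** [heavy_deg] adds both directions, so a low vertex has small rows and small columns at once. *)
Lemma low_row y : int01 (fun v => heavy v y * low v * low y) <= bl.
Proof.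
have k1 := kxy measurable_low measurable_low.
have b1 := bounded_measurable_row y (bounded_kernelT k1).
have b2 := bounded_measurable_row y (bounded_kernelT kernel_heavy).
have h0 : 0 <= int01 (heavy y) by apply: int01_ge0 => u; case/andP: (heavy01 y u).
rewrite /= in b1 b2; case: (leP bl (heavy_deg y)) => h.
  rewrite (_ : (fun v => _) = fun=> 0) ?int01_cst ?ltW//.
  by apply/funext => v; rewrite /low h mulr0.
apply: le_trans (ltW h); rewrite /heavy_deg; apply: ler_wpDl => //.
apply: int01_le => // v; have /andP[a0 _] := heavy01 v y.
by case: (low01 v) => ->; case: (low01 y) => ->; rewrite ?mulr1 ?mulr0.
Qed.

Lemma low_col y : int01 (fun v => heavy y v * low y * low v) <= bl.
Proof.
have k1 := kxy measurable_low measurable_low.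
have b1 := bounded_measurable_row y k1.
have b2 := bounded_measurable_row y kernel_heavy.
have h0 : 0 <= int01 (heavy^~ y) by apply: int01_ge0 => u; case/andP: (heavy01 u y).
case: (leP bl (heavy_deg y)) => h.
  rewrite (_ : (fun v => _) = fun=> 0) ?int01_cst ?ltW//.
  by apply/funext => v; rewrite /low h mulr0 mul0r.
apply: le_trans (ltW h); rewrite /heavy_deg; apply: ler_wpDr => //.
apply: int01_le => // v; have /andP[a0 _] := heavy01 y v.
by case: (low01 v) => ->; case: (low01 y) => ->; rewrite ?mulr1 ?mulr0 ?mul0r.
Qed.

(** Since [heavy <= 1], this mass is quadratic in the hub measure, hence of order [q ^ 2]. *)
Lemma hub_hub_mass : int2 (fun x y => heavy x y * hub x * hub y) <= int01 hub ^+ 2.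
Proof.
have kh := bounded_kernel_fst measurable_hub; have kh' := bounded_kernel_snd measurable_hub.
apply: (@le_trans _ _ (int2 (fun x y => hub x * hub y))).
  apply: int2_le; first by apply: kxy; exact: measurable_hub.
    exact: bounded_kernelM.
  move=> x y; have /andP[a0 a1] := heavy01 x y.
  by case: (hub01 x) => ->; case: (hub01 y) => ->; rewrite ?mulr1 ?mulr0 ?mul0r.
rewrite /int2 (_ : (fun a => _) = fun a => int01 hub * hub a); last first.
  by apply/funext => a; rewrite (int01Zl _ measurable_hub) mulrC.
by rewrite (int01Zl _ measurable_hub) expr2 lexx.
Qed.

Lemma class_mass s t : int2 (fun x y => heavy x y * cls hub low s x * cls hub low t y) <= theta.
Proof.
have c01 (b : bool) x : cls hub low b x = 0 \/ cls hub low b x = 1.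
  by case: b; [exact: hub01|exact: low01].
have mc b : bounded_measurable (cls hub low b).
  by case: b; [exact: measurable_hub|exact: measurable_low].
apply: int2_le; [exact: kxy|exact: kernel_heavy|] => x y.
have /andP[a0 a1] := heavy01 x y.
by case: (c01 s x) => ->; case: (c01 t y) => ->; rewrite ?mulr1 ?mulr0 ?mul0r.
Qed.

(** The three class pairs are disjoint. Their masses, normalized, become [th1], [th2] and [eta], so
    the entropy pays for the sum of all three. *)
Lemma class_mass_sum :
  int2 (fun x y => heavy x y * hub x * low y) +
  int2 (fun x y => heavy x y * low x * hub y) +
  int2 (fun x y => heavy x y * low x * low y) <= theta.
Proof.
have mh := measurable_hub; have ml := measurable_low.
have k1 := kxy mh ml; have k2 := kxy ml mh; have k3 := kxy ml ml.
have k12 := bounded_kernelD k1 k2.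
rewrite -(int2D k1 k2) -(int2D k12 k3); apply: int2_le.
- exact: bounded_kernelD.
- exact: kernel_heavy.
move=> x y; have /andP[a0 a1] := heavy01 x y; have := hub_low x; have := hub_low y.
case: (hub01 x) => ->; case: (hub01 y) => ->; case: (low01 x) => ->;
  case: (low01 y) => ->; lra.
Qed.

Lemma rest_mass (D : nat) : (2 <= D)%N -> int2 (fun x y => rest x y ^+ D) <=
  4 * kap * int2 (fun x y => Ip p (W x y)) +
  (int2 (fun x y => heavy x y * mid x) + int2 (fun x y => heavy x y * mid y)).
Proof.
move=> D2; have [kI _] := EIpE hp gW.
have k1 := kx measurable_mid; have k2 := ky measurable_mid.
have c0 : 0 <= 4 * kap by rewrite mulr_ge0// ltW.
have kcI : bounded_kernel (fun x y => 4 * kap * Ip p (W x y)).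
  by apply: bounded_kernelM => //; exact: bounded_kernel_cst.
rewrite -int2Z// -(int2D k1 k2) -(int2D kcI (bounded_kernelD k1 k2)).
apply: int2_le.
- have [mr _] := kernel_rest; split; first exact: measurable_funX.
  exists 1 => x y; have /andP[r0 r1] := rest01 x y.
  by rewrite exprn_ge0//= exprn_ile1.
- by apply: bounded_kernelD => //; exact: bounded_kernelD.
- by move=> x y; exact: rest_pow.
Qed.

Lemma heavy_entropy e : kap = (ln p^-1) ^- 2 -> 1 <= ln p^-1 -> e <= 1 ->
  2 * ln (ln p^-1) + 1 <= e * ln p^-1 ->
  (1 - e) * ln p^-1 * theta <= int2 (fun x y => Ip p (W x y)).
Proof.
move=> kapE L1 e1 eL; have [kI _] := EIpE hp gW.
have c0 : 0 <= (1 - e) * ln p^-1.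
  by rewrite mulr_ge0 ?subr_ge0// (le_trans ler01).
rewrite -int2Z//; last exact: kernel_heavy.
apply: int2_le => //.
  by apply: bounded_kernelM; [exact: bounded_kernel_cst|exact: kernel_heavy].
move=> x y; rewrite /heavy; case: ifP => h; last by rewrite mulr0 Ip_ge0.
rewrite mulrC; apply: Ip_ge_lin => //; rewrite -kapE h /=.
by case/andP: (W01 x y).
Qed.

End Split.

(** * Exponents of the hub terms *)

Section Exponents.
Variables (R : realType) (n : nat) (E : rel 'I_n).
Hypotheses (Hloop : irreflexive E) (D2 : (2 <= maxdeg E)%N).

(** Solved for the exponent, the bound reads [b <= ln T / ln r], which passes to the supremum
    whether or not it is attained. *)
Lemma le_powR_sup (r T : R) (B : set R) : 0 < r <= 1 -> B !=set0 ->
  (forall b, B b -> T <= r `^ b) -> T <= r `^ (sup B).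
Proof.
move=> /andP[r0 r1] B0 TB; have [T0|T0] := leP T 0.
  by apply: le_trans T0 (powR_ge0 _ _).
have [r_eq1|rN1] := eqVneq r 1.
  have [b Bb] := B0; have := TB b Bb; by rewrite r_eq1 !powR1.
have lr : ln r < 0 by rewrite ln_lt0// r0 lt_neqAle rN1.
have TE b : (T <= r `^ b) = (b <= ln T / ln r).
  rewrite -ler_ln ?posrE ?powR_gt0// ln_powR.
  by rewrite ler_ndivlMr.
rewrite TE; apply: ge_sup => // b /TB.
by rewrite TE.
Qed.

(** A vertex of [S] has positive degree, hence an in- or an out-neighbour, and belongs to exactly
    one of the three classes. *)
Lemma vertex_sign_count (S : {set 'I_n}) : indepHstar E S ->
  (vplus E S + vminus E S + vpm E S)%N = #|S|.
Proof.
move=> indS; have cE (P : pred 'I_n) :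
    #|finset (fun v => (v \in S) && P v)| = (\sum_(v in S) P v)%N.
  rewrite cardsE -sum1_card (eq_bigl (fun v => (v \in S) && P v))//.
  by rewrite big_mkcondr; apply: eq_bigr => v _; case: (P v).
rewrite /vplus /vminus /vpm !cE -!big_split /= -sum1_card.
apply: eq_bigr => v vS; have := indep_deg indS vS; rewrite /deg.
case: (indeg E v) => [|i]; case: (outdeg E v) => [|o] //= D0.
by move: D2; rewrite -D0.
Qed.

Section OneSet.
Variable S : {set 'I_n}.
Hypothesis indS : indepHstar E S.

Lemma matching_sums_ge0 (w : 'I_n -> 'I_n -> R) : max_frac_matching E S w ->
  0 <= \sum_u \sum_(v | edgeST E S u v) w u v /\
  0 <= \sum_u \sum_(v | edgeTS E S u v) w u v.
Proof.
move=> [w01 _ _]; split; apply: sumr_ge0 => u _; apply: sumr_ge0 => v h.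
  by have /andP[] := w01 u v (introT orP (or_introl h)).
by have /andP[] := w01 u v (introT orP (or_intror h)).
Qed.

Let A : set R := [set s | exists w : 'I_n -> 'I_n -> R,
  max_frac_matching E S w /\ s = \sum_u \sum_(v | edgeST E S u v) w u v].
Let B : set R := [set s | exists w : 'I_n -> 'I_n -> R,
  max_frac_matching E S w /\ s = \sum_u \sum_(v | edgeTS E S u v) w u v].

(** The uniform matching and the total weight [#|S|] show that both suprema range over nonempty
    bounded sets; the last inequality tests both with the same matching. *)
Lemma aS_bS_ge : [/\ 0 <= aS E S :> R, 0 <= bS E S :> R & #|S|%:R <= aS E S + bS E S :> R].
Proof.
have uw : max_frac_matching E S (fun _ _ => (maxdeg E)%:R^-1 : R).
  exact: uniform_matching.
have [a0 b0] := matching_sums_ge0 uw.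
have sz := matching_size Hloop indS uw.
have supA : has_sup A.
  split; first by eexists; exists (fun _ _ => (maxdeg E)%:R^-1).
  exists #|S|%:R => _ [w [mw ->]]; have [_ h] := matching_sums_ge0 mw.
  by rewrite -(matching_size Hloop indS mw) lerDl.
have supB : has_sup B.
  split; first by eexists; exists (fun _ _ => (maxdeg E)%:R^-1).
  exists #|S|%:R => _ [w [mw ->]]; have [h _] := matching_sums_ge0 mw.
  by rewrite -(matching_size Hloop indS mw) lerDr.
have lA : \sum_u \sum_(v | edgeST E S u v) (maxdeg E)%:R^-1 <= aS E S :> R.
  by apply: sup_ubound; [case: supA | exists (fun _ _ => (maxdeg E)%:R^-1)].
have lB : \sum_u \sum_(v | edgeTS E S u v) (maxdeg E)%:R^-1 <= bS E S :> R.
  by apply: sup_ubound; [case: supB | exists (fun _ _ => (maxdeg E)%:R^-1)].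
by split; [exact: le_trans lA | exact: le_trans lB | rewrite -sz lerD].
Qed.

(** [a_S] and [b_S] may belong to different matchings, but only one exponent matters at a time: once
    [x ^ #|S|] is taken out, one of [th1 / x], [th2 / x] equals 1, and the exponent of the other is
    maximized alone. *)
Lemma hub_coefficient_le (t th1 th2 x : R) : 0 < th1 -> 0 < th2 ->
  x = Num.max th1 th2 ->
  (forall w, max_frac_matching E S w ->
     t <= th1 `^ (\sum_u \sum_(v | edgeST E S u v) w u v) *
          th2 `^ (\sum_u \sum_(v | edgeTS E S u v) w u v)) ->
  t <= x ^+ vplus E S * x ^+ vminus E S * (Num.min x x) ^+ vpm E S *
       (th1 / x) `^ aS E S * (th2 / x) `^ bS E S.
Proof.
move=> th10 th20 xdef H.
have uw : max_frac_matching E S (fun _ _ => (maxdeg E)%:R^-1 : R).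
  exact: uniform_matching.
rewrite minxx -!exprD vertex_sign_count//.
have x0 : 0 < x by rewrite xdef lt_max th10.
have split_pow (a b : R) : a + b = #|S|%:R -> th1 `^ a * th2 `^ b =
    x ^+ #|S| * ((th1 / x) `^ a * (th2 / x) `^ b).
  have pw (y c : R) : 0 < y -> y `^ c = x `^ c * (y / x) `^ c.
    move=> y0; rewrite -powRM ?divr_ge0 ?(ltW y0) ?(ltW x0)//.
    by rewrite mulrCA divff ?mulr1// gt_eqF.
  move=> ab; rewrite (pw th1)// (pw th2)// mulrACA.
  rewrite -powRD; last by apply/implyP => _; rewrite gt_eqF.
  by rewrite ab powR_mulrn// ltW.
have xS : 0 < x ^+ #|S| by exact: exprn_gt0.
rewrite -mulrA -ler_pdivrMl//.
have H' w : max_frac_matching E S w -> (x ^+ #|S|)^-1 * t <=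
    (th1 / x) `^ (\sum_u \sum_(v | edgeST E S u v) w u v) *
    (th2 / x) `^ (\sum_u \sum_(v | edgeTS E S u v) w u v).
  move=> mw; rewrite ler_pdivrMl// -split_pow; first exact: H.
  exact: matching_size.
have nA : A !=set0 by eexists; exists (fun _ _ => (maxdeg E)%:R^-1).
have nB : B !=set0 by eexists; exists (fun _ _ => (maxdeg E)%:R^-1).
have [h|h] := leP th2 th1.
  have xE : x = th1 by rewrite xdef max_l.
  rewrite {2}xE divff ?gt_eqF// powR1 mul1r.
  apply: (@le_powR_sup _ _ B) => //.
    by rewrite divr_gt0//= ler_pdivrMr// mul1r xE.
  move=> _ [w [mw ->]]; apply: le_trans (H' w mw) _.
  by rewrite {1}xE divff ?gt_eqF// powR1 mul1r lexx.
have xE : x = th2 by rewrite xdef max_r// ltW.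
rewrite {3}xE divff ?gt_eqF// powR1 mulr1.
apply: (@le_powR_sup _ _ A) => //.
  by rewrite divr_gt0//= ler_pdivrMr// mul1r xE ltW.
move=> _ [w [mw ->]]; apply: le_trans (H' w mw) _.
by rewrite {2}xE divff ?gt_eqF// powR1 mulr1 lexx.
Qed.

End OneSet.
End Exponents.

(** * The asymptotic estimate *)

Section Numeric.
Variable R : realFieldType.
Implicit Types K q L e theta EI zeta r h eps : R.

(** As [1 - e >= 1 / 2], the entropy is at least [L theta / 2]; this is the reason for [K / 4]. *)
Lemma mass_le_of_entropy K q L e theta EI : 0 < L -> e <= 2^-1 -> 0 <= theta ->
  (1 - e) * L * theta <= EI -> EI <= K / 4 * (q * L) -> 2 * theta <= K * q.
Proof.
move=> L0 e2 th0 h1 h2.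
have h3 : 2^-1 * L * theta <= (1 - e) * L * theta.
  by rewrite ler_wpM2r// ler_wpM2r ?(ltW L0)//; lra.
by rewrite -(ler_pM2l L0); lra.
Qed.

Lemma mass_add_small K q theta e3 : 1 <= K -> 0 <= q -> e3 <= 4^-1 ->
  2 * theta <= K * q -> theta + q * e3 <= K * q.
Proof.
move=> K1 q0 e34 thK.
have h1 : q * e3 <= q * 4^-1 by rewrite ler_wpM2l.
by have := ler_wpM2r q0 K1; rewrite mul1r; lra.
Qed.

Lemma cost_le q L e theta EI e3 (a b c : R) : 0 < q -> 0 < L -> 0 < e -> e <= 2^-1 ->
  0 < e3 -> 3 * e3 <= e -> (1 - e) * L * theta <= EI -> a + b + c <= theta ->
  (1 - e) * ((a / q + e3) + (b / q + e3) + (c / q + e3)) * (q * L) <= EI + e * (q * L).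
Proof.
move=> q0 L0 e0 e2 e30 e3e EI_theta abc.
have qL : 0 < q * L by exact: mulr_gt0.
have -> : (1 - e) * ((a / q + e3) + (b / q + e3) + (c / q + e3)) * (q * L) =
    (1 - e) * L * (a + b + c) + (1 - e) * (3 * e3) * (q * L).
  by field; rewrite gt_eqF.
have e1 : 0 <= 1 - e by lra.
apply: lerD.
  by apply: le_trans EI_theta; rewrite ler_wpM2l// mulr_ge0// ltW.
rewrite ler_wpM2r ?(ltW qL)//; apply: le_trans e3e.
by rewrite ler_piMl ?mulr_ge0 ?(ltW e30)// gerBl ltW.
Qed.

(** Small values, middle range and shift contribute at most [zeta q / 4] each. *)
Lemma rest_mass_small K q L zeta theta EI e3 (N0 : R) : 0 < q -> 0 < L -> 0 < zeta ->
  0 < N0 -> 4 * K / zeta <= L -> 8 * K / zeta <= N0 -> e3 <= zeta / 4 ->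
  EI <= K / 4 * (q * L) -> 2 * theta <= K * q ->
  4 * L ^- 2 * EI + 2 * theta / N0 + q * e3 <= zeta * q.
Proof.
move=> q0 L0 z0 N00 LM NM e3z EIle thK.
have L20 : 0 < 4 * L ^- 2 by rewrite mulr_gt0// invr_gt0 exprn_gt0.
have g1 : 4 * L ^- 2 * EI <= zeta / 4 * q.
  apply: le_trans (ler_wpM2l (ltW L20) EIle) _.
  have -> : 4 * L ^- 2 * (K / 4 * (q * L)) = K / L * q by field; rewrite gt_eqF.
  rewrite ler_wpM2r ?(ltW q0)// ler_pdivrMr//.
  by move: LM; rewrite ler_pdivrMr//; lra.
have g2 : 2 * theta / N0 <= zeta / 4 * q.
  rewrite ler_pdivrMr//; move: NM; rewrite ler_pdivrMr// => NM.
  have := ler_wpM2r (ltW q0) NM; have := mulr_gt0 z0 (mulr_gt0 N00 q0).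
  by have := mulr_gt0 z0 q0; lra.
have g3 : q * e3 <= q * (zeta / 4) by rewrite ler_wpM2l ?(ltW q0).
apply: le_trans (lerD (lerD g1 g2) g3) _.
by have := mulr_gt0 z0 q0; lra.
Qed.

(** [b] and [b'] are the degree thresholds for hubs and low vertices, [bm] a lower bound for [b]
    over the scales in play, [bs] the smallness wanted from their ratio, [h] the hub measure, [r] a
    bound on [q]. *)
Section Scales.
Variables K q r h e3 zeta bm b b' bs : R.
Hypotheses (K1 : 1 <= K) (q0 : 0 < q) (qr : q <= r) (h0 : 0 <= h) (e30 : 0 < e3).
Hypotheses (zeta0 : 0 < zeta) (zeta1 : zeta <= 1) (e3z : e3 <= zeta / 4).
Hypotheses (bm0 : 0 < bm) (bm1 : bm <= 1) (bmb : bm <= b) (b1 : b <= 1).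
Hypotheses (bs0 : 0 < bs) (bs1 : bs <= 1) (e3b : e3 <= bs / 12).
Hypotheses (bE : b' = b * (bs / 6)) (rE : r = zeta * bm ^+ 2 / (4 * K ^+ 2)).
Hypothesis hq : h <= K * q / b.
Hypothesis q1 : q <= 1.

Let K0 : 0 < K. Proof. exact: lt_le_trans K1. Qed.
Let b0 : 0 < b. Proof. exact: lt_le_trans bmb. Qed.
Let r0 : 0 < r. Proof. exact: lt_le_trans qr. Qed.
Let epse3 : q * e3 <= e3. Proof. by rewrite ler_piMl// ltW. Qed.
Let rK : K ^+ 2 * r = zeta * bm ^+ 2 / 4.
Proof. by rewrite rE; field; rewrite gt_eqF. Qed.
Let hb : h * b <= K * q. Proof. by move: hq; rewrite ler_pdivlMr. Qed.
Let hbm : h * bm <= K * q.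
Proof. by apply: le_trans hb; rewrite ler_wpM2l. Qed.

(** [h <= K q / b] makes [h ^ 2] quadratic in [q]; bounding one factor [q] by [r] and [b] below by
    [bm] gives [zeta q / 4], which dictates the formula for [r]. *)
Lemma hub_hub_small : h ^+ 2 + q * e3 <= zeta * q.
Proof.
have g1 : (h * bm) ^+ 2 <= (K * q) ^+ 2.
  by rewrite lerXn2r ?nnegrE ?mulr_ge0// ltW.
have g2 : (K * q) ^+ 2 <= K ^+ 2 * r * q.
  by rewrite exprMn -mulrA ler_wpM2l ?sqr_ge0// expr2 ler_wpM2r// ltW.
have g3 : h ^+ 2 <= zeta / 4 * q.
  have bm2 : 0 < bm ^+ 2 by exact: exprn_gt0.
  rewrite -(ler_pM2r bm2) -exprMn; apply: le_trans g1 (le_trans g2 _).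
  by rewrite rK le_eqVlt; apply/orP; left; apply/eqP; field.
have : q * e3 <= q * (zeta / 4) by rewrite ler_wpM2l ?(ltW q0).
by have := mulr_gt0 zeta0 q0; lra.
Qed.

Let Kr : K * r <= zeta * bm / 4.
Proof.
have g1 : K * r <= K ^+ 2 * r by rewrite ler_wpM2r ?(ltW r0)// expr2 ler_peMl// ltW.
apply: le_trans g1 _; rewrite rK ler_wpM2r// ler_wpM2l ?(ltW zeta0)//.
by rewrite expr2 ler_piMl// ltW.
Qed.

Lemma hub_small : h + q * e3 <= zeta.
Proof.
have g1 : h <= zeta / 4.
  rewrite -(ler_pM2r bm0); apply: le_trans hbm _.
  have : K * q <= K * r by rewrite ler_wpM2l// ltW.
  by have := Kr; lra.
by have := epse3; have := zeta0; have := e3z; lra.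
Qed.

(** [(h + q e3) b <= 2 K q], while [b' + q e3 <= b (bs / 2)] thanks to the ratio [bs / 6]; in the
    product the threshold [b] cancels. *)
Lemma scales_small : (h + q * e3) * (b' + q * e3) / (K * q) <= bs.
Proof.
have Kq0 : 0 < K * q by exact: mulr_gt0.
have e0 : 0 <= q * e3 by rewrite mulr_ge0// ltW.
have rbm : r <= bm.
  apply: (@le_trans _ _ (K * r)); first by rewrite ler_peMl// ltW.
  apply: le_trans Kr _; have := ler_wpM2r (ltW bm0) zeta1; have := bm0; lra.
have g0 : q * e3 * b <= K * q.
  have g01 : q * e3 * b <= q * e3 by rewrite ler_piMr.
  apply: le_trans g01 _; rewrite mulrC ler_wpM2r ?(ltW q0)//.
  by have := zeta1; have := e3z; have := K1; lra.
have g1 : (h + q * e3) * b <= 2 * (K * q) by rewrite mulrDl; have := hb; lra.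
have g2 : b' + q * e3 <= b * (bs / 2).
  have g21 : q * e3 <= b * e3.
    rewrite ler_wpM2r ?(ltW e30)//; apply: le_trans qr _; exact: le_trans bmb.
  have g22 : b * e3 <= b * (bs / 12) by rewrite ler_wpM2l ?(ltW b0).
  by have := mulr_gt0 b0 bs0; rewrite bE; lra.
have g3 : (h + q * e3) * (b' + q * e3) <= (h + q * e3) * (b * (bs / 2)).
  by rewrite ler_wpM2l// addr_ge0.
have g4 := ler_wpM2r (ltW bs0) g1.
by rewrite ler_pdivrMr// mulrC; lra.
Qed.

End Scales.
End Numeric.

(** * Small [p] and the choice of a scale *)

Section Estimate.
Variable R : realType.

Lemma ln_inv_large (e M : R) : 0 < e -> exists2 p0 : R, 0 < p0 < 1 &
  forall p, 0 < p < p0 -> [/\ 1 <= ln p^-1, M <= ln p^-1 &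
    2 * ln (ln p^-1) + 1 <= e * ln p^-1].
Proof.
(* With [s = sqrt L >= 1] and [ln L <= 2 s], the last claim follows from [5 s <= e L], that is from
   [s >= 5 / e]. *)
move=> e0; pose L0 : R := Num.max 1 (Num.max M ((5 / e) ^+ 2)).
have L01 : 1 <= L0 by rewrite le_max lexx.
exists (expR (- L0)); first by rewrite expR_gt0 expR_lt1 oppr_lt0 (lt_le_trans ltr01).
move=> p /andP[p0 pL]; set L := ln p^-1.
have LL : L0 <= L.
  rewrite /L lnV ?posrE// lerNr -(expRK (- L0)).
  by rewrite ler_ln ?posrE ?expR_gt0// ltW.
have L1 : 1 <= L by exact: le_trans LL.
have L_gt0 : 0 < L by exact: lt_le_trans L1.
have ML : M <= L by apply: le_trans LL; rewrite !le_max lexx orbT.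
have eL : (5 / e) ^+ 2 <= L by apply: le_trans LL; rewrite !le_max lexx !orbT.
split => //; pose s := Num.sqrt L.
have s2 : s ^+ 2 = L by rewrite sqr_sqrtr// ltW.
have s0 : 0 < s by rewrite sqrtr_gt0.
have s1 : 1 <= s by rewrite -(@ler_pXn2r _ 2) ?nnegrE ?(ltW s0)// expr1n s2.
have s5 : 5 / e <= s.
  by rewrite -(@ler_pXn2r _ 2) ?nnegrE ?(ltW s0) ?divr_ge0 ?(ltW e0)// s2.
have lnL : ln L <= 2 * s.
  by rewrite -{1}s2 lnXn// -[leLHS]mulr_natl ler_wpM2l// ltW// ln_sublinear.
have h : 5 * s <= e * L.
  rewrite -s2 expr2 mulrA ler_wpM2r ?(ltW s0)//.
  by rewrite mulrC -ler_pdivrMr.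
by lra.
Qed.

Lemma telescoping_pigeonhole (f g : nat -> R) (t : R) (N : nat) :
  (forall j, 0 <= f j <= t) -> (forall j, 0 <= g j <= t) -> (0 < N)%N ->
  exists2 j, (j < N)%N & (f j.+1 - f j) + (g j.+1 - g j) <= 2 * t / N%:R.
Proof.
move=> ft gt N0; pose h j := (f j.+1 - f j) + (g j.+1 - g j).
have sumh : \sum_(0 <= j < N) h j <= 2 * t.
  have -> : \sum_(0 <= j < N) h j = (f N - f 0%N) + (g N - g 0%N).
    by rewrite -(telescope_sumr f (leq0n N)) -(telescope_sumr g (leq0n N)) -big_split.
  have /andP[x0 _] := ft 0%N; have /andP[_ x1] := ft N.
  have /andP[y0 _] := gt 0%N; have /andP[_ y1] := gt N.
  lra.
case: (pselect (exists2 j, (j < N)%N & h j <= 2 * t / N%:R)) => // H.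
have NR : 0 < N%:R :> R by rewrite ltr0n.
have gt_all j : (j < N)%N -> 2 * t / N%:R < h j.
  by move=> jN; rewrite ltNge; apply/negP => hj; apply: H; exists j.
exfalso; suff : 2 * t < \sum_(0 <= j < N) h j by rewrite ltNge sumh.
have -> : 2 * t = \sum_(0 <= j < N) (2 * t / N%:R).
  by rewrite sumr_const_nat subn0 -[RHS]mulr_natr divfK// gt_eqF.
rewrite !big_mkord; apply: ltr_sum => [|i _]; last exact: gt_all.
by apply/hasP; exists (Ordinal N0); rewrite ?mem_index_enum.
Qed.

(** Points between the thresholds are those that become hubs when the threshold drops from [b j] to
    [b j.+1]. Their masses therefore telescope in each of the two coordinates, with total at most
    [2 theta]. *)
Lemma scale_pigeonhole (W : R -> R -> R) (kap : R) (b : nat -> R) (N : nat) :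
  graphon W -> (forall j, 0 < b j.+1 <= b j) -> (0 < N)%N ->
  exists2 j, (j < N)%N &
    int2 (fun x y => heavy W kap x y * mid W kap (b j) (b j.+1) x) +
    int2 (fun x y => heavy W kap x y * mid W kap (b j) (b j.+1) y) <=
    2 * int2 (heavy W kap) / N%:R.
Proof.
move=> gW bb N0; set A := heavy W kap; set theta := int2 A.
have kA : bounded_kernel A by exact: kernel_heavy.
pose hx j := int2 (fun x y => A x y * hub W kap (b j) x).
pose hy j := int2 (fun x y => A x y * hub W kap (b j) y).
have mhub j : bounded_measurable (hub W kap (b j)) by exact: measurable_hub.
have mmid j : bounded_measurable (mid W kap (b j) (b j.+1)).
  by have /andP[b0 bj] := bb j; exact: measurable_mid.
have kx (f : R -> R) : bounded_measurable f -> bounded_kernel (fun x y => A x y * f x).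
  by move=> mf; apply: bounded_kernelM => //; exact: bounded_kernel_fst.
have ky (f : R -> R) : bounded_measurable f -> bounded_kernel (fun x y => A x y * f y).
  by move=> mf; apply: bounded_kernelM => //; exact: bounded_kernel_snd.
have hubS j u : hub W kap (b j.+1) u = mid W kap (b j) (b j.+1) u + hub W kap (b j) u.
  rewrite /mid opprD addrA addrAC subrK /hub /low.
  by case: ifP; rewrite ?subr0 ?subrr.
have dx j : int2 (fun x y => A x y * mid W kap (b j) (b j.+1) x) = hx j.+1 - hx j.
  rewrite /hx (_ : (fun x y => A x y * hub W kap (b j.+1) x) = (fun x y =>
     A x y * mid W kap (b j) (b j.+1) x + A x y * hub W kap (b j) x)).
    by rewrite int2D ?addrK//; exact: kx.
  by apply/funext => x; apply/funext => y; rewrite hubS mulrDr.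
have dy j : int2 (fun x y => A x y * mid W kap (b j) (b j.+1) y) = hy j.+1 - hy j.
  rewrite /hy (_ : (fun x y => A x y * hub W kap (b j.+1) y) = (fun x y =>
     A x y * mid W kap (b j) (b j.+1) y + A x y * hub W kap (b j) y)).
    by rewrite int2D ?addrK//; exact: ky.
  by apply/funext => x; apply/funext => y; rewrite hubS mulrDr.
have A0 x y : 0 <= A x y by case/andP: (heavy01 kap gW x y).
have hx_le j : 0 <= hx j <= theta.
  apply/andP; split; first exact/int2_ge0/kx.
  apply: (int2_le (kx _ (mhub j)) kA) => x y.
  by rewrite ler_piMr//; case: (hub01 W kap (b j) x) => ->; rewrite ?ler01.
have hy_le j : 0 <= hy j <= theta.
  apply/andP; split; first exact/int2_ge0/ky.
  apply: (int2_le (ky _ (mhub j)) kA) => x y.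
  by rewrite ler_piMr//; case: (hub01 W kap (b j) y) => ->; rewrite ?ler01.
have [j jN fj] := telescoping_pigeonhole hx_le hy_le N0.
by exists j => //; rewrite dx dy.
Qed.

End Estimate.

(** * From the entropy of a graphon to its normalized masses *)

Section Key.
Variables (R : realType) (n : nat) (E : rel 'I_n).
Hypotheses (Hloop : irreflexive E) (Hconn : connected_digraph E).
Hypothesis D2 : (2 <= maxdeg E)%N.
Local Notation D := (maxdeg E).
Local Notation N := (nedges E).

(* [gH] is evaluated at [x1 = x2], the larger of the normalized masses [th1] and
   [th2] of the edges leaving and entering the hubs, so that [x y1 = th1] and
   [x y2 = th2]; [eta] is the normalized mass between low vertices. *)
Lemma entropy_key (delta K e : R) : 1 <= K -> 0 < e <= 2^-1 ->
  exists2 p0 : R, 0 < p0 < 1 & forall p, 0 < p < p0 -> forall W, graphon W ->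
  int2 (fun x y => Ip p (W x y)) <= K / 4 * (p ^+ D * ln p^-1) ->
  (((1 + delta) * p ^+ N)%:E <= tHW E W)%E ->
  exists th1 th2 eta, [/\ 0 < th1, 0 < th2, 0 < eta,
    (1 - e) * (th1 + th2 + eta) * (p ^+ D * ln p^-1) <=
      int2 (fun x y => Ip p (W x y)) + e * (p ^+ D * ln p^-1) &
    1 + delta - e <=
      gH E (Num.max th1 th2) (Num.max th1 th2)
           (th1 / Num.max th1 th2) (th2 / Num.max th1 th2) +
      (if `[< regular E >] then eta `^ (n%:R / 2) else 0)].
Proof.
move=> K1 /andP[e0 e2].
have K0 : 0 < K by exact: lt_le_trans K1.
pose C : R := #|{ffun {e : 'I_n * 'I_n | E e.1 e.2} -> option (option (bool * bool))}|%:R *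
  K ^+ N.
have C0 : 0 <= C by rewrite mulr_ge0// exprn_ge0// ltW.
(* Each bad labelling gains a factor [k]; relative to [p ^ N], all together contribute at most
   [C k <= e]. *)
pose k := e / (C + 1).
have C10 : 0 < C + 1 by rewrite ltr_wpDl.
have k0 : 0 < k by exact: divr_gt0.
have k1 : k <= 1 by rewrite ler_pdivrMr// mul1r; lra.
have Ck : C * k <= e.
  by rewrite /k mulrCA ler_piMr ?(ltW e0)// ler_pdivrMr// mul1r lerDl.
have D0 : (0 < D)%N by exact: leq_trans D2.
(* The roots taken for bad labellings, of order [D] and [D (n + 1)], turn these powers back into
   [k]. *)
pose zeta := k ^+ D; pose bs := k ^+ (D * n.+1).
have zeta0 : 0 < zeta by exact: exprn_gt0.
have zeta1 : zeta <= 1 by rewrite exprn_ile1// ltW.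
have bs0 : 0 < bs by exact: exprn_gt0.
have bs1 : bs <= 1 by rewrite exprn_ile1// ltW.
pose N0 := (Num.bound (8 * K / zeta)).+1.
have N0P : 8 * K / zeta <= N0%:R.
  apply: le_trans (ltW (archi_boundP _)) _; first by rewrite divr_ge0 ?mulr_ge0 ?ltW.
  by rewrite ler_nat.
have N0gt : (0 < N0)%N by [].
(* Consecutive scales have the ratio [bs / 6] of [scales_small]; the start [bs / 2] leaves room
   below [bs] for the shift. *)
pose b j := bs / 2 * (bs / 6) ^+ j.
have b0 j : 0 < b j by rewrite mulr_gt0// ?exprn_gt0// divr_gt0.
have b_succ j : b j.+1 = b j * (bs / 6) by rewrite /b exprSr mulrA.
have ble j : b j.+1 <= b j by rewrite b_succ ler_piMr ?(ltW (b0 j))// ler_pdivrMr//; lra.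
have b_bs j : b j <= bs / 2.
  by elim: j => [|j IH]; [rewrite /b expr0 mulr1 | exact: le_trans (ble j) IH].
have bmin i j : (i <= j)%N -> b j <= b i.
  by move=> /subnK <-; elim: (j - i)%N => [//|m IH]; exact: le_trans (ble _) IH.
pose bm := b N0; have bm0 : 0 < bm by exact: b0.
have bm_le i : (i <= N0)%N -> bm <= b i by exact: bmin.
have bm1 : bm <= 1 by have := b_bs N0; rewrite -/bm; lra.
(* Small enough at once for [3 e3 <= e], [e3 <= zeta / 4] and [e3 <= bs / 12]. *)
pose e3 := e * zeta * bs / 12.
have ez1 : e * zeta <= 1 by rewrite mulr_ile1 ?(ltW e0) ?(ltW zeta0)//; lra.
have ez0 : 0 < e * zeta by exact: mulr_gt0.
have e30 : 0 < e3 by rewrite divr_gt0// mulr_gt0.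
have e3e : 3 * e3 <= e.
  have : zeta * bs <= 1 by rewrite mulr_ile1// ltW.
  by move=> /(ler_wpM2l (ltW e0)); rewrite /e3 mulrA; lra.
have e3z : e3 <= zeta / 4.
  have : e * bs <= 1 by rewrite mulr_ile1 ?(ltW e0) ?(ltW bs0)//; lra.
  by move=> /(ler_wpM2l (ltW zeta0)); rewrite /e3 mulrAC mulr1 [zeta * _]mulrC; lra.
have e3b : e3 <= bs / 12 by have := ler_wpM2r (ltW bs0) ez1; rewrite /e3; lra.
pose r := zeta * bm ^+ 2 / (4 * K ^+ 2).
have K20 : 0 < 4 * K ^+ 2 by rewrite mulr_gt0 ?exprn_gt0.
have r0 : 0 < r by rewrite divr_gt0// mulr_gt0// exprn_gt0.
have b_le1 j : b j <= 1 by have := b_bs j; lra.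
have b_e3 j : b j + e3 <= bs by have := b_bs j; lra.
have rdef : r = zeta * bm ^+ 2 / (4 * K ^+ 2) by [].
have kroot : zeta `^ D%:R^-1 = k by rewrite powR_root// ltW.
have broot : bs `^ (D%:R * n.+1%:R)^-1 = k.
  by rewrite -natrM powR_root ?muln_gt0 ?D0// ltW.
(* The constants up to here depend on [H], [K] and [e] only; from now on just the relations recorded
   above are used. *)
clearbody e3 r N0 bm b zeta bs k.
have [p1 /andP[p10 p11] p1P] := @ln_inv_large R e (4 * K / zeta) e0.
exists (Num.min p1 (Num.min r 2^-1)).
  by rewrite lt_min p10 lt_min r0 invr_gt0 ltr0n/= gt_min p11.
move=> p; rewrite !lt_min => /and4P[p0 pp1 pr ph] W gW.
set q := p ^+ D; set L := ln p^-1; set EI := int2 _ => EIle tW.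
have hp : 0 < p < 1 by rewrite p0/= (lt_le_trans ph)// invf_le1// ler1n.
have [L1 LM Le] : [/\ 1 <= L, 4 * K / zeta <= L & 2 * ln L + 1 <= e * L].
  by apply: p1P; rewrite p0.
have L0 : 0 < L by exact: lt_le_trans L1.
have q0 : 0 < q by exact: exprn_gt0.
have qp : q <= p.
  by rewrite /q -[leRHS]expr1; apply: ler_wiXn2l => //; rewrite ltW//; case/andP: hp.
have qr : q <= r by exact: le_trans (ltW pr).
have q1 : q <= 1 by case/andP: hp => _ /ltW; exact: le_trans.
pose kap := L ^- 2; have kap0 : 0 < kap by rewrite invr_gt0 exprn_gt0.
pose theta := int2 (heavy W kap).
have th0 : 0 <= theta by apply: int2_ge0; exact: kernel_heavy.
have EI_theta : (1 - e) * L * theta <= EI by apply: heavy_entropy => //; apply: le_trans e2 _; rewrite invf_le1// ler1n.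
have thK : 2 * theta <= K * q by apply: mass_le_of_entropy L0 e2 th0 EI_theta EIle.
have [j jN midP] := @scale_pigeonhole R W kap b N0 gW (fun j => introT andP (conj (b0 _) (ble j))) N0gt.
have blh := ble j; have bl0 := b0 j.+1; have bh0 := b0 j.
have bmj : bm <= b j by exact/bm_le/ltnW.
pose A := heavy W kap; pose Z := rest W kap p (b j) (b j.+1).
pose hb := hub W kap (b j); pose lo := low W kap (b j.+1).
pose h := int01 hb; pose eps := q * e3.
have eps0 : 0 < eps by exact: mulr_gt0.
have epse3 : eps <= e3 by rewrite ler_piMl// ltW.
have h0 : 0 <= h by apply: int01_ge0 => u; rewrite /hb; case: (hub01 W kap (b j) u) => ->.
have hq : h <= K * q / b j.
  by apply: le_trans (hub_mass kap gW bl0 blh) _; rewrite ler_pM2r ?invr_gt0.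
have e34 : e3 <= 4^-1.
  by apply: le_trans e3z _; rewrite ler_piMl// invr_ge0.
have F1 : theta + eps <= K * q by apply: mass_add_small => //; exact: ltW.
have F2 : 4 * kap * EI + 2 * theta / N0%:R + eps <= zeta * q.
  by apply: (rest_mass_small (K := K)) => //; rewrite ltr0n.
have bj1 := b_le1 j.
have F3 : h ^+ 2 + eps <= zeta * q.
  exact: (hub_hub_small (K := K) (r := r) (bm := bm) (b := b j)).
have F4 : h + eps <= zeta.
  exact: (hub_small (K := K) (r := r) (bm := bm) (b := b j)).
have F6 : (h + eps) * (b j.+1 + eps) / (K * q) <= bs.
  exact: (scales_small (r := r) (zeta := zeta) (bm := bm) (b := b j)).
have F5 : b j.+1 + eps <= bs by apply: le_trans (b_e3 j.+1); rewrite lerD2l.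
have kA : bounded_kernel A by exact: kernel_heavy.
have kZ : bounded_kernel Z by exact: kernel_rest.
have mh : bounded_measurable hb by exact: measurable_hub.
have ml : bounded_measurable lo by exact: measurable_low.
have A01 : forall x y, 0 <= A x y <= 1 := heavy01 kap gW.
have hb01 : forall x, hb x = 0 \/ hb x = 1 := hub01 W kap (b j).
have lo01 : forall x, lo x = 0 \/ lo x = 1 := low01 W kap (b j.+1).
have kxy (f g : R -> R) : bounded_measurable f -> bounded_measurable g ->
    bounded_kernel (fun x y => A x y * f x * g y).
  move=> mf mg; apply: bounded_kernelM; last exact: bounded_kernel_snd.
  by apply: bounded_kernelM => //; exact: bounded_kernel_fst.
pose m1 := int2 (fun x y => A x y * hb x * lo y).
pose m2 := int2 (fun x y => A x y * lo x * hb y).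
pose m3 := int2 (fun x y => A x y * lo x * lo y).
have m10 : 0 <= m1 by exact/int2_ge0/kxy.
have m20 : 0 <= m2 by exact/int2_ge0/kxy.
have m30 : 0 <= m3 by exact/int2_ge0/kxy.
have msum : m1 + m2 + m3 <= theta := class_mass_sum kap gW blh.
(* The shift enters the normalized masses, which makes them positive even where a mass vanishes. *)
have thP (m : R) : 0 <= m ->
    exists th, [/\ 0 < th, th = m / q + e3 & th * q = m + eps].
  move=> m0; exists (m / q + e3); split => //; first by rewrite ltr_wpDl// divr_ge0// ltW.
  by rewrite mulrDl divfK ?gt_eqF// [e3 * q]mulrC.
have [th1 [t1 th1E t1q]] := thP _ m10; have [th2 [t2 th2E t2q]] := thP _ m20.
have [eta [t3 etaE t3q]] := thP _ m30.
exists th1, th2, eta; split => //.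
  by rewrite th1E th2E etaE; exact: (cost_le q0 L0 e0 e2 e30 e3e EI_theta msum).
pose x := Num.max th1 th2.
pose c (S : {set 'I_n}) := x ^+ vplus E S * x ^+ vminus E S *
  (Num.min x x) ^+ vpm E S * (th1 / x) `^ aS E S * (th2 / x) `^ bS E S.
have x0 : 0 <= x by rewrite le_max ltW.
have DR0 : 0 <= D%:R^-1 :> R by rewrite invr_ge0.
have he0 : 0 <= h + eps by rewrite addr_ge0// ltW.
have tau0 : 0 <= (D%:R * n.+1%:R)^-1 :> R by rewrite invr_ge0 mulr_ge0.
have pN0 : 0 < p ^+ N by exact: exprn_gt0.
have hyp_massA s t : int2 (fun x y => A x y * cls hb lo s x * cls hb lo t y) + eps <= K * q.
  by apply: le_trans F1; rewrite lerD2r; exact: class_mass.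
have hyp_massZ : int2 (fun x y => Z x y ^+ D) + eps <= zeta * q.
  apply: le_trans F2; rewrite lerD2r.
  apply: le_trans (rest_mass gW hp kap0 blh D2) _.
  by rewrite -/EI lerD2l; exact: midP.
have hyp_hh : int2 (fun x y => A x y * hb x * hb y) + eps <= zeta * q.
  by apply: le_trans F3; rewrite lerD2r; exact: hub_hub_mass.
have hyp_b1 y : int01 (fun v => A v y * lo v * lo y) + eps <= b j.+1 + eps.
  by rewrite lerD2r; exact: low_row.
have hyp_b2 y : int01 (fun v => A y v * lo y * lo v) + eps <= b j.+1 + eps.
  by rewrite lerD2r; exact: low_col.
have be0 : 0 <= b j.+1 + eps by rewrite addr_ge0// ltW.
have khub : (h + eps) `^ D%:R^-1 <= k.
  by rewrite -kroot ge0_ler_powR ?nnegrE// ltW.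
have kbeta : (b j.+1 + eps) `^ (D%:R * n.+1%:R)^-1 <= k.
  by rewrite -broot ge0_ler_powR ?nnegrE ?(ltW bs0).
have kmix : ((h + eps) * (b j.+1 + eps) / (K * q)) `^ (D%:R * n.+1%:R)^-1 <= k.
  rewrite -broot ge0_ler_powR ?nnegrE ?(ltW bs0)//.
  by apply: divr_ge0; apply: mulr_ge0 => //; exact: ltW.
have kz : zeta `^ D%:R^-1 <= k by rewrite kroot.
have c0 S : indepHstar E S -> 0 <= c S.
  move=> _; rewrite /c; repeat (apply: mulr_ge0; last exact: powR_ge0).
  by rewrite !mulr_ge0 ?exprn_ge0// minxx.
have Z01 : forall x y, 0 <= Z x y <= 1 := rest01 kap gW hp blh.
have hc S : indepHstar E S -> term p A Z hb lo (@hub_label n E S) <= p ^+ N * c S.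
  move=> iS; rewrite -ler_pdivrMl//.
  apply: (hub_coefficient_le Hloop D2 iS t1 t2 erefl) => w mw.
  rewrite ler_pdivrMl//.
  apply: (hub_term_le Hloop hp D2 kA kZ A01 Z01 mh ml hb01 lo01 iS mw eps0 t1 t2).
    by rewrite t1q.
  by rewrite t2q.
have hc' : regular E -> term p A Z hb lo (@low_label n E) <= p ^+ N * eta `^ (n%:R / 2).
  move=> rE; apply: (low_term_le Hloop hp D2 kA kZ A01 Z01 mh ml hb01 lo01 eps0 t3 rE).
  by rewrite t3q.
have dens := density_le Hloop Hconn hp D2 kA kZ A01 Z01 mh ml hb01 lo01
  (hub_low W kap blh) K1 zeta0 (le_trans zeta1 K1) eps0 hyp_massA hyp_massZ hyp_hh
  hyp_b1 hyp_b2 kz khub kbeta kmix (kernelW gW) (split_le W kap (b j) (b j.+1) hp)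
  c0 (powR_ge0 eta (n%:R / 2)) hc hc'.
have {dens} := le_trans tW dens.
rewrite lee_fin [X in X <= _]mulrC ler_pM2l// => dens.
rewrite lerBlDr; apply: le_trans dens _; rewrite lerD2l.
by apply: le_trans Ck; rewrite /C mulrA lexx.
Qed.

End Key.

(** * The variational problem and the lower bound *)

Section Variational.
Variables (R : realType) (n : nat) (E : rel 'I_n).
Hypotheses (Hloop : irreflexive E) (D2 : (2 <= maxdeg E)%N).
Variable delta : R.
Hypothesis delta0 : 0 < delta.
Implicit Types x y : R.

Let coef x1 x2 y1 y2 (S : {set 'I_n}) : R :=
  x1 ^+ vplus E S * x2 ^+ vminus E S * (Num.min x1 x2) ^+ vpm E S
     * y1 `^ aS E S * y2 `^ bS E S.

Let coef_ge0 x1 x2 y1 y2 S : 0 <= x1 -> 0 <= x2 -> 0 <= coef x1 x2 y1 y2 S.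
Proof.
move=> x10 x20; rewrite /coef -mulrA mulr_ge0//.
  by rewrite !mulr_ge0 ?exprn_ge0// le_min x10.
by rewrite mulr_ge0// powR_ge0.
Qed.

Lemma powR_le1 (y a : R) : 0 <= y <= 1 -> 0 <= a -> y `^ a <= 1.
Proof.
move=> /andP[y0 y1] a0; rewrite -[leRHS](_ : 1 `^ a = 1); last by rewrite powR1.
by rewrite ge0_ler_powR ?nnegrE.
Qed.

Lemma indep0 : indepHstar E finset.set0.
Proof. by apply/andP; split; apply/forall_inP => v; rewrite inE. Qed.

Let coef0 x1 x2 y1 y2 : 0 <= y1 <= 1 -> 0 <= y2 <= 1 -> coef x1 x2 y1 y2 finset.set0 <= 1.
Proof.
move=> hy1 hy2; have [a0 b0 _] := aS_bS_ge R Hloop D2 indep0.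
have := vertex_sign_count D2 indep0; rewrite cards0 => /eqP.
rewrite !addn_eq0 => /andP[/andP[/eqP v1 /eqP v2] /eqP v3].
rewrite /coef v1 v2 v3 !expr0 !mul1r mulr_ile1 ?powR_ge0//; exact: powR_le1.
Qed.

(** The three vertex counts add up to [#|S|], so along a ray in [(x1, x2)] the function [g_H] is a
    polynomial with nonnegative coefficients. *)
Lemma gH_scale t x1 x2 y1 y2 : 0 <= t -> gH E (t * x1) (t * x2) y1 y2 =
  \sum_(S | indepHstar E S) t ^+ #|S| * coef x1 x2 y1 y2 S.
Proof.
move=> t0; apply: eq_bigr => S iS.
have -> : Num.min (t * x1) (t * x2) = t * Num.min x1 x2 by rewrite minr_pMr.
rewrite -(vertex_sign_count D2 iS) !exprD !exprMn /coef; ring.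
Qed.

Lemma gH_scaleE t x1 x2 y1 y2 : 0 <= t -> gH E (t * x1) (t * x2) y1 y2 =
  coef x1 x2 y1 y2 finset.set0 +
  \sum_(S | indepHstar E S && (S != finset.set0)) t ^+ #|S| * coef x1 x2 y1 y2 S.
Proof.
by move=> t0; rewrite gH_scale// (bigD1 finset.set0)/= ?indep0// cards0 expr0 mul1r.
Qed.

Section Point.
Variables x1 x2 y1 y2 : R.
Hypotheses (x10 : 0 <= x1) (x20 : 0 <= x2) (hy1 : 0 <= y1 <= 1) (hy2 : 0 <= y2 <= 1).

Let g1E : gH E x1 x2 y1 y2 = coef x1 x2 y1 y2 finset.set0 +
  \sum_(S | indepHstar E S && (S != finset.set0)) coef x1 x2 y1 y2 S.
Proof.
have := gH_scaleE x1 x2 y1 y2 ler01; rewrite !mul1r => ->; congr (_ + _).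
by apply: eq_bigr => S _; rewrite expr1n mul1r.
Qed.

(** The empty set contributes at most 1 and every other term grows at least linearly, so the excess
    over 1 grows at least by the factor [t]; [gH_shrink] is the mirror image. *)
Lemma gH_expand t : 1 <= t ->
  1 + t * (gH E x1 x2 y1 y2 - 1) <= gH E (t * x1) (t * x2) y1 y2.
Proof.
move=> t1; rewrite gH_scaleE ?(le_trans ler01)// g1E.
have c0 := coef0 x1 x2 hy1 hy2.
have h : t * \sum_(S | indepHstar E S && (S != finset.set0)) coef x1 x2 y1 y2 S <=
    \sum_(S | indepHstar E S && (S != finset.set0)) t ^+ #|S| * coef x1 x2 y1 y2 S.
  rewrite mulr_sumr; apply: ler_sum => S /andP[_ S0].
  rewrite ler_wpM2r ?coef_ge0//; move: S0; rewrite -card_gt0.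
  by case: #|S| => // m _; rewrite exprS ler_peMr ?(le_trans ler01)// exprn_ege1.
by nra.
Qed.

Lemma gH_shrink t : 0 <= t <= 1 ->
  gH E (t * x1) (t * x2) y1 y2 <= 1 + t * (gH E x1 x2 y1 y2 - 1).
Proof.
move=> /andP[t0 t1]; rewrite gH_scaleE// g1E.
have c0 := coef0 x1 x2 hy1 hy2.
have h : \sum_(S | indepHstar E S && (S != finset.set0)) t ^+ #|S| * coef x1 x2 y1 y2 S <=
    t * \sum_(S | indepHstar E S && (S != finset.set0)) coef x1 x2 y1 y2 S.
  rewrite mulr_sumr; apply: ler_sum => S /andP[_ S0].
  rewrite ler_wpM2r ?coef_ge0//; move: S0; rewrite -card_gt0.
  by case: #|S| => // m _; rewrite exprS ler_piMr// exprn_ile1.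
by nra.
Qed.

(** Intermediate value theorem for the polynomial of [gH_scale], whose value at [t = 0] is at most
    1. *)
Lemma gH_attain : 1 + delta <= gH E x1 x2 y1 y2 ->
  exists2 t, 0 <= t <= 1 & gH E (t * x1) (t * x2) y1 y2 = 1 + delta.
Proof.
move=> g1; pose P : {poly R} :=
  \sum_(S | indepHstar E S) (coef x1 x2 y1 y2 S)%:P * 'X^#|S| - (1 + delta)%:P.
have PE t : 0 <= t -> P.[t] = gH E (t * x1) (t * x2) y1 y2 - (1 + delta).
  move=> t0; rewrite gH_scale// /P hornerD hornerN hornerC horner_sum; congr (_ - _).
  by apply: eq_bigr => S _; rewrite hornerM hornerC hornerXn mulrC.
have P0 : P.[0] <= 0.
  rewrite PE// subr_le0; apply: le_trans (gH_shrink _) _; first by rewrite lexx ler01.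
  by rewrite mul0r addr0 lerDl ltW.
have P1 : 0 <= P.[1] by rewrite PE// !mul1r subr_ge0.
have [|t t01 /rootP Pt] := @poly_ivt R P 0 1 ler01.
  by rewrite P0.
exists t => //; apply/eqP; rewrite -subr_eq0 -PE ?Pt//.
by case/andP: t01.
Qed.

(** Shrinking [x1] and [x2] until equality holds only lowers the cost, so the constraint may be read
    as an inequality. *)
Lemma GHdelta_le : 1 + delta <= gH E x1 x2 y1 y2 ->
  GHdelta E delta <= x1 * y1 + x2 * y2.
Proof.
move=> /gH_attain[t /andP[t0 t1] gt].
have /andP[y10 _] := hy1; have /andP[y20 _] := hy2.
apply: (@le_trans _ _ (t * x1 * y1 + t * x2 * y2)); last first.
  by apply: lerD; rewrite ler_wpM2r// ler_piMl.
apply: ge_inf.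
  exists 0 => _ [u1 [u2 [v1 [v2 [[u10 u20 /andP[v10 _] /andP[v20 _]] [_ ->]]]]]].
  by rewrite addr_ge0// mulr_ge0.
exists (t * x1), (t * x2), y1, y2; split; last by split.
by split => //; rewrite mulr_ge0.
Qed.

Lemma GHdelta_y1_le : Num.max y1 y2 = 1 -> 1 + delta <= gH E x1 x2 y1 y2 ->
  GHdelta_y1 E delta <= x1 * y1 + x2 * y2.
Proof.
move=> y12 /gH_attain[t /andP[t0 t1] gt].
have /andP[y10 _] := hy1; have /andP[y20 _] := hy2.
apply: (@le_trans _ _ (t * x1 * y1 + t * x2 * y2)); last first.
  by apply: lerD; rewrite ler_wpM2r// ler_piMl.
apply: ge_inf.
  exists 0 => _ [u1 [u2 [v1 [v2 [[u10 u20 /andP[v10 _] /andP[v20 _]] [_ [_ ->]]]]]]].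
  by rewrite addr_ge0// mulr_ge0.
exists (t * x1), (t * x2), y1, y2; split; last by split.
by split => //; rewrite mulr_ge0.
Qed.

End Point.

Lemma indep_singleton v : deg E v = maxdeg E -> indepHstar E [set v].
Proof.
move=> dv; apply/andP; split; apply/forall_inP => u; rewrite inE => /eqP ->.
  by rewrite dv.
by apply/forall_inP => w; rewrite inE => /eqP ->; rewrite Hloop.
Qed.

(** The singleton of a vertex of maximum degree already contributes [1 + delta]. With [gH_attain]
    this yields a feasible point, so the infima are over nonempty sets. *)
Lemma gH_large : 1 + delta <= gH E (1 + delta) (1 + delta) 1 1.
Proof.
have [v dv] := maxdeg_attained (leq_trans (isT : (0 < 2)%N) D2).
have iv := indep_singleton dv.
have d1 : 0 <= 1 + delta by rewrite addr_ge0// ltW.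
have cv : coef (1 + delta) (1 + delta) 1 1 [set v]%SET = 1 + delta.
  by rewrite /coef minxx -!exprD (vertex_sign_count D2 iv) cards1 !powR1 expr1 !mulr1.
rewrite -[leLHS]cv /gH (bigD1 [set v]%SET)//= lerDl.
by apply: sumr_ge0 => S _; exact: coef_ge0.
Qed.

(** Moving the factor [y] from [y1], [y2] to [x1], [x2] keeps the cost and multiplies the term of
    [S] by [y] to the power [#|S| - a_S - b_S <= 0], which is at least 1. For [y = 0] only the empty
    set could contribute, and [g_H] would be at most 1. *)
Lemma gH_normalize x1 x2 y1 y2 : 0 <= x1 -> 0 <= x2 -> 0 <= y1 <= 1 -> 0 <= y2 <= 1 ->
  gH E x1 x2 y1 y2 = 1 + delta -> let y := Num.max y1 y2 in
  0 < y /\ 1 + delta <= gH E (y * x1) (y * x2) (y1 / y) (y2 / y).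
Proof.
move=> x10 x20 hy1 hy2 gE y.
have /andP[y10 y11] := hy1; have /andP[y20 y21] := hy2.
have y_ge0 : 0 <= y by rewrite le_max y10.
have y_le1 : y <= 1 by rewrite ge_max y11.
have y0 : 0 < y.
  rewrite lt_neqAle y_ge0 andbT eq_sym; apply/negP => /eqP y_eq0.
  have y1E : y1 = 0 by apply/eqP; rewrite eq_le y10 andbT -y_eq0 le_max lexx.
  have y2E : y2 = 0 by apply/eqP; rewrite eq_le y20 andbT -y_eq0 le_max lexx orbT.
  have : gH E x1 x2 y1 y2 <= 1.
    have := gH_scaleE x1 x2 y1 y2 ler01; rewrite !mul1r => ->.
    rewrite big1 ?addr0; first exact: coef0.
    move=> S /andP[iS S0]; have [a0 b0 ab] := aS_bS_ge R Hloop D2 iS.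
    rewrite expr1n mul1r /coef y1E y2E.
    have : 0 < aS E S + bS E S :> R.
      by apply: lt_le_trans ab; rewrite ltr0n card_gt0.
    have [->|aN0] := eqVneq (aS E S) (0 : R).
      by rewrite add0r => b1; rewrite (powR0 (x := bS E S)) ?mulr0// gt_eqF.
    by rewrite (powR0 aN0) mulr0 mul0r.
  by rewrite gE gerDl leNgt delta0.
split => //; rewrite -gE gH_scale//; apply: ler_sum => S iS.
have [a0 b0 ab] := aS_bS_ge R Hloop D2 iS.
have yE (z a : R) : 0 <= z -> z `^ a = y `^ a * (z / y) `^ a.
  move=> z0; rewrite -powRM ?divr_ge0//.
  by rewrite mulrCA divff ?mulr1// gt_eqF.
rewrite /coef (yE y1)// (yE y2)//.
set c := x1 ^+ _ * _ * _; have c0 : 0 <= c.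
  by rewrite /c !mulr_ge0 ?exprn_ge0// le_min x10.
clearbody c.
have -> : c * (y `^ aS E S * (y1 / y) `^ aS E S) * (y `^ bS E S * (y2 / y) `^ bS E S) =
    (y `^ aS E S * y `^ bS E S) * (c * (y1 / y) `^ aS E S * (y2 / y) `^ bS E S) by ring.
rewrite ler_wpM2r ?mulr_ge0 ?powR_ge0//.
rewrite -powRD; last by apply/implyP => _; rewrite gt_eqF.
by rewrite -powR_mulrn// ger_powR// y0.
Qed.

Lemma GHdelta_y1E : GHdelta_y1 E delta = GHdelta E delta.
Proof.
have d1 : 0 <= 1 + delta by rewrite addr_ge0// ltW.
have one01 : 0 <= (1 : R) <= 1 by rewrite ler01 lexx.
have [t /andP[t0 t1] gt] := gH_attain d1 d1 one01 one01 gH_large.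
have td : 0 <= t * (1 + delta) by rewrite mulr_ge0.
apply/eqP; rewrite eq_le; apply/andP; split; last first.
  apply: lb_le_inf.
    eexists; exists (t * (1 + delta)), (t * (1 + delta)), 1, 1; split; first by split.
    by split; first exact: maxxx.
  move=> _ [x1 [x2 [y1 [y2 [[x10 x20 hy1 hy2] [_ [gE ->]]]]]]].
  by apply: GHdelta_le => //; rewrite gE.
apply: lb_le_inf.
  by eexists; exists (t * (1 + delta)), (t * (1 + delta)), 1, 1; split; first by split.
move=> _ [x1 [x2 [y1 [y2 [[x10 x20 hy1 hy2] [gE ->]]]]]].
have [] := gH_normalize x10 x20 hy1 hy2 gE; set y := Num.max y1 y2 => y0 g1.
have /andP[y10 _] := hy1; have /andP[y20 _] := hy2.
have yN0 : y != 0 by rewrite gt_eqF.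
have -> : x1 * y1 + x2 * y2 = (y * x1) * (y1 / y) + (y * x2) * (y2 / y) by field.
apply: GHdelta_y1_le => //.
- by rewrite mulr_ge0// ltW.
- by rewrite mulr_ge0// ltW.
- by rewrite divr_ge0 ?(ltW y0)//= ler_pdivrMr// mul1r le_max lexx.
- by rewrite divr_ge0 ?(ltW y0)//= ler_pdivrMr// mul1r le_max lexx orbT.
- by rewrite -maxr_pMl ?invr_ge0 ?(ltW y0)// divff.
Qed.

Lemma GHdelta_ge0 : 0 <= GHdelta E delta.
Proof.
have d1 : 0 <= 1 + delta by rewrite addr_ge0// ltW.
have one01 : 0 <= (1 : R) <= 1 by rewrite ler01 lexx.
have [t /andP[t0 t1] gt] := gH_attain d1 d1 one01 one01 gH_large.
apply: lb_le_inf.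
  eexists; exists (t * (1 + delta)), (t * (1 + delta)), 1, 1; split => //.
  by split => //; rewrite mulr_ge0.
move=> _ [x1 [x2 [y1 [y2 [[x10 x20 /andP[y10 _] /andP[y20 _]] [_ ->]]]]]].
by rewrite addr_ge0// mulr_ge0.
Qed.

End Variational.

(** * From normalized masses to the lower bound *)

Section LowerBound.
Variables (R : realType) (n : nat) (E : rel 'I_n).
Hypotheses (Hloop : irreflexive E) (Hconn : connected_digraph E).
Hypothesis D2 : (2 <= maxdeg E)%N.
Variable delta : R.
Hypothesis delta0 : 0 < delta.

Lemma cost_contradiction (c s e eps : R) : 0 <= c -> 0 < e -> e < delta ->
  e * (delta + c * (1 + delta)) <= delta * eps -> e <= 2^-1 ->
  c <= delta / (delta - e) * s -> (1 - e) * s < c - eps + e -> False.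
Proof.
move=> c0 e0 ed ee e2 cs scost.
have de : 0 < delta - e by rewrite subr_gt0.
have cs' : c * (delta - e) <= delta * s.
  by move: cs; rewrite mulrAC ler_pdivlMr.
have e1 : 0 <= 1 - e by lra.
have h1 := ler_wpM2r e1 cs'.
have h2 : delta * ((1 - e) * s) < delta * (c - eps + e) by rewrite ltr_pM2l.
have h3 : 0 <= c * (e * e) by rewrite !mulr_ge0// ltW.
lra.
Qed.

(** A graphon violating the bound has entropy below [(c - eps) q L], so [entropy_key] applies with
    [K = 4 (c + 1)]. Its count falls short of [1 + delta] by [e], and [delta / (delta - e)] is the
    price of the repair. *)
Lemma asymp_lower_bound_of_cost (c : R) : 0 <= c ->
  (forall e th1 th2 eta, 0 < e < delta -> 0 < th1 -> 0 < th2 -> 0 < eta ->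
    1 + delta - e <=
      gH E (Num.max th1 th2) (Num.max th1 th2)
           (th1 / Num.max th1 th2) (th2 / Num.max th1 th2) +
      (if `[< regular E >] then eta `^ (n%:R / 2) else 0) ->
    c <= delta / (delta - e) * (th1 + th2 + eta)) ->
  asymp_lower_bound E delta c.
Proof.
move=> c0 cost eps eps0.
pose M := delta + c * (1 + delta).
have M0 : 0 < M.
  have := mulr_ge0 c0 (ltW delta0); rewrite /M; have := delta0; lra.
pose e := Num.min 2^-1 (Num.min (delta / 2) (delta * eps / M)).
have e0 : 0 < e.
  rewrite !lt_min; apply/and3P; split; first by rewrite invr_gt0.
    exact: divr_gt0.
  by apply: divr_gt0 => //; exact: mulr_gt0.
have e2 : e <= 2^-1 by rewrite ge_min lexx.
have ed : e < delta.
  apply: (@le_lt_trans _ _ (delta / 2)); first by rewrite !ge_min lexx orbT.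
  by have := delta0; lra.
have eM : e * M <= delta * eps by rewrite -ler_pdivlMr// !ge_min lexx !orbT.
have K1 : 1 <= 4 * (c + 1) by lra.
have he : 0 < e <= 2^-1 by rewrite e0.
have [p0 /andP[p00 p01] key] := entropy_key Hloop Hconn D2 delta K1 he.
exists p0; split => // p /andP[pp ppp0].
have p1 : p < 1 by exact: lt_trans p01.
have hp : 0 < p < 1 by rewrite pp.
rewrite /Phi div1r; set Q := p ^+ maxdeg E * ln p^-1.
have Q0 : 0 < Q by rewrite mulr_gt0 ?exprn_gt0// ln_gt0// invf_gt1.
apply/ereal_infP => _ [W [gW tW] <-].
have [_ ->] := EIpE hp gW.
rewrite -EFinM lee_fin leNgt; apply/negP => EIlt.
have EIK : int2 (fun x y => Ip p (W x y)) <= 4 * (c + 1) / 4 * Q.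
  apply: le_trans (ltW EIlt) _; rewrite ler_wpM2r ?(ltW Q0)//; lra.
have hpp : 0 < p < p0 by rewrite pp.
have [th1 [th2 [eta [t1 t2 t3 costle g1]]]] := key p hpp W gW EIK tW.
have hed : 0 < e < delta by rewrite e0.
have cs := cost e th1 th2 eta hed t1 t2 t3 g1.
apply: (cost_contradiction c0 e0 ed eM e2 cs).
rewrite -(ltr_pM2r Q0); apply: le_lt_trans costle _.
by rewrite mulrDl ltrD2r.
Qed.

Section Cost.
Variables (e th1 th2 eta : R).
Hypotheses (he : 0 < e < delta) (t1 : 0 < th1) (t2 : 0 < th2) (t3 : 0 < eta).
Let x := Num.max th1 th2.
Let t := th1 + th2.
Let mu := delta / (delta - e).

Let de : 0 < delta - e. Proof. by rewrite subr_gt0; case/andP: he. Qed.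
Let mu1 : 1 <= mu.
Proof. by rewrite ler_pdivlMr// mul1r gerBl; case/andP: he => /ltW. Qed.
Let mu0 : 0 < mu. Proof. exact: lt_le_trans mu1. Qed.
Let x0 : 0 < x. Proof. by rewrite lt_max t1. Qed.
Let y1 : 0 <= th1 / x <= 1.
Proof.
apply/andP; split; first exact/ltW/divr_gt0.
by rewrite ler_pdivrMr// mul1r le_max lexx.
Qed.
Let y2 : 0 <= th2 / x <= 1.
Proof.
apply/andP; split; first exact/ltW/divr_gt0.
by rewrite ler_pdivrMr// mul1r le_max lexx orbT.
Qed.

(** By [gH_expand] the factor [mu] raises the excess from [delta - e] to [delta]. The scale [s] is 1
    or, when low vertices share the cost, [1 / lam]. *)
Lemma GHdelta_le_scaled (s : R) : 0 <= s ->
  1 + delta - e <= gH E (s * x) (s * x) (th1 / x) (th2 / x) ->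
  GHdelta E delta <= mu * (s * t).
Proof.
move=> s0 g1; have sx : 0 <= s * x by rewrite mulr_ge0// ltW.
have g2 := gH_expand Hloop D2 sx sx y1 y2 mu1.
have g3 : 1 + delta <= gH E (mu * (s * x)) (mu * (s * x)) (th1 / x) (th2 / x).
  apply: le_trans g2; rewrite lerD2l.
  apply: (@le_trans _ _ (mu * (delta - e))); first by rewrite /mu divfK// gt_eqF.
  by rewrite ler_wpM2l ?(ltW mu0)// lerBrDl addrA.
have sx' : 0 <= mu * (s * x) by rewrite mulr_ge0// ltW.
have := GHdelta_le Hloop D2 delta0 sx' sx' y1 y2 g3.
rewrite -mulrDr -mulrDl -/t -!mulrA [x * _]mulrCA divff ?mulr1//.
by rewrite gt_eqF.
Qed.

Lemma GHdelta_cost : 1 + delta - e <= gH E x x (th1 / x) (th2 / x) ->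
  GHdelta E delta <= mu * (t + eta).
Proof.
move=> g1; have := @GHdelta_le_scaled 1 ler01; rewrite !mul1r => /(_ g1) h.
apply: le_trans h _; rewrite ler_wpM2l ?(ltW mu0)// lerDl; exact: ltW.
Qed.

(* Splitting the cost [s] as [lam s + (1 - lam) s], the hub part of the count is
   at most [lam] times its value at full cost, and so is the clique part with
   [1 - lam]: one of the two already suffices at full cost. *)
Lemma min_cost : (1 < n)%N ->
  1 + delta - e <= gH E x x (th1 / x) (th2 / x) + eta `^ (n%:R / 2) ->
  Num.min (GHdelta E delta) (delta `^ (2 / n%:R)) <= mu * (t + eta).
Proof.
move=> n2 g1; pose s := t + eta; pose lam := t / s.
have t0 : 0 < t by rewrite addr_gt0.
have s0 : 0 < s by rewrite addr_gt0.
have lam0 : 0 < lam by rewrite divr_gt0.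
have lam1 : lam <= 1 by rewrite ler_pdivrMr// mul1r lerDl ltW.
have etaE : eta = (1 - lam) * s.
  by rewrite mulrBl mul1r /lam divfK ?gt_eqF// /s addrAC subrr add0r.
have nR : 0 < n%:R :> R by rewrite ltr0n (ltn_trans _ n2).
have n21 : 1 <= n%:R / 2 :> R by rewrite ler_pdivlMr// mul1r ler_nat.
have n20 : 0 <= n%:R / 2 :> R by rewrite (le_trans ler01).
have etap : eta `^ (n%:R / 2) <= (1 - lam) * s `^ (n%:R / 2).
  have l1 : 0 <= 1 - lam by rewrite subr_ge0.
  rewrite etaE powRM ?(ltW s0)// ler_wpM2r ?powR_ge0//.
  have [->|lN0] := eqVneq (1 - lam) 0.
    by rewrite powR0// gt_eqF// (lt_le_trans ltr01).
  by apply: ge1r_powR => //; rewrite lt_neqAle eq_sym lN0 l1/= gerBl ltW.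
have xl : 0 <= lam^-1 * x by rewrite mulr_ge0 ?invr_ge0 ?(ltW lam0) ?(ltW x0).
have lx : lam * (lam^-1 * x) = x by rewrite mulrA divff ?mul1r// gt_eqF.
have g2 := gH_shrink Hloop D2 xl xl y1 y2 (t := lam).
rewrite lx (ltW lam0) lam1 in g2.
have {}g2 := g2 isT.
set g' := gH E (lam^-1 * x) (lam^-1 * x) _ _ in g2.
have [h|h] := leP (1 + delta - e) g'.
  rewrite ge_min; apply/orP; left.
  have := GHdelta_le_scaled (s := lam^-1) _ h; rewrite invr_ge0 => /(_ (ltW lam0)).
  by rewrite /lam invf_div divfK// gt_eqF.
have sp : delta - e <= s `^ (n%:R / 2).
  (* Were both alternatives short, their average with weights [lam] and [1 - lam] would stay below
     [delta - e], against [g1]. *)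
  rewrite leNgt; apply/negP => h2.
  have h3 : lam * (g' - 1) < lam * (delta - e) by rewrite ltr_pM2l//; lra.
  have h4 : (1 - lam) * s `^ (n%:R / 2) <= (1 - lam) * (delta - e).
    by rewrite ler_wpM2l ?subr_ge0// ltW.
  by move: g1 etap; set gx := gH _ _ _ _ _ in g2 *; lra.
rewrite ge_min; apply/orP; right.
have ms : 0 <= mu * s by rewrite mulr_ge0 ?ltW.
have dm : delta <= (mu * s) `^ (n%:R / 2).
  rewrite powRM ?(ltW s0) ?(ltW mu0)//.
  have m1 : mu <= mu `^ (n%:R / 2) by exact: le1r_powR.
  apply: (@le_trans _ _ (mu * (delta - e))); first by rewrite /mu divfK// gt_eqF.
  by apply: ler_pM => //; exact: ltW.
have e20 : 0 <= 2 / n%:R :> R by rewrite divr_ge0// ltW.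
have := ge0_ler_powR e20 (ltW delta0 : delta \is Num.nneg) (powR_ge0 _ _ : _ \is Num.nneg) dm.
rewrite -powRrM (_ : n%:R / 2 * (2 / n%:R) = 1) ?powRr1//.
by field; rewrite gt_eqF.
Qed.

End Cost.
End LowerBound.

Theorem theorem1p6 (R : realType) (n : nat) (E : rel 'I_n)
  (Hloop : irreflexive E) (Hconn : connected_digraph E)
  (HDelta : (2 <= maxdeg E)%N) (delta : R) (Hdelta : 0 < delta) :
  (~ regular E -> asymp_lower_bound E delta (GHdelta E delta)) /\
  (regular E -> asymp_lower_bound E delta
                   (Num.min (GHdelta E delta) (delta `^ (2 / n%:R)))) /\
  GHdelta_y1 E delta = GHdelta E delta.
Proof.
have G0 : 0 <= GHdelta E delta by exact: GHdelta_ge0.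
(* A vertex of positive degree has an edge, whose two ends differ; [n >= 2] gives the exponent
   [n / 2 >= 1] on which [min_cost] relies. *)
have n2 : (1 < n)%N.
  have [v vD] := maxdeg_attained (ltnW HDelta).
  have /card_gt0P[e _] : (0 < #|[pred e : {e : 'I_n * 'I_n | E e.1 e.2} | inc e v]|)%N.
    by rewrite -(degE Hloop) vD ltnW.
  have := src_neq_tgt Hloop e; rewrite -val_eqE /= neq_ltn.
  by case/orP=> h; apply: leq_ltn_trans (ltn_ord _); apply: leq_ltn_trans h.
split; [|split].
- move=> nreg; apply: asymp_lower_bound_of_cost => // e th1 th2 eta he t1 t2 t3.
  by rewrite ifF ?addr0; [exact: GHdelta_cost | exact/asboolPn].
- move=> reg; apply: asymp_lower_bound_of_cost => //.
    by rewrite le_min G0 powR_ge0.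
  move=> e th1 th2 eta he t1 t2 t3.
  by rewrite ifT; [exact: min_cost | exact/asboolP].
- exact: GHdelta_y1E.
Qed.
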